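(* There exists a constant $\delta>0$ such that, for $n\equiv 1,3\pmod 6$, if $S$ is chosen uniformly at random from the set $\mathcal{S}_n$ of all Steiner triple systems on $n$ vertices, then asymptotically almost surely $$\alpha_3^*(S)\leq n^{1-\delta}.$$
   Context: A Steiner triple system is a $3$-uniform hypergraph in which each pair of distinct vertices is contained in exactly one edge; $\mathcal{S}_n$ is the family of all Steiner triple systems on a fixed (labelled) vertex set of size $n$, e.g. $\{1,\dots,n\}$. ''Asymptotically almost surely'' (a.a.s.) means with probability tending to $1$ as $n\to\infty$ (through $n\equiv 1,3\pmod 6$). $\alpha_3^*(H)$ is the maximum integer $a$ such that there exist pairwise disjoint sets $X_1,X_2,X_3\subseteq V(H)$ with $|X_1|=|X_2|=|X_3|=a$ such that for every $e\in E(H)$ there is $i\in\{1,2,3\}$ with $e\cap X_i=\emptyset$. *)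

(* Defs.v *)
From HB Require Import structures.
From mathcomp Require Import all_boot all_order all_algebra.
From mathcomp Require Import all_classical all_reals all_analysis.
Set Implicit Arguments.
Unset Strict Implicit.
Unset Printing Implicit Defensive.
Import Order.TTheory GRing.Theory Num.Theory.

Local Open Scope ring_scope.

(* A hypergraph on the finite vertex type T is given by its edge set. *)
Definition uniform_hypergraph (T : finType) (k : nat) (H : {set {set T}}) :
    bool :=
  [forall e in H, #|e| == k].

Definition steiner_triple_system (T : finType) (H : {set {set T}}) : bool :=
  uniform_hypergraph 3 H &&
  [forall x : T, forall y : T, (x != y) ==>
     (#|[set e in H | (x \in e) && (y \in e)]| == 1%N)].

Definition STS (n : nat) : {set {set {set 'I_n}}} :=
  [set S : {set {set 'I_n}} | steiner_triple_system S].

Definition tripartite_hole (T : finType) (H : {set {set T}}) (a : nat) : bool :=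
  [exists X : {ffun 'I_3 -> {set T}},
     [&& [forall i, #|X i| == a],
         [forall i, forall j, (i != j) ==> [disjoint X i & X j]]
       & [forall e in H, exists i, [disjoint e & X i]]]].

(* The bound on a loses nothing, since a = #|X i| <= #|T|; the maximum is over
   a nonempty range because a = 0 is always admissible. *)
Definition alpha3_star (T : finType) (H : {set {set T}}) : nat :=
  \max_(a < #|T|.+1 | tripartite_hole H a) a.

(* Probability that a uniformly random element of Omega satisfies P (equal to
   0 when Omega is empty). *)
Definition uniform_Pr (R : realType) (U : finType) (Omega : {set U})
    (P : pred U) : R :=
  #|[set w in Omega | P w]|%:R / #|Omega|%:R.

(* Main.v *)
Require Import Defs.
From HB Require Import structures.
From mathcomp Require Import all_boot all_order all_algebra.
From mathcomp Require Import reals sequences exp.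
From mathcomp Require Import zify ring lra.
Set Implicit Arguments.
Unset Strict Implicit.
Unset Printing Implicit Defensive.
Import Order.TTheory GRing.Theory Num.Theory.

(** The number of Steiner triple systems is compared with the number of those
    having a given hole [X1, X2, X3] of size [a]. Ordered prefixes of [M1] blocks,
    almost all of the [N = n (n - 1) / 6], are counted from below by the random
    triangle-removal process and from above by an AM-GM argument on the numbers of
    available triples. Per step the two counts agree up to [1 + O (1 / y ^ 2)],
    where [y] is a small power of [n], but a hole removes a proportion
    [6 (a / n) ^ 3 >= 6 / y] of the triples. The resulting factor
    [expR (- 5 M1 / y)] beats both the choices for the last [N - M1] blocks and
    the [8 ^ n] choices of the hole.

    The lower count needs prefixes that extend to complete systems. Split the
    points as [U1], [U2], [W] with [#|U1| = #|U2| = m] and [#|W| = w] a power of 3.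
    The process is run on [U1 :|: U2] until the density of uncovered pairs is
    slightly above [w / m], and then with triples inside [U1] or inside [U2] only,
    until the remaining inside pairs can be covered by triples whose third point
    lies on the other side, each point being used a prescribed number of times.
    What remains uncovered is a [w]-regular bipartite graph between [U1] and [U2].
    It is a union of [w] perfect matchings, which are matched up with the points
    of [W]; an affine triple system on [W] completes the design. *)

(** * Graphs and packings *)

(** The random process is not controlled down to a complete system, which is why the last stage is
    algebraic and needs the reserved set [W]. The price is that the counted prefixes avoid [W]. With
    [v = 1 / y] and [#|W| / n] about [v ^ 4], this changes the density of uncovered pairs by
    [O (v ^ 4)], a relative error [O (v ^ 2)] as long as the density is at least [v ^ 2]; the
    counted prefix stops there. The remaining blocks, at most [3 * v ^ 2 * N], are estimated by a
    factor [n ^ 3] each from above and by a single completion from below. The resulting loss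
    [expR (O (v ^ 2 * N * ln n))] is smaller than the gain because [v * ln n] is small. Hence no
    count of completions is needed, only the existence of one for every good prefix. To find it, the
    process runs on, uncounted, from density [v ^ 2] to about [w / m]. *)

Section Graphs.
Variable V : finType.
Implicit Types (G : rel V) (Q : {set {set V}}) (e : {set V}) (Z S : {set V}).

(** On the diagonal, [cov Q x x] only says that some block contains [x]; statements about pairs
    therefore carry [x != y] or concern disjoint sets. *)
Definition cov Q : rel V := fun x y => [exists e in Q, (x \in e) && (y \in e)].
Definition unc G Q : rel V := fun x y => G x y && ~~ cov Q x y.
Definition tri G : {set {set V}} :=
  [set e : {set V} | (#|e| == 3) &&
     [forall x in e, forall y in e, (x != y) ==> G x y]].
(** Every quantity followed by the process is the size of such a set: degrees and codegrees for one
    and two points in [Z], and up to four points for a later second moment argument. *)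
Definition cnbr G Z S : {set V} := [set x in S | [forall z in Z, G z x]].
Definition codeg G x y := #|cnbr G [set x; y] [set: V]|.
Definition ecount G := #|[set xy : V * V | G xy.1 xy.2]|.

Lemma triP G e : reflect (#|e| = 3 /\ {in e &, forall x y, x != y -> G x y})
  (e \in tri G).
Proof.
rewrite inE; apply: (iffP andP) => [[/eqP -> /forall_inP h]|[-> h]].
  by split=> // x y xe ye xy; move/forall_inP: (h x xe) => /(_ y ye)/implyP; apply.
split=> //; apply/forall_inP=> x xe; apply/forall_inP=> y ye.
by apply/implyP; apply: h.
Qed.

Lemma covU Q e x y : cov (e |: Q) x y = ((x \in e) && (y \in e)) || cov Q x y.
Proof.
apply/existsP/orP => [[f /andP[]]|[h|/existsP[f /andP[fQ h]]]].
- rewrite in_setU1 => /orP[/eqP ->|fQ] h; first by left.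
  by right; apply/existsP; exists f; rewrite fQ.
- by exists e; rewrite setU11.
- by exists f; rewrite in_setU1 fQ orbT.
Qed.

Lemma cov_sym Q x y : cov Q x y = cov Q y x.
Proof. by apply: eq_existsb => e; rewrite (andbC (x \in e)). Qed.

Lemma unc_sym G Q : symmetric G -> symmetric (unc G Q).
Proof. by move=> sG x y; rewrite /unc sG cov_sym. Qed.

Lemma unc_irr G Q : irreflexive G -> irreflexive (unc G Q).
Proof. by move=> iG x; rewrite /unc iG. Qed.

Lemma uncU G Q e x y :
  unc G (e |: Q) x y = unc G Q x y && ~~ ((x \in e) && (y \in e)).
Proof. by rewrite /unc covU negb_or -!andbA; congr (_ && _); rewrite andbC. Qed.

Lemma cov0 x y : cov set0 x y = false.
Proof. by apply/existsP=> -[e]; rewrite inE. Qed.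

Lemma unc0 G x y : unc G set0 x y = G x y.
Proof. by rewrite /unc cov0 andbT. Qed.

Lemma card3_pair (e : {set V}) x y : #|e| = 3 -> x \in e -> y \in e -> x != y ->
  exists z, [/\ z != x, z != y & e = [set x; y; z]].
Proof.
move=> c3 xe ye xy.
have /eqP/cards1P[z ez] : #|e :\ x :\ y| = 1.
  have := cardsD1 x e; have := cardsD1 y (e :\ x).
  by rewrite !inE xe ye eq_sym xy c3; lia.
have : z \in e :\ x :\ y by rewrite ez set11.
rewrite !inE => /and3P[zy zx ze]; exists z; split=> //.
apply/setP=> t; have /setP/(_ t) := ez; rewrite !inE.
have [->|tx] := eqVneq t x; first by rewrite xe.
by have [->|ty] := eqVneq t y; rewrite ?ye.
Qed.

Lemma cards3 (x y z : V) : x != y -> x != z -> y != z -> #|[set x; y; z]| = 3.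
Proof.
by move=> xy xz yz; rewrite setUC cardsU1 !inE cards2 xy eq_sym (negbTE xz) eq_sym (negbTE yz).
Qed.

Lemma card_pairs3 e : #|e| = 3 ->
  #|[set xy : V * V | [&& xy.1 \in e, xy.2 \in e & xy.1 != xy.2]]| = 6.
Proof.
move=> c3; transitivity (#|setX e e| - #|[set xy : V * V | (xy.1 == xy.2) && (xy.1 \in e)]|).
  rewrite -cardsDS; last first.
    by apply/fintype.subsetP=> -[x y]; rewrite !inE /= => /andP[/eqP <- ->].
  apply: eq_card => -[x y]; rewrite !inE /=.
  by case: (x \in e); case: (y \in e); rewrite ?andbF //= ?andbT.
rewrite cardsX c3.
suff -> : #|[set xy : V * V | (xy.1 == xy.2) && (xy.1 \in e)]| = #|e| by rewrite c3.
have inj : injective (fun x : V => (x, x)) by move=> x y [].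
rewrite -(card_imset (mem e) inj); congr #|pred_of_set _|.
apply/setP=> -[x y]; rewrite inE /=; apply/andP/imsetP => [[/eqP <- xe]|[z ze [-> ->]] //].
by exists x.
Qed.

Definition packing G Q :=
  (Q \subset tri G) && [forall x, forall y, (x != y) ==>
    (#|[set e in Q | (x \in e) && (y \in e)]| <= 1)].

Lemma packingP G Q : reflect (Q \subset tri G /\
    forall x y, x != y -> #|[set e in Q | (x \in e) && (y \in e)]| <= 1)
  (packing G Q).
Proof.
apply: (iffP andP) => -[h1 h2]; split=> //.
  by move=> x y xy; move/forallP: h2 => /(_ x)/forallP/(_ y)/implyP; apply.
by apply/forallP=> x; apply/forallP=> y; apply/implyP/h2.
Qed.

Lemma packing0 G : packing G set0.
Proof.
apply/packingP; split; first exact: sub0set.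
by move=> x y _; rewrite (_ : [set _ in _ | _] = set0) ?cards0 //; apply/setP=> e; rewrite !inE.
Qed.

Lemma tri_unc_sub G Q : tri (unc G Q) \subset tri G.
Proof.
apply/fintype.subsetP=> e /triP[c3 h]; apply/triP; split=> // x y xe ye xy.
by case/andP: (h x y xe ye xy).
Qed.

Lemma card_gt1_pair (e : {set V}) : 1 < #|e| -> exists x y, [/\ x \in e, y \in e & x != y].
Proof. by move/card_gt1P => [x [y [xe ye xy]]]; exists x, y. Qed.

Lemma tri_unc_notin G Q e : e \in tri (unc G Q) -> e \notin Q.
Proof.
move=> /triP[c3 h]; apply/negP => eQ.
have [|x [y [xe ye xy]]] := @card_gt1_pair e; first by rewrite c3.
have /andP[_ /negP] := h x y xe ye xy; apply; apply/existsP; exists e.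
by rewrite eQ xe.
Qed.

Lemma packingU G Q e : packing G Q -> e \in tri (unc G Q) -> packing G (e |: Q).
Proof.
move=> /packingP[h1 h2] he; apply/packingP; split.
  by rewrite subUset h1 sub1set (fintype.subsetP (tri_unc_sub G Q)).
move=> x y xy; have [xye|xye] := boolP ((x \in e) && (y \in e)).
  rewrite (_ : [set _ in _ | _] = [set e]) ?cards1 //.
  apply/setP=> f; rewrite !inE; have [->|fe] := eqVneq f e; first by rewrite xye.
  rewrite /=; apply/negbTE/negP => /and3P[fQ xf yf]; case/andP: xye => xe ye.
  have /triP[_ /(_ x y xe ye xy)/andP[_ /negP]] := he; apply.
  by apply/existsP; exists f; rewrite fQ xf.
rewrite (_ : [set _ in _ | _] = [set e in Q | (x \in e) && (y \in e)]) ?h2 //.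
by apply/setP=> f; rewrite !inE; have [->|//] := eqVneq f e; rewrite (negbTE xye) !andbF.
Qed.

Section SymG.
Variable G : rel V.
Hypotheses (sG : symmetric G) (iG : irreflexive G).

Lemma tri3P x y z : x != y -> x != z -> y != z ->
  ([set x; y; z] \in tri G) = [&& G x y, G x z & G y z].
Proof.
move=> xy xz yz; apply/triP/and3P => [[_ h]|[h1 h2 h3]].
  by split; apply: h; rewrite ?inE ?eqxx ?orbT.
split; first exact: cards3.
move=> s t; rewrite !inE -!orbA => /or3P[]/eqP-> /or3P[]/eqP->; rewrite ?eqxx //.
- by rewrite sG.
- by rewrite sG.
- by rewrite sG.
Qed.

Lemma G_neq x y : G x y -> x != y.
Proof. by apply: contraTneq => ->; rewrite iG. Qed.

Lemma cnbr2E x y z : (z \in cnbr G [set x; y] [set: V]) = G x z && G y z.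
Proof.
rewrite !inE /=; apply/forall_inP/andP => [h|[h1 h2] t].
  by split; apply: h; rewrite !inE eqxx ?orbT.
by rewrite !inE => /orP[]/eqP->.
Qed.

Lemma tri_edge x y : G x y ->
  #|[set e in tri G | (x \in e) && (y \in e)]| = codeg G x y.
Proof.
move=> gxy; have xy := G_neq gxy.
have inj : {in cnbr G [set x; y] [set: V] &, injective (fun z => [set x; y; z])}.
  move=> z t; rewrite !cnbr2E => /andP[/G_neq xz /G_neq yz] /andP[/G_neq xt /G_neq yt].
  move=> /setP/(_ z); rewrite !inE eqxx !orbT eq_sym (negbTE xz) eq_sym (negbTE yz).
  by move=> /esym/eqP.
rewrite /codeg -(card_in_imset inj); congr #|pred_of_set _|.
apply/setP=> e; apply/setIdP/imsetP => [[/triP[c3 h] /andP[xe ye]]|[z]].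
  have [z [zx zy ez]] := card3_pair c3 xe ye xy.
  exists z => //; rewrite cnbr2E.
  by rewrite !h // ?ez ?inE ?eqxx ?orbT // eq_sym.
rewrite cnbr2E => /andP[xz yz] ->; split; last by rewrite !inE !eqxx orbT.
by rewrite tri3P ?G_neq // gxy xz yz.
Qed.

Lemma tri_count : 6 * #|tri G| = \sum_(xy : V * V | G xy.1 xy.2) codeg G xy.1 xy.2.
Proof.
transitivity (\sum_(xy : V * V | G xy.1 xy.2) \sum_(e in tri G)
     ((xy.1 \in e) && (xy.2 \in e) : nat)).
  rewrite exchange_big /= -sum1_card big_distrr /=; apply: eq_bigr => e /triP[c3 h].
  rewrite muln1.
  rewrite -(card_pairs3 c3) -sum1_card -big_mkcondr /=; apply: eq_bigl => -[x y].
  rewrite !inE /=; case xe: (x \in e); case ye: (y \in e); rewrite ?andbF //= ?andbT.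
  by apply/idP/idP => [/h|/G_neq //]; apply.
apply: eq_bigr => -[x y] /= gxy; rewrite -tri_edge // -sum1_card -big_mkcondr /=.
by apply: eq_bigl => e; rewrite !inE.
Qed.

(** Choosing the triple [e] removes [x] from the common neighbourhood of [Z] exactly when [e] uses a
    pair joining [x] to [Z]. *)
Definition hit Z x e := (x \in e) && [exists z in Z, z \in e].

Lemma cnbr_unc Q e Z S : cnbr (unc G (e |: Q)) Z S =
  cnbr (unc G Q) Z S :\: [set x in cnbr (unc G Q) Z S | hit Z x e].
Proof.
apply/setP=> x; rewrite !inE.
have [xS|] := boolP (x \in S) => //=; rewrite ?andbF //.
have [h|h] := boolP [forall z in Z, unc G Q z x]; rewrite ?andbF /=.
  rewrite andbT /hit; apply/forall_inP/negP.
    move=> h2 /andP[xe /existsP[z /andP[zZ ze]]].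
    by move: (h2 z zZ); rewrite uncU xe ze andbF.
  move=> nh z zZ; rewrite uncU (forall_inP h) //=; apply/negP => /andP[ze xe].
  by apply: nh; rewrite xe /=; apply/existsP; exists z; rewrite zZ.
apply/negbTE; apply: contra h => /forall_inP h; apply/forall_inP => z zZ.
by move: (h z zZ); rewrite uncU => /andP[].
Qed.

Lemma ecount_unc Q e : e \in tri (unc G Q) ->
  ecount (unc G (e |: Q)) + 6 = ecount (unc G Q).
Proof.
move=> /triP[c3 h]; rewrite -(card_pairs3 c3) /ecount addnC -[RHS](cardsID
  [set xy : V * V | [&& xy.1 \in e, xy.2 \in e & xy.1 != xy.2]]); congr addn.
  apply: eq_card => -[x y]; rewrite !inE /=; apply/idP/andP => [/and3P[xe ye xy]|[_ ->] //].
  by split; [exact: h|rewrite xe ye].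
apply: eq_card => -[x y]; rewrite !inE /= uncU andbC.
by have [g|] := boolP (unc G Q x y); rewrite ?andbF //= (G_neq (andP g).1) !andbT.
Qed.

Lemma card_cnbr_unc Q e Z S :
  (#|cnbr (unc G (e |: Q)) Z S| + \sum_(x in cnbr (unc G Q) Z S) hit Z x e
   = #|cnbr (unc G Q) Z S|)%N.
Proof.
have -> : \sum_(x in cnbr (unc G Q) Z S) (hit Z x e : nat) =
   #|[set x in cnbr (unc G Q) Z S | hit Z x e]|.
  by rewrite -sum1_card -big_mkcondr; apply: eq_bigl => x; rewrite [RHS]inE.
rewrite cnbr_unc addnC.
rewrite -[RHS](cardsID [set x in cnbr (unc G Q) Z S | hit Z x e]).
congr addn; congr #|pred_of_set _|.
by apply/esym/setIidPr/fintype.subsetP=> x /setIdP[].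
Qed.

Lemma hit_le3 Q e Z S : #|e| = 3 -> \sum_(x in cnbr (unc G Q) Z S) hit Z x e <= 3.
Proof.
move=> <-; rewrite -sum1_card big_mkcond [X in _ <= X]big_mkcond /=.
apply: leq_sum => x _; rewrite /hit; case: (x \in cnbr _ _ _) => //.
by case: (x \in e); rewrite ?leq_b1.
Qed.

Lemma hit_count_le x Z : x \in cnbr G Z [set: V] ->
  #|[set e in tri G | hit Z x e]| <= \sum_(z in Z) codeg G z x.
Proof.
move=> hx; apply: (@leq_trans (\sum_(z in Z) #|[set e in tri G | (z \in e) && (x \in e)]|)).
  rewrite -sum1_card (eq_bigl (fun e => (e \in tri G) && hit Z x e)); last by move=> e; rewrite inE.
  under [X in _ <= X]eq_bigr => z _ do rewrite -sum1_card big_mkcond /=.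
  rewrite exchange_big /= big_mkcond /=; apply: leq_sum => e _.
  have [/andP[et /andP[xe /existsP[z /andP[zZ ze]]]]|] //:= boolP (_ && _).
  by rewrite (bigD1 z) //= inE et ze xe.
apply: leq_sum => z zZ; rewrite tri_edge //.
by move: hx; rewrite inE => /andP[_ /forall_inP]; apply.
Qed.

(** The sum of codegrees counts a triple twice only if it contains [x] and two points [z], [t] of
    [Z]. Such a triple is [[set z; t; x]], so the overcount is at most the number of pairs
    [(z, t)]. *)
Lemma hit_count_ge x Z : x \in cnbr G Z [set: V] ->
  \sum_(z in Z) codeg G z x <= #|[set e in tri G | hit Z x e]| + #|Z| * #|Z|.
Proof.
move=> hx.
have gz z : z \in Z -> G z x by move: hx; rewrite inE => /andP[_ /forall_inP]; apply.
have -> : \sum_(z in Z) codeg G z x = \sum_(e in tri G) \sum_(z in Z) ((z \in e) && (x \in e)).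
  rewrite exchange_big /=; apply: eq_bigr => z zZ; rewrite -tri_edge ?gz // -sum1_card -big_mkcondr /=.
  by apply: eq_bigl => e; rewrite inE.
have -> : #|[set e in tri G | hit Z x e]| = \sum_(e in tri G) hit Z x e.
  by rewrite -sum1_card -big_mkcondr; apply: eq_bigl => e; rewrite inE.
have hZ : \sum_(e in tri G) \sum_(z in Z) \sum_(t in Z | t != z)
    [&& z \in e, t \in e & x \in e] <= #|Z| * #|Z|.
  rewrite exchange_big /= -sum_nat_const; apply: leq_sum => z zZ.
  rewrite exchange_big /= -sum1_card [X in X <= _]big_mkcond [X in _ <= X]big_mkcond /=.
  apply: leq_sum => t _; have [tZ|] //= := boolP (t \in Z); case: eqVneq => //= tz.
  apply: (@leq_trans (\sum_(e in tri G) (e == [set z; t; x]))).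
    apply: leq_sum => e /triP[c3 _]; case: and3P => // -[ze te xe].
    have zt : z != t by rewrite eq_sym.
    have [s [sz process_state es]] := card3_pair c3 ze te zt.
    have := xe; rewrite {1}es !inE.
    by rewrite eq_sym (negbTE (G_neq (gz _ zZ))) eq_sym (negbTE (G_neq (gz _ tZ))) /= => /eqP ->; rewrite es eqxx.
  rewrite -big_mkcondr /= sum1_card.
  by rewrite (leq_trans (subset_leq_card (B:=pred1 [set z; t; x]) _)) ?card1 //; apply/fintype.subsetP=> e /andP[].
apply: leq_trans (leq_add (leqnn _) hZ); rewrite -big_split /=; apply: leq_sum => e et.
rewrite /hit; have [xe|] := boolP (x \in e); last first.
  by rewrite big1 // => z _; rewrite andbF.
have [/existsP[z /andP[zZ ze]]|] := boolP [exists z in Z, z \in e]; last first.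
  by move/existsPn => h; rewrite big1 // => z zZ; move: (h z); rewrite zZ /= => /negbTE->.
rewrite (bigD1 z) //= ze /= leq_add2l [X in _ <= X](bigD1 z) //=.
rewrite -[X in X <= _]addn0 leq_add //.
by apply: leq_sum => t _; rewrite ze !andbT.
Qed.

End SymG.
End Graphs.

(** * Assigning edges to apexes *)

Lemma card_bigcup_le (I T : finType) (P : pred I) (f : I -> {set T}) :
  #|\bigcup_(i | P i) f i| <= \sum_(i | P i) #|f i|.
Proof.
elim/big_rec2: _ => [|i n A _ h]; first by rewrite cards0.
by apply: leq_trans (leq_card_setU _ _) _; rewrite leq_add2l.
Qed.

Section ExactAssignment.
Variables (V : finType) (F : {set {set V}}) (B : {set V}) (ok : rel V) (q : V -> nat).
Variables (Delta qmin qmax a1 a3 a4 a5 : nat).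
Notation okE e x := [forall u in e, ok u x].
Hypothesis F2 : forall e, e \in F -> #|e| = 2.
Hypothesis degF : forall u, #|[set e in F | u \in e]| <= Delta.
Hypothesis q_bd : forall x, x \in B -> qmin <= q x <= qmax.
Hypothesis sum_q : \sum_(x in B) q x = #|F|.
Hypothesis H1 : forall e, e \in F -> a1 + 2 * Delta <= #|[set x in B | okE e x]|.
Hypothesis H2 : forall A : {set {set V}}, A \subset F -> a1 * qmin <= #|A| ->
  #|[set x in B | #|[set e in A | okE e x]| < a4]| <= a3.
Hypothesis H3 : forall y, y \in B -> a5 <= #|[set e in F | okE e y]|.
Hypothesis a4_big : 2 * qmax * Delta < a4.
Hypothesis a5_big : 2 * qmax * Delta + qmax * a3 < a5.

Implicit Types (a : V -> {set {set V}}) (e f : {set V}).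

(** A partial assignment of the edges in [F] to the bins in [B]: quotas are respected, each bin
    receives a matching of allowed edges, and no edge is used twice. *)
Definition valid (a : V -> {set {set V}}) :=
  [/\ forall x, x \in B -> [/\ a x \subset F, #|a x| <= q x &
        forall e, e \in a x -> okE e x],
      forall x e e', x \in B -> e \in a x -> e' \in a x -> e != e' -> [disjoint e & e'] &
      forall x x' e, x \in B -> x' \in B -> e \in a x -> e \in a x' -> x = x'].

Definition used (a : V -> {set {set V}}) x : {set V} := \bigcup_(e in a x) e.
Definition free a (e : {set V}) x := okE e x && [disjoint e & used a x].
Definition ins (a : V -> {set {set V}}) e x := fun y => if y == x then e |: a y else a y.
Definition del (a : V -> {set {set V}}) e x := fun y => if y == x then a y :\ e else a y.

Lemma valid_del a e x : valid a -> valid (del a e x).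
Proof.
have sub y : del a e x y \subset a y.
  by rewrite /del; case: eqP => // _; apply: subsetDl.
move=> [h1 h2 h3]; split.
- move=> y yB; have [s1 s2 s3] := h1 y yB; split.
  + exact: subset_trans (sub y) s1.
  + exact: leq_trans (subset_leq_card (sub y)) s2.
  + by move=> f /(subsetP (sub y))/s3.
- by move=> y f g yB /(subsetP (sub y)) fy /(subsetP (sub y)) gy; apply: h2 yB fy gy.
- by move=> y y' f yB y'B /(subsetP (sub y)) fy /(subsetP (sub y')) gy; apply: h3 fy gy.
Qed.

Lemma valid_ins a e x : valid a -> e \in F -> x \in B -> free a e x ->
  (forall y, y \in B -> e \notin a y) -> #|a x| < q x -> valid (ins a e x).
Proof.
move=> [h1 h2 h3] eF xB /andP[oke dis] nin ld.
have dj f : f \in a x -> [disjoint e & f].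
  move=> fx; rewrite disjoint_sym; apply: disjointWl _ (_ : [disjoint used a x & e]).
    exact: (bigcup_sup f).
  by rewrite disjoint_sym.
split.
- move=> y yB; have [s1 s2 s3] := h1 y yB; rewrite /ins; case: eqP => [yx|_]; last by split.
  split; first by rewrite subUset sub1set eF.
    by rewrite yx cardsU1; case: (_ \notin _) => //; rewrite ltnW.
  by move=> f; rewrite in_setU1 => /orP[/eqP->|/s3 //]; rewrite yx.
- move=> y f g yB; rewrite /ins; case: eqP => [->|_]; last exact: h2.
  rewrite !in_setU1 => /orP[/eqP->|fx] /orP[/eqP->|gx] ne; rewrite ?eqxx // in ne *.
  + exact: dj.
  + by rewrite disjoint_sym dj.
  + exact: h2 xB fx gx ne.
- move=> y y' f yB y'B; rewrite /ins; case: eqP => [->|_]; case: eqP => [->|_] //.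
  + rewrite in_setU1 => /orP[/eqP->|fx] fy'; last exact: h3 fx fy'.
    by rewrite (negbTE (nin y' y'B)) in fy'.
  + rewrite in_setU1 => fy /orP[/eqP fe|fx]; last exact: h3 fy fx.
    by rewrite fe (negbTE (nin y yB)) in fy.
  + exact: h3.
Qed.

Definition total (a : V -> {set {set V}}) := \sum_(x in B) #|a x|.

Lemma total_ins a e x : x \in B -> e \notin a x -> total (ins a e x) = (total a).+1.
Proof.
move=> xB ne; rewrite /total (bigD1 x) //= [in RHS](bigD1 x) //= /ins eqxx cardsU1 ne -addSn add1n.
by congr addn; apply: eq_bigr => y /andP[_ /negbTE->].
Qed.

Lemma total_del a e x : x \in B -> e \in a x -> (total (del a e x)).+1 = total a.
Proof.
move=> xB ne; rewrite /total (bigD1 x) //= [in RHS](bigD1 x) //= /del eqxx (cardsD1 e (a x)) ne add1n !addSn.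
by congr (_ + _).+1; apply: eq_bigr => y /andP[_ /negbTE->].
Qed.

Lemma used_card a x : valid a -> x \in B -> #|used a x| <= 2 * q x.
Proof.
move=> [h1 _ _] xB; have [s1 s2 _] := h1 x xB.
apply: (@leq_trans (\sum_(e in a x) #|e|)).
  exact: card_bigcup_le.
rewrite (eq_bigr (fun=> 2)); last by move=> e /(subsetP s1)/F2.
by rewrite sum_nat_const mulnC leq_mul2l.
Qed.

(** The bin [x] occupies at most [2 * q x] points, each lying on at most [Delta] edges. *)
Lemma blocked_edges a x : valid a -> x \in B ->
  #|[set e in F | ~~ [disjoint e & used a x]]| <= 2 * qmax * Delta.
Proof.
move=> va xB; apply: (@leq_trans (\sum_(u in used a x) #|[set e in F | u \in e]|)).
  rewrite -sum1_card (eq_bigl (fun e => (e \in F) && ~~ [disjoint e & used a x])); last by move=> e; rewrite inE.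
  under [X in _ <= X]eq_bigr => u _ do rewrite -sum1_card big_mkcond /=.
  rewrite exchange_big /= big_mkcond /=; apply: leq_sum => e _.
  have [/andP[eF]|] //:= boolP (_ && _).
  rewrite -setI_eq0 => /set0Pn[u /setIP[ue uu]].
  by rewrite (bigD1 u) //= inE eF ue.
apply: (@leq_trans (\sum_(u in used a x) Delta)); first by apply: leq_sum.
rewrite sum_nat_const leq_mul2r (leq_trans (used_card va xB)) ?orbT //.
by rewrite leq_mul2l; have /andP[_ ->] := q_bd xB; rewrite orbT.
Qed.

(** A bin blocks [f] through an end [u] of [f], hence holds one of the at most [Delta] edges at [u];
    distinct bins hold distinct edges. *)
Lemma blocked_bins a f : valid a -> f \in F ->
  #|[set x in B | ~~ [disjoint f & used a x]]| <= 2 * Delta.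
Proof.
move=> [h1 h2 h3] fF.
apply: (@leq_trans (\sum_(u in f) #|[set e in F | u \in e]|)); last first.
  by rewrite -(F2 fF) -sum_nat_const; apply: leq_sum.
apply: (@leq_trans (\sum_(u in f) #|[set x in B | u \in used a x]|)).
  rewrite -sum1_card (eq_bigl (fun x => (x \in B) && ~~ [disjoint f & used a x])); last by move=> x; rewrite inE.
  under [X in _ <= X]eq_bigr => u _ do rewrite -sum1_card big_mkcond /=.
  rewrite exchange_big /= big_mkcond /=; apply: leq_sum => x _.
  have [/andP[xB]|] //:= boolP (_ && _).
  rewrite -setI_eq0 => /set0Pn[u /setIP[ue uu]].
  by rewrite (bigD1 u) //= inE xB uu.
apply: leq_sum => u _.
pose pk x := odflt set0 [pick e in a x | u \in e].
have pkP x : x \in B -> u \in used a x -> pk x \in a x /\ u \in pk x.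
  move=> xB /bigcupP[e ea ue]; rewrite /pk; case: pickP => [g /andP[] //|/(_ e)].
  by rewrite ea ue.
rewrite -(card_in_imset (f:=pk)).
  apply/subset_leq_card/subsetP => e /imsetP[x /setIdP[xB xu] ->].
  have [p1 p2] := pkP x xB xu; rewrite inE p2 andbT.
  by have [s _ _] := h1 x xB; apply: (subsetP s).
move=> x y /setIdP[xB xu] /setIdP[yB yu] exy.
have [p1 _] := pkP x xB xu; have [p2 _] := pkP y yB yu.
by rewrite -exy in p2; apply: h3 p1 p2.
Qed.

Lemma freeS a a' e x : used a' x \subset used a x -> free a e x -> free a' e x.
Proof.
move=> s /andP[h1 h2]; rewrite /free h1 /= disjoint_sym; apply: disjointWl s _.
by rewrite disjoint_sym.
Qed.

Lemma used_del a e x y : used (del a e x) y \subset used a y.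
Proof.
apply/subsetP=> u /bigcupP[f fd uf]; apply/bigcupP; exists f => //.
by move: fd; rewrite /del; case: eqP => // _ /setD1P[].
Qed.

Lemma used_ins_neq a e x y : y != x -> used (ins a e x) y = used a y.
Proof. by move=> /negbTE yx; rewrite /used /ins yx. Qed.

Lemma sum_card_le (X : {set V}) a : valid a -> X \subset B ->
  \sum_(x in X) #|a x| <= #|\bigcup_(x in X) a x|.
Proof.
move=> [_ _ h3] XB; under eq_bigr => x _ do rewrite -sum1_card big_mkcond /=.
rewrite exchange_big -sum1_card [X in _ <= X]big_mkcond /=; apply: leq_sum => e _.
have [/bigcupP[x xX ex]|ne] := boolP (e \in _).
  rewrite (bigD1 x) //= ex big1 // => y /andP[yX yx].
  by case: ifP => // ey; rewrite (h3 x y e) ?eqxx ?(subsetP XB) // in yx.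
rewrite big1 // => x xX; case: ifP => // ex.
by case/negP: ne; apply/bigcupP; exists x.
Qed.

(** If no bin free for [f] has room, these bins are full and there are at least [a1] of them, so
    together they hold at least [a1 * qmin] edges. By [H2], all but [a3] bins are compatible with at
    least [a4] of those edges, more than a bin can block. The bin [y] can receive more than
    [qmax * a3] edges, too many to lie all in exceptional bins, so one of them sits in a bin where
    the exchange is possible. *)
Lemma augment a : valid a -> total a < #|F| -> exists2 a', valid a' & total a' = (total a).+1.
Proof.
move=> va tF; have [h1 h2 h3] := va.
have [f fF nf] : exists2 f, f \in F & forall x, x \in B -> f \notin a x.
  have [/exists_inP[f fF /forall_inP h]|/exists_inPn hn] :=
    boolP [exists f in F, [forall x in B, f \notin a x]]; first by exists f.
  exfalso; move: tF; apply/negP; rewrite -leqNgt /total.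
  apply: (@leq_trans #|\bigcup_(x in B) a x|).
    apply/subset_leq_card/subsetP => f fF.
    have /forall_inPn[x xB] := hn f fF; rewrite negbK => fx.
    by apply/bigcupP; exists x.
  exact: card_bigcup_le.
have [y yB ly] : exists2 y, y \in B & #|a y| < q y.
  have [/exists_inP[y yB h]|/exists_inPn hn] := boolP [exists y in B, #|a y| < q y]; first by exists y.
  exfalso; move: tF; apply/negP; rewrite -leqNgt -sum_q; apply: leq_sum => y yB.
  by rewrite leqNgt hn.
(* Augmenting chain: the missing edge [f] goes to a saturated apex [x2], which
   releases [e2] to [x3], which releases [e3] to the apex [y] with spare quota. *)
pose X2 := [set x in B | free a f x].
have X2a : a1 <= #|X2|.
  have := H1 fF; have := blocked_bins va fF.
  have : [set x in B | okE f x] \subset X2 :|: [set x in B | ~~ [disjoint f & used a x]].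
    by apply/subsetP=> x; rewrite !inE /free => /andP[-> ->] /=; case: [disjoint _ & _].
  by move/subset_leq_card => e1; have := (leq_card_setU X2 [set x in B | ~~ [disjoint f & used a x]]).1; lia.
have [/exists_inP[x /setIdP[xB fx] lx]|/exists_inPn hsat] := boolP [exists x in X2, #|a x| < q x].
  exists (ins a f x); first by apply: valid_ins.
  by rewrite total_ins // nf.
have sat x : x \in X2 -> #|a x| = q x.
  move=> xX; have /setIdP[xB _] := xX; have [_ le _] := h1 x xB.
  by apply/eqP; rewrite eqn_leq le leqNgt hsat.
pose E3 := [set e in F | free a e y].
have E3a : qmax * a3 < #|E3|.
  have := H3 yB; have := blocked_edges va yB.
  have : [set e in F | okE e y] \subset E3 :|: [set e in F | ~~ [disjoint e & used a y]].
    by apply/subsetP=> x; rewrite !inE /free => /andP[-> ->] /=; case: [disjoint _ & _].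
  by move/subset_leq_card => e1; have := (leq_card_setU E3 [set e in F | ~~ [disjoint e & used a y]]).1; lia.
have [/exists_inP[e /setIdP[eF ey] /forall_inP ne]|/exists_inPn has3] :=
    boolP [exists e in E3, [forall x in B, e \notin a x]].
  by exists (ins a e y); [apply: valid_ins|rewrite total_ins // ne].
pose E2 := \bigcup_(x in X2) a x.
have E2F : E2 \subset F.
  by apply/bigcupsP=> x /setIdP[xB _]; have [] := h1 x xB.
have E2a : a1 * qmin <= #|E2|.
  have X2B : X2 \subset B by apply/subsetP => x /setIdP[].
  apply: leq_trans (sum_card_le va X2B).
  apply: (@leq_trans (\sum_(x in X2) qmin)); first by rewrite sum_nat_const leq_mul2r X2a orbT.
  apply: leq_sum => x xX; rewrite sat //; have /setIdP[xB _] := xX.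
  by have /andP[] := q_bd xB.
pose bad := [set x in B | #|[set e in E2 | okE e x]| < a4].
have badc : #|bad| <= a3 by apply: H2.
have [e3 [x3 [e3E x3B e3x x3g]]] : exists e3 x3, [/\ e3 \in E3, x3 \in B, e3 \in a x3 & x3 \notin bad].
  have [/exists_inP[e eE /exists_inP[x xB /andP[h h']]]|/exists_inPn hn] :=
    boolP [exists e in E3, [exists x in B, (e \in a x) && (x \notin bad)]]; first by exists e, x.
  exfalso; move: E3a; apply/negP; rewrite -leqNgt.
  apply: (@leq_trans #|\bigcup_(x in bad) a x|).
    apply/subset_leq_card/subsetP => e eE.
    have /forall_inPn[x xB] := has3 e eE; rewrite negbK => ex.
    have /exists_inPn/(_ x xB) := hn e eE; rewrite ex /= negbK => xb.
    by apply/bigcupP; exists x.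
  apply: (@leq_trans (\sum_(x in bad) qmax)); last by rewrite sum_nat_const mulnC leq_mul2l badc orbT.
  apply: (@leq_trans (\sum_(x in bad) #|a x|)).
    exact: card_bigcup_le.
  apply: leq_sum => x /setIdP[xB _]; have [_ le _] := h1 x xB; apply: leq_trans le _.
  by have /andP[] := q_bd xB.
have [e2 e2E e2x] : exists2 e2, e2 \in E2 & free a e2 x3.
  have [/exists_inP[e eE h]|/exists_inPn hn] := boolP [exists e in E2, free a e x3]; first by exists e.
  exfalso; move: x3g; rewrite inE x3B /= -leqNgt; apply/negP; rewrite -ltnNge.
  apply: leq_trans a4_big; rewrite ltnS; apply: leq_trans (blocked_edges va x3B).
  apply/subset_leq_card/subsetP => e /setIdP[eE eo]; rewrite inE (subsetP E2F) //=.
  by move: (hn e eE); rewrite /free eo.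
have /bigcupP[x2 x2X e2a] := e2E; have /setIdP[x2B fx2] := x2X.
have /setIdP[e3F e3y] := e3E.
have nonempty e : e \in F -> exists u, u \in e.
  by move=> /F2 c; apply/card_gt0P; rewrite c.
have x32 : x3 != x2.
  apply/eqP=> ex; have [u ue] := nonempty _ (subsetP E2F _ e2E).
  have /andP[_ /disjointFr/(_ ue)] := e2x => /negP; apply.
  by apply/bigcupP; exists e2 => //; rewrite ex.
have x3y : x3 != y.
  apply/eqP=> ex; have [u ue] := nonempty _ e3F.
  have /andP[_ /disjointFr/(_ ue)] := e3y => /negP; apply.
  by apply/bigcupP; exists e3 => //; rewrite -ex.
have x2y : x2 != y by apply: contraTneq ly => <-; rewrite sat // ltnn.
have e23 : e2 != e3.
  by apply: contraNneq x32 => ee; rewrite (h3 x3 x2 e3) // -ee.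
have e2f : e2 != f by apply: contraTneq e2a => ->; apply: nf.
have e3f : e3 != f by apply: contraTneq e3x => ->; apply: nf.
pose b1 := del a e3 x3. pose b2 := ins b1 e3 y.
pose b3 := del b2 e2 x2. pose b4 := ins b3 e2 x3.
have vb1 : valid b1 by apply: valid_del.
have nb1 x : x \in B -> e3 \notin b1 x.
  move=> xB; rewrite /b1 /del; case: eqP => [_|/eqP xx]; first by rewrite !inE eqxx.
  by apply: contraNN xx => ex; rewrite (h3 x x3 e3).
have vb2 : valid b2.
  apply: valid_ins => //; first exact: freeS (used_del _ _ _ _) e3y.
  by rewrite /b1 /del eq_sym (negbTE x3y).
have vb3 : valid b3 by apply: valid_del.
have e2b2 : e2 \in b2 x2.
  by rewrite /b2 /ins (negbTE x2y) /b1 /del eq_sym (negbTE x32).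
have nb3 x : x \in B -> e2 \notin b3 x.
  have [_ _ g3] := vb2.
  move=> xB; rewrite /b3 /del; case: eqP => [_|/eqP xx]; first by rewrite !inE eqxx.
  by apply: contraNN xx => ex; rewrite (g3 x x2 e2).
have b3x3 : b3 x3 = a x3 :\ e3.
  by rewrite /b3 /del (negbTE x32) /b2 /ins (negbTE x3y) /b1 /del eqxx.
have vb4 : valid b4.
  apply: valid_ins => //; first exact: (subsetP E2F).
    apply: freeS e2x; apply: subset_trans (used_del _ _ _ _) _.
    by rewrite used_ins_neq //; apply: used_del.
  rewrite b3x3; have [_ le _] := h1 x3 x3B; apply: leq_trans le.
  by rewrite (cardsD1 e3 (a x3)) e3x.
have b4x2 : b4 x2 = a x2 :\ e2.
  by rewrite /b4 /ins eq_sym (negbTE x32) /b3 /del eqxx /b2 /ins (negbTE x2y) /b1 /del eq_sym (negbTE x32).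
have nb4 x : x \in B -> f \notin b4 x.
  have ni (b : V -> {set {set V}}) e z : e != f -> f \notin b x -> f \notin ins b e z x.
    by rewrite /ins => ef fb; case: eqP => // _; rewrite in_setU1 negb_or eq_sym ef.
  have nd (b : V -> {set {set V}}) e z : f \notin b x -> f \notin del b e z x.
    by rewrite /del => fb; case: eqP => // _; rewrite in_setD1 negb_and fb orbT.
  by move=> xB; do 2![apply: (ni) => //; apply: (nd)]; apply: nf.
exists (ins b4 f x2).
  apply: valid_ins => //.
    apply: freeS fx2; rewrite used_ins_neq ?(eq_sym x2) //.
    apply: subset_trans (used_del _ _ _ _) _.
    by rewrite used_ins_neq //; apply: used_del.
  rewrite b4x2; have [_ le _] := h1 x2 x2B; apply: leq_trans le.
  by rewrite (cardsD1 e2 (a x2)) e2a.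
rewrite total_ins ?nb4 // /b4 total_ins ?nb3 // /b3 total_del // /b2 total_ins ?nb1 //.
by rewrite /b1 total_del.
Qed.

(** Augmentation is iterated until all of [F] is placed; as the quotas sum to [#|F|], every bin is
    then full. *)
Lemma exact_assignment : exists a : V -> {set {set V}},
  [/\ forall x, x \in B -> [/\ a x \subset F, #|a x| = q x &
        forall e u, e \in a x -> u \in e -> ok u x],
      forall x e e', x \in B -> e \in a x -> e' \in a x -> e != e' -> [disjoint e & e'],
      forall x x' e, x \in B -> x' \in B -> e \in a x -> e \in a x' -> x = x' &
      forall e, e \in F -> exists2 x, x \in B & e \in a x].
Proof.
have [a va ta] : exists2 a, valid a & total a = #|F|.
  suff : forall k, k <= #|F| -> exists2 a, valid a & total a = k by apply.
  elim=> [_|k IH kF].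
    exists (fun=> set0); last by rewrite /total big1 // => x _; rewrite cards0.
    by split=> [x xB|x e e'|x x' e]; rewrite ?inE //; split=> [||e]; rewrite ?sub0set ?cards0 ?inE.
  have [a va ta] := IH (ltnW kF).
  by have [|a' va' ta'] := augment va; [rewrite ta|exists a'; rewrite ?ta' ?ta].
have [h1 h2 h3] := va.
have full x : x \in B -> #|a x| = q x.
  have le y : y \in B -> #|a y| <= q y by move=> /h1[].
  have : total a = \sum_(x in B) q x by rewrite ta sum_q.
  rewrite /total => /eqP; rewrite (leqif_sum (fun y yB => leqif_eq (le y yB))).
  by move=> /forall_inP h xB; apply/eqP/h.
exists a; split=> //.
- move=> x xB; have [s1 _ s3] := h1 x xB; split=> //; first exact: full.
  by move=> e u /s3/forall_inP; apply.
- move=> e eF; have [/exists_inP[x xB ex]|/exists_inPn hn] := boolP [exists x in B, e \in a x]; first by exists x.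
  exfalso; suff : total a < #|F| by rewrite ta ltnn.
  apply: leq_ltn_trans (sum_card_le va (subxx _)) _.
  apply/proper_card/properP; split.
    by apply/bigcupsP=> x /h1[].
  by exists e => //; apply/negP => /bigcupP[x xB ex]; move: (hn x xB); rewrite ex.
Qed.

End ExactAssignment.

(** * Upper bound on prefixes *)

(** In probabilistic terms: a random ordered [l]-prefix of [N] blocks avoids three given blocks with
    probability at most [((N - l) / N) ^ 3]. *)
Lemma ffact_shift3 N l : (N - 3) ^_ l * N ^ 3 <= N ^_ l * (N - l) ^ 3.
Proof.
elim: l => [|l IH]; first by rewrite !ffactn0 subn0.
rewrite !ffactnSr; have [xl|xl] := leqP (N - l) 3.
  by have -> : N - 3 - l = 0 by [lia]; rewrite muln0.
apply: (@leq_trans (N ^_ l * (N - l) ^ 3 * (N - 3 - l))).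
  by rewrite mulnAC leq_mul2r IH orbT.
rewrite -!mulnA leq_mul2l; apply/orP; right.
have -> : N - l.+1 = (N - l).-1 by lia.
have -> : N - 3 - l = (N - l) - 3 by lia.
move: (N - l) xl => [|[|[|x]]] // _.
have -> : x.+3 - 3 = x by lia.
by rewrite /= !expnS !expn0; nia.
Qed.

Section STSbasics.
Variable V : finType.
Implicit Types (S Q : {set {set V}}) (T e : {set V}).

Lemma stsP S : reflect ((forall e, e \in S -> #|e| = 3) /\
    forall x y, x != y -> #|[set e in S | (x \in e) && (y \in e)]| = 1)
  (steiner_triple_system S).
Proof.
apply: (iffP andP) => [[/forall_inP h1 /forallP h2]|[h1 h2]]; split.
- by move=> e /h1/eqP.
- by move=> x y xy; move: (h2 x) => /forallP/(_ y)/implyP/(_ xy)/eqP.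
- by apply/forall_inP => e /h1 ->.
- by apply/forallP=> x; apply/forallP=> y; apply/implyP=> /h2 ->.
Qed.

Lemma sts_uniq S e f x y : steiner_triple_system S -> x != y ->
  e \in S -> f \in S -> x \in e -> y \in e -> x \in f -> y \in f -> e = f.
Proof.
move=> /stsP[_ h] xy eS fS xe ye xf yf; have /eqP/cards1P[g eg] := h x y xy.
have : e \in [set e in S | (x \in e) && (y \in e)] by rewrite inE eS xe.
have : f \in [set e in S | (x \in e) && (y \in e)] by rewrite inE fS xf.
by rewrite eg !inE => /eqP-> /eqP->.
Qed.

Lemma sts_block S x y : steiner_triple_system S -> x != y ->
  exists2 e, e \in S & (x \in e) && (y \in e).
Proof.
move=> /stsP[_ h] xy; have /eqP/cards1P[g eg] := h x y xy.
have : g \in [set e in S | (x \in e) && (y \in e)] by rewrite eg set11.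
by rewrite inE => /andP[]; exists g.
Qed.

Lemma sts_card S : steiner_triple_system S -> 6 * #|S| = #|V| * (#|V|).-1.
Proof.
move=> sS; have [h3 h1] := stsP _ sS.
have -> : #|V| * #|V|.-1 = #|[set xy : V * V | xy.1 != xy.2]|.
  have hd : #|[pred xy : V * V | xy.1 == xy.2]| = #|V|.
    have inj : injective (fun x : V => (x, x)) by move=> x y [].
    rewrite -(card_imset (mem V) inj); apply: eq_card => -[x y]; rewrite !inE /=.
    by apply/eqP/imsetP => [->|[z _ [-> ->]] //]; exists y.
  have := cardC [pred xy : V * V | xy.1 == xy.2]; rewrite hd card_prod => hc.
  have -> : #|[set xy : V * V | xy.1 != xy.2]| = #|[predC [pred xy : V * V | xy.1 == xy.2]]|.
    by apply: eq_card => xy; rewrite !inE.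
  by move: hc; case: #|V| => [|k] /=; [rewrite add0n => <-|rewrite mulnS => /addnI <-].
transitivity (\sum_(xy : V * V | xy.1 != xy.2) \sum_(e in S) ((xy.1 \in e) && (xy.2 \in e) : nat)).
  rewrite exchange_big /= -sum1_card big_distrr /=; apply: eq_bigr => e /h3 c3.
  rewrite muln1 -(card_pairs3 c3) -sum1_card -big_mkcondr /=; apply: eq_bigl => -[x y].
  by rewrite !inE /=; case: (x \in e); case: (y \in e); rewrite ?andbF ?andbT.
rewrite -sum1_card; apply: eq_big => [xy|[x y] /= xy]; first by rewrite inE.
rewrite -(h1 _ _ xy) -sum1_card -big_mkcondr /=.
by apply: eq_bigl => e; rewrite !inE.
Qed.

End STSbasics.

Section UpperBound.
Variables (R : realType) (V : finType).
Variables (B : {set {set {set V}}}) (A0 : {set {set V}}) (N M : nat).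
Hypothesis B_sts : forall S, S \in B -> steiner_triple_system S.
Hypothesis B_sub : forall S, S \in B -> S \subset A0.
Hypothesis A0_3 : forall T, T \in A0 -> #|T| = 3.
Hypothesis B_N : forall S, S \in B -> #|S| = N.
Hypothesis MN : M <= N.
Implicit Types (S Q : {set {set V}}) (T e : {set V}).

Local Open Scope ring_scope.
Definition avail Q : {set {set V}} :=
  [set T in A0 | [forall f in Q, (#|T :&: f| <= 1)%N]].
(* [alpha l] bounds the mean of [#|avail Q|] over random [l]-subsets [Q] of a
   system [S]: a triple outside [S] shares a pair with at least three blocks of
   [S], a block of [S] only with itself. *)
Definition alpha l : R := #|A0|%:R * ((N - l)%:R / N%:R) ^+ 3 + (N - l)%:R.
(* [psi] is the probability, summed over orders, that a random greedy packing
   started at [Q] follows [S] for [j] more steps. By [1 / A >= expR (1 - A / alpha) / alpha]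
   it dominates [xi], and by [expR (- z) >= 1 - z] then [upsilon], which depends
   only on first moments of [#|avail Q|]. *)
Fixpoint psi S j Q : R := if j is j'.+1 then
  #|avail Q|%:R^-1 * \sum_(e in S :\: Q) psi S j' (e |: Q) else 1.
Fixpoint xi S j i (z : R) Q : R := if j is j'.+1 then
  \sum_(e in S :\: Q) xi S j' i.+1 (z + #|avail Q|%:R / alpha i - 1) (e |: Q) else expR (- z).
Fixpoint upsilon S j i (z : R) Q : R := if j is j'.+1 then
  \sum_(e in S :\: Q) upsilon S j' i.+1 (z + #|avail Q|%:R / alpha i - 1) (e |: Q) else 1 - z.

Lemma psi_ge0 S j Q : 0 <= psi S j Q.
Proof. by elim: j Q => //= j IH Q; rewrite mulr_ge0 ?invr_ge0 ?sumr_ge0. Qed.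

Lemma two_common e f : (1 < #|e :&: f|)%N ->
  exists x y : V, [/\ x != y, x \in e, y \in e & (x \in f) && (y \in f)].
Proof.
by move/card_gt1P => [x [y [/setIP[xe xf] /setIP[ye yf] xy]]]; exists x, y; rewrite xf yf.
Qed.

Lemma avail_sts S Q e : S \in B -> Q \subset S -> e \in S :\: Q -> e \in avail Q.
Proof.
move=> SB QS /setDP[eS eQ]; rewrite inE (subsetP (B_sub SB)) //=.
apply/forall_inP=> f fQ; rewrite leqNgt; apply/negP => /two_common[x [y [xy xe ye /andP[xf yf]]]].
have ef : e = f by apply: (sts_uniq (B_sts SB) xy) => //; apply: (subsetP QS).
by rewrite ef fQ in eQ.
Qed.

(** For the greedy process the events of following different systems overlap only as far as the
    systems share the final set of [M] blocks, and at most [C] systems contain a given such set.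
    Each step averages over the next block, which is available by [avail_sts]. *)
Lemma psi_upper j Q (C : R) : (#|Q| + j = M)%N -> 0 <= C ->
  (forall Q, #|Q| = M -> #|[set S in B | Q \subset S]|%:R <= C) ->
  \sum_(S in B | Q \subset S) psi S j Q <= C.
Proof.
move=> hj C0 hC; elim: j Q hj => [|j IH] Q hj /=.
  rewrite sumr_const; apply: le_trans (hC Q _); last by lia.
  by rewrite ler_nat; apply/subset_leq_card/subsetP => S; rewrite !inE.
rewrite -mulr_sumr.
have [A00|A0p] := posnP #|avail Q|; first by rewrite A00 invr0 mul0r.
rewrite ler_pdivrMl ?ltr0n //.
(* The double sum is reorganised by the next block [e]. Terms with [e \in Q] get the value 0, since
   the induction needs [e |: Q] to have one block more than [Q]. *)
apply: (@le_trans _ _ (\sum_(e in avail Q) \sum_(S in B | (e |: Q) \subset S) if e \in Q then 0 else psi S j (e |: Q))).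
  under eq_bigr => S _ do rewrite big_mkcond /=.
  rewrite exchange_big /= [X in _ <= X]big_mkcond /=; apply: ler_sum => e _.
  have [eQ|eQ] := boolP (e \in Q).
    rewrite big1 => [|S _]; last by rewrite inE eQ.
    by case: ifP => // _; rewrite big1.
  have [ea|ea] := boolP (e \in avail Q).
    rewrite big_mkcond [X in _ <= X]big_mkcond /=; apply: ler_sum => S _.
    rewrite subUset sub1set inE eQ /=.
    by case: (S \in B) => //=; case: (Q \subset S); case: (e \in S) => //=.
  rewrite big1 // => S /andP[SB QS]; case: ifP => // eS.
  by rewrite (avail_sts SB QS eS) in ea.
rewrite mulr_natl -sumr_const; apply: ler_sum => e ea.
have [eQ|eQ] := boolP (e \in Q); first by rewrite big1.
by apply: IH; rewrite cardsU1 eQ; lia.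
Qed.

Lemma alpha_gt0 l : (l < N)%N -> 0 < alpha l.
Proof.
move=> lN; rewrite ltr_wpDl //; last by rewrite ltr0n subn_gt0.
by rewrite mulr_ge0 // exprn_ge0 // divr_ge0.
Qed.

Lemma xi_psi S j i z Q : S \in B -> Q \subset S -> (i + j <= N)%N ->
  xi S j i z Q <= expR (- z) * (psi S j Q * \prod_(i <= l < i + j) alpha l).
Proof.
move=> SB; elim: j i z Q => [|j IH] i z Q QS ij /=.
  by rewrite addn0 big_geq // !mulr1.
rewrite big_ltn ?addnS ?ltnS ?leq_addr //.
have a0 : 0 < alpha i by apply: alpha_gt0; lia.
have Pi0 : 0 <= \prod_(i.+1 <= l < i.+1 + j) alpha l.
  by rewrite big_nat; apply: prodr_ge0 => l hl; apply/ltW/alpha_gt0; lia.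
have [A00|A0p] := posnP #|avail Q|.
  rewrite [X in X <= _]big1 ?A00 ?invr0 ?mul0r ?mulr0 // => e eS.
  have := avail_sts SB QS eS; have /eqP := A00; rewrite cards_eq0 => /eqP ->.
  by rewrite inE.
have Ap : 0 < #|avail Q|%:R :> R by rewrite ltr0n.
apply: (@le_trans _ _ (\sum_(e in S :\: Q) expR (- (z + #|avail Q|%:R / alpha i - 1)) *
   (psi S j (e |: Q) * \prod_(i.+1 <= l < i.+1 + j) alpha l))).
  apply: ler_sum => e /setDP[eS _]; apply: IH; last by lia.
  by rewrite subUset sub1set eS.
rewrite -mulr_sumr -mulr_suml.
set Sg := \sum_(_ in _) _.
have Sg0 : 0 <= Sg by apply: sumr_ge0 => e _; apply: psi_ge0.
have -> : expR (- z) * (#|avail Q|%:R^-1 * Sg * (alpha i * \prod_(i.+1 <= l < i.+1 + j) alpha l))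
  = expR (- z) * (alpha i / #|avail Q|%:R) * (Sg * \prod_(i.+1 <= l < i.+1 + j) alpha l) by ring.
apply: ler_wpM2r; first by rewrite mulr_ge0.
have -> : - (z + #|avail Q|%:R / alpha i - 1) = - z + - (#|avail Q|%:R / alpha i - 1) by ring.
rewrite expRD ler_pM2l ?expR_gt0 // expRN -[alpha i / _]invrK lef_pV2 ?posrE ?expR_gt0 //.
  rewrite invf_div; apply: le_trans (expR_ge1Dx _); by rewrite addrC subrK.
by rewrite invr_gt0 divr_gt0.
Qed.

Lemma upsilon_xi S j i z Q : upsilon S j i z Q <= xi S j i z Q.
Proof.
elim: j i z Q => [|j IH] i z Q /=; first by apply: le_trans (expR_ge1Dx _).
by apply: ler_sum.
Qed.

Definition kap S T : {set {set V}} := [set f in S | (1 < #|T :&: f|)%N].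
(** Counts pairs of a triple [T] and an ordering of [j] further blocks of [S] such that [T] is still
    available after the first [l] of them: these [l] blocks avoid [kap S T], the blocks sharing a
    pair with [T], and the other [j - l] are arbitrary. *)
Definition cntU S l j Q : nat := (\sum_(T in A0 | [disjoint kap S T & Q])
  (N - #|Q| - #|kap S T|) ^_ l * (N - #|Q| - l) ^_ (j - l))%N.

Lemma kap_avail S Q T : Q \subset S -> T \in A0 ->
  (T \in avail Q) = [disjoint kap S T & Q].
Proof.
move=> QS TA; rewrite inE TA /=; apply/forall_inP/idP => [h|h f fQ].
  rewrite -setI_eq0 -subset0; apply/subsetP => f /setIP[/setIdP[_ h1] fQ].
  by move: (h f fQ); rewrite leqNgt h1.
rewrite leqNgt; apply/negP => h1; move: (disjointFl h fQ).
by rewrite inE (subsetP QS) // h1.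
Qed.

Lemma cntU0 S j Q : Q \subset S -> cntU S 0 j Q = (#|avail Q| * (N - #|Q|) ^_ j)%N.
Proof.
move=> QS; rewrite /cntU -sum_nat_const; apply: eq_big => [T|T _].
  have [TA|TA] := boolP (T \in A0); first by rewrite (kap_avail QS TA).
  by rewrite inE (negbTE TA).
by rewrite ffactn0 mul1n !subn0.
Qed.

Lemma cntUS S l j Q : S \in B -> Q \subset S ->
  (\sum_(e in S :\: Q) cntU S l j (e |: Q) = cntU S l.+1 j.+1 Q)%N.
Proof.
move=> SB QS; rewrite /cntU.
under eq_bigr => e _ do rewrite big_mkcond /=.
rewrite exchange_big /= [RHS]big_mkcond /=; apply: eq_bigr => T _.
have [TA|TA] := boolP (T \in A0) => /=; last by rewrite big1.
have cd e : e \in S :\: Q -> #|e |: Q| = #|Q|.+1 by move=> /setDP[_ h]; rewrite cardsU1 h.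
have [dj|dj] := boolP [disjoint kap S T & Q]; last first.
  rewrite big1 // => e eS; case: ifP => // d; case/negP: dj.
  by apply: disjointWr d; apply: subsetUr.
have kS : kap S T \subset S by apply/subsetP=> f /setIdP[].
have kQ : kap S T \subset S :\: Q by rewrite subsetD kS dj.
rewrite -big_mkcondr /=.
rewrite (eq_bigl (fun e => e \in (S :\: Q) :\: kap S T)); last first.
  move=> e; rewrite [RHS]inE andbC; congr (_ && _).
  rewrite -!setI_eq0 setIUr setU_eq0 !setI_eq0 dj andbT.
  by rewrite disjoint_sym disjoints1.
rewrite (eq_bigr (fun=> ((N - #|Q| - #|kap S T|).-1 ^_ l * (N - #|Q| - l.+1) ^_ (j - l))%N)); last first.
  move=> e /setDP[eS _]; rewrite cd //; congr (_ ^_ _ * _ ^_ _)%N; last by rewrite -!subnDA addSnnS.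
  by rewrite -subn1 -!subnDA addn1 addnS addSn.
rewrite sum_nat_const cardsDS // cardsDS // (B_N SB) mulnA subSS; congr muln.
Qed.

(** Unfolded, [upsilon] is a sum over orderings of [1 - z] minus the sum of the terms
    [#|avail| / alpha - 1]. This is linear in the sizes [#|avail|], so after exchanging sums only
    the totals [cntU] remain. *)
Lemma upsilonE S j z Q : S \in B -> Q \subset S ->
  upsilon S j #|Q| z Q = ((N - #|Q|) ^_ j)%:R * (1 - z + j%:R) -
    \sum_(l < j) (cntU S l j Q)%:R / alpha (#|Q| + l).
Proof.
move=> SB; elim: j z Q => [|j IH] z Q QS /=.
  by rewrite big_ord0 ffactn0 mul1r addr0 subr0.
rewrite big_ord_recl /= cntU0 // addn0 natrM.
set c := _ / alpha #|Q|.
transitivity (\sum_(e in S :\: Q) (((N - #|Q|.+1) ^_ j)%:R * (1 - (z + c - 1) + j%:R) -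
   \sum_(l < j) (cntU S l j (e |: Q))%:R / alpha (#|Q| + l.+1))).
  apply: eq_bigr => e eS; have /setDP[e1 e2] := eS.
  have cd : #|e |: Q| = #|Q|.+1 by rewrite cardsU1 e2.
  rewrite -{1}cd IH ?subUset ?sub1set ?e1 // cd; congr (_ - _).
  by apply: eq_bigr => l _; rewrite addSnnS.
rewrite sumrB sumr_const -[X in X - _]mulr_natl exchange_big /=.
have -> : #|S :\: Q| = (N - #|Q|)%N by rewrite cardsDS // (B_N SB).
have -> : \sum_(l < j) \sum_(e in S :\: Q) (cntU S l j (e |: Q))%:R / alpha (#|Q| + l.+1)
   = \sum_(l < j) (cntU S (bump 0 l) j.+1 Q)%:R / alpha (#|Q| + bump 0 l) :> R.
  apply: eq_bigr => l _; rewrite -mulr_suml -natr_sum cntUS //.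
have -> : ((N - #|Q|) ^_ j.+1)%:R = (N - #|Q|)%:R * ((N - #|Q|.+1) ^_ j)%:R :> R.
  rewrite -natrM; congr _%:R; case E : (N - #|Q|)%N => [|k]; first by rewrite mul0n ffact0n.
  by rewrite ffactSS; congr (_ * _ ^_ _)%N; lia.
rewrite /c -natr1; ring.
Qed.

Lemma kap_card S T : S \in B -> T \in A0 -> (1 <= #|kap S T|)%N /\ (T \notin S -> 3 <= #|kap S T|)%N.
Proof.
move=> SB TA; have c3 := A0_3 TA; have sS := B_sts SB.
have [x [y [xT yT xy]]] : exists x y : V, [/\ x \in T, y \in T & x != y].
  by apply: card_gt1_pair; rewrite c3.
have [z [zx zy eT]] := card3_pair c3 xT yT xy.
have zT : z \in T by rewrite eT !inE eqxx orbT.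
have kapb u v f : u \in T -> v \in T -> u != v -> f \in S -> (u \in f) && (v \in f) -> f \in kap S T.
  move=> uT vT uv fS /andP[uf vf]; rewrite inE fS; apply/card_gt1P; exists u, v.
  by rewrite !inE uT uf vT vf.
have [f fS fxy] := sts_block sS xy.
have [g gS gxz] := sts_block sS zx.
have [h hS hyz] := sts_block sS zy.
have fk := kapb _ _ _ xT yT xy fS fxy.
split; first by apply/card_gt0P; exists f.
(* A block containing all of [T] would equal [T], so the blocks through the three pairs of [T] are
   distinct. *)
move=> TS; have h3 : forall e, e \in S -> x \in e -> y \in e -> z \in e -> False.
  move=> e eS xe ye ze; case/negP: TS; suff -> : T = e by [].
  apply/eqP; rewrite eqEcard; have /stsP[-> // _] := sS; rewrite c3 leqnn andbT.
  by rewrite eT; apply/subsetP=> t; rewrite !inE -orbA => /or3P[]/eqP->.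
have gk := kapb _ _ _ zT xT zx gS gxz; have hk := kapb _ _ _ zT yT zy hS hyz.
case/andP: fxy gxz hyz => xf yf /andP[zg xg] /andP[zh yh].
have fg : f != g by apply/eqP => e; apply: (h3 f) => //; rewrite e.
have fh : f != h by apply/eqP => e; apply: (h3 f) => //; rewrite e.
have gh : g != h by apply/eqP => e; apply: (h3 g) => //; rewrite e.
rewrite -(cards3 fg fh gh); apply/subset_leq_card/subsetP=> e.
by rewrite !in_setU !in_set1 -orbA => /or3P[]/eqP->.
Qed.

Lemma ffact_antimono a b l : (a <= b)%N -> (a ^_ l <= b ^_ l)%N.
Proof. by move=> ab; elim: l => // l IH; rewrite !ffactnSr leq_mul // leq_sub2r. Qed.

Lemma ffact_split l : (l <= M)%N -> (N ^_ M = N ^_ l * (N - l) ^_ (M - l))%N.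
Proof.
move=> lM; rewrite -{1}(subnKC lM); elim: (M - l)%N {lM} => [|k IH]; first by rewrite addn0 muln1.
by rewrite addnS !ffactnSr IH -mulnA subnDA.
Qed.

(** The two terms of [alpha] come from the two kinds of triples: those outside [S] have at least
    three blocks to avoid and are treated by [ffact_shift3]; the at most [N] blocks of [S] in [A0]
    survive with probability at most [(N - l) / N] each. *)
Lemma cntU_le S l : S \in B -> (l < M)%N ->
  (cntU S l M set0)%:R <= (N ^_ M)%:R * alpha l.
Proof.
move=> SB lM; have N0 : (0 < N)%N by lia.
rewrite /cntU cards0 subn0 (bigID (fun T => T \in S)) /= natrD addrC /alpha mulrDr.
have sp : (N ^_ M)%:R = (N ^_ l)%:R * ((N - l) ^_ (M - l))%:R :> R.
  by rewrite -natrM -ffact_split // ltnW.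
have NR : 0 < N%:R :> R by rewrite ltr0n.
apply: lerD.
  apply: (@le_trans _ _ (\sum_(T in A0) ((N - 3) ^_ l * (N - l) ^_ (M - l))%:R)).
    rewrite -natr_sum ler_nat big_mkcond [X in (_ <= X)%N]big_mkcond; apply: leq_sum => T _.
    have [TA|//] := boolP (T \in A0); have [_ k3] := kap_card SB TA.
    case: ifP => // /andP[_ TS]; rewrite leq_mul2r ffact_antimono ?orbT //.
    by apply: leq_sub2l; apply: k3.
  rewrite sumr_const -[X in X <= _]mulr_natl mulrCA ler_wpM2l // expr_div_n sp natrM.
  rewrite [X in _ <= X]mulrACA [_ * (N%:R ^+ 3)^-1]mulrC mulrA ler_wpM2r // ler_pdivlMr ?exprn_gt0 //.
  by rewrite -!natrX -!natrM ler_nat ffact_shift3.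
apply: (@le_trans _ _ (\sum_(T in S) ((N - 1) ^_ l * (N - l) ^_ (M - l))%:R)).
  rewrite -natr_sum ler_nat big_mkcond [X in (_ <= X)%N]big_mkcond; apply: leq_sum => T _.
  case: ifP => // /andP[/andP[TA _] ->]; have [k1 _] := kap_card SB TA.
  by rewrite leq_mul2r ffact_antimono ?orbT //; apply: leq_sub2l.
rewrite sumr_const (B_N SB) -[X in X <= _]mulr_natl -natrM -natrM ler_nat (ffact_split (ltnW lM)).
rewrite mulnA [(_ * (N - l))%N]mulnAC leq_mul2r; apply/orP; right.
have -> : (N * (N - 1) ^_ l = N ^_ l.+1)%N by case: (N) N0 => // k _; rewrite subn1 ffactSS.
by rewrite ffactnSr.
Qed.

Lemma bin_le_exp n k : ('C(n, k) <= n ^ k)%N.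
Proof.
apply: (@leq_trans (n ^_ k)%N); last first.
  by elim: k => // k IH; rewrite ffactnSr expnSr leq_mul // leq_subr.
by rewrite -bin_ffact leq_pmulr // fact_gt0.
Qed.

(** For each system, the chain [psi], [xi], [upsilon] bounds [psi] from below by [N ^_ M] over the
    product of the [alpha l]: the [M] summands [+1] in [upsilonE] outweigh the [M] normalised first
    moments. Comparing with [psi_upper] gives the bound. *)
Lemma upper_count :
  (#|B| * N ^_ M)%:R <= ((#|V| ^ 3) ^ (N - M))%:R * \prod_(0 <= l < M) alpha l.
Proof.
have Pi0 : 0 < \prod_(0 <= l < M) alpha l.
  by rewrite big_nat; apply: prodr_gt0 => l hl; apply/alpha_gt0; lia.
have up : \sum_(S in B | set0 \subset S) psi S M set0 <= ((#|V| ^ 3) ^ (N - M))%:R.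
  apply: psi_upper => // [|Q cQ]; first by rewrite cards0.
  rewrite ler_nat.
  pose T3 : {set {set V}} := [set T : {set V} | #|T| == 3].
  (* A system containing [Q] is determined by its other [N - M] blocks, a set of triples of that
     size. *)
  apply: (@leq_trans #|[set P : {set {set V}} | (P \subset T3) && (#|P| == (N - M)%N)]|).
    have inj : {in [set S in B | Q \subset S] &, injective (fun S => S :\: Q)}.
      move=> S S' /setIdP[_ h] /setIdP[_ h'] e.
      by rewrite -(setID S Q) -(setID S' Q) e (setIidPr h) (setIidPr h').
    rewrite -(card_in_imset inj); apply/subset_leq_card/subsetP => P /imsetP[S /setIdP[SB QS] ->].
    rewrite inE cardsDS // (B_N SB) cQ eqxx andbT; apply/subsetP => e /setDP[eS _].
    by rewrite inE; have /stsP[h _] := B_sts SB; rewrite h.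
  rewrite cards_draws card_draws; apply: leq_trans (bin_le_exp _ _) _.
  by case: (N - M)%N => // k; rewrite leq_exp2r // bin_le_exp.
have low : \sum_(S in B | set0 \subset S) psi S M set0 >= \sum_(S in B) (N ^_ M)%:R / \prod_(0 <= l < M) alpha l.
  rewrite [X in _ <= X](eq_bigl (fun S => S \in B)); last by move=> S; rewrite sub0set andbT.
  apply: ler_sum => S SB; rewrite ler_pdivrMr //.
  have := xi_psi 0 SB (sub0set S) (_ : 0 + M <= N)%N; rewrite oppr0 expR0 mul1r add0n => /(_ MN).
  apply: le_trans; apply: le_trans (upsilon_xi _ _ _ _ _).
  have := upsilonE M 0 SB (sub0set S); rewrite cards0 => ->.
  rewrite subn0 subr0 mulrDr mulr1 -addrA lerDl subr_ge0.
  apply: (@le_trans _ _ (\sum_(l < M) (N ^_ M)%:R)).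
    apply: ler_sum => l _; rewrite add0n ler_pdivrMr ?cntU_le //; apply: alpha_gt0.
    exact: leq_trans (ltn_ord l) MN.
  by rewrite sumr_const card_ord mulr_natr.
by rewrite natrM; have := le_trans low up; rewrite sumr_const -[X in X <= _ -> _]mulr_natl mulrA ler_pdivrMr.
Qed.

End UpperBound.

(** * Matchings in bipartite graphs *)

Section Hall.
Variables (I T : finType).
Implicit Types (N : I -> {set T}) (X A : {set I}).

Definition nbh N X := \bigcup_(u in X) N u.

Lemma nbhU N X A : nbh N (X :|: A) = nbh N X :|: nbh N A.
Proof. exact: bigcup_setU. Qed.

Lemma nbhS N X A : X \subset A -> nbh N X \subset nbh N A.
Proof. by move=> s; apply/bigcupsP => u uX; apply: bigcup_sup; apply: (subsetP s). Qed.

Definition hallc (U : {set I}) N := forall X, X \subset U -> #|X| <= #|nbh N X|.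

(** This is the step of Rado's proof of Hall's theorem. If deleting [y1] and deleting [y2] both
    break the condition, the two violating sets contain [u0]; removing it leaves [A1] and [A2], and
    the condition for [u0 |: (A1 :|: A2)] and [A1 :&: A2] contradicts
    [#|P :|: Q| + #|P :&: Q| = #|P| + #|Q|]. *)
Lemma hall_shrink (U : {set I}) N u0 y1 y2 : hallc U N -> u0 \in U -> y1 != y2 -> y1 \in N u0 -> y2 \in N u0 ->
  hallc U (fun u => if u == u0 then N u :\ y1 else N u) \/
  hallc U (fun u => if u == u0 then N u :\ y2 else N u).
Proof.
move=> h u0U y12 yN1 yN2.
pose N' y := fun u => if u == u0 then N u :\ y else N u.
have out y X : u0 \notin X -> nbh (N' y) X = nbh N X.
  move=> uX; apply: eq_bigr => u uX'; rewrite /N'; case: eqP => // e.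
  by rewrite -e uX' in uX.
have [/existsP[X1 /andP[s1 l1]]|/existsPn h1] := boolP [exists X : {set I}, (X \subset U) && (#|nbh (N' y1) X| < #|X|)]; last first.
  by left=> X XU; move: (h1 X); rewrite XU /= -leqNgt.
have [/existsP[X2 /andP[s2 l2]]|/existsPn h2] := boolP [exists X : {set I}, (X \subset U) && (#|nbh (N' y2) X| < #|X|)]; last first.
  by right=> X XU; move: (h2 X); rewrite XU /= -leqNgt.
exfalso.
have dec y X : X \subset U -> #|nbh (N' y) X| < #|X| -> exists A,
   [/\ u0 \notin A, A \subset U & #|nbh N A :|: (N u0 :\ y)| <= #|A|].
  move=> sX lX; have uX : u0 \in X.
    by apply: contraLR lX => uX; rewrite out // -leqNgt h.
  exists (X :\ u0); rewrite !inE eqxx; split=> //; first by apply: subset_trans (subsetDl _ _) sX.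
  move: lX; rewrite (cardsD1 u0 X) uX add1n ltnS; apply: leq_trans; apply: subset_leq_card.
  have o : nbh (N' y) (X :\ u0) = nbh N (X :\ u0) by apply: out; rewrite !inE eqxx.
  rewrite -o -{2}(setD1K uX) nbhU setUC.
  by rewrite setSU // /nbh big_set1 /N' eqxx.
have [A1 [n1 sA1 c1]] := dec _ _ s1 l1; have [A2 [n2 sA2 c2]] := dec _ _ s2 l2.
set P := _ :|: _ in c1; set Q := _ :|: _ in c2.
have e1 : #|u0 |: (A1 :|: A2)| <= #|P :|: Q|.
  apply: leq_trans (h _ _) _; first by rewrite !subUset sub1set u0U sA1.
  apply: subset_leq_card; rewrite !nbhU /nbh big_set1 !subUset -/(nbh N A1) -/(nbh N A2).
  apply/and3P; split.
  - apply/subsetP=> t tN; rewrite !inE; have [->|] := eqVneq t y1.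
      by rewrite y12 yN1 !orbT.
    by rewrite tN /= !orbT.
  - by rewrite /P -!setUA subsetUl.
  - by rewrite /Q setUC -!setUA subsetUl.
have e2 : #|A1 :&: A2| <= #|P :&: Q|.
  apply: leq_trans (h _ _) _; first by apply: subset_trans sA1; apply: subsetIl.
  apply: subset_leq_card; rewrite subsetI; apply/andP; split; apply: subset_trans (subsetUl _ _).
    by apply: nbhS; apply: subsetIl.
  by apply: nbhS; apply: subsetIr.
move: e1; rewrite cardsU1 inE negb_or n1 n2 add1n => e1.
have := cardsUI P Q; have := cardsUI A1 A2; lia.
Qed.

(** Induction on the total size of the lists: [hall_shrink] deletes elements until all lists are
    singletons, and then Hall's condition on two-element sets is injectivity. The type [option T]
    avoids a default element of [T]. *)
Lemma hall (U : {set I}) N : hallc U N ->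
  exists f : I -> option T, {in U &, injective f} /\ forall u, u \in U -> exists2 y, f u = Some y & y \in N u.
Proof.
move: {2}(\sum_(u in U) #|N u|) (leqnn (\sum_(u in U) #|N u|)) => k.
elim: k N => [|k IH] N hk h.
  exists (fun=> None); have U0 u : u \in U -> False.
    move=> uU; have := h [set u]; rewrite sub1set uU cards1 /nbh big_set1 => /(_ isT).
    by move: hk; rewrite (bigD1 u) //=; lia.
  by split=> [u v /U0|u /U0].
have [/exists_inP[u0 u0U /card_gt1P[y1 [y2 [yN1 yN2 y12]]]]|/exists_inPn hn] :=
    boolP [exists u in U, 1 < #|N u|].
  have lt y : y \in N u0 -> \sum_(u in U) #|if u == u0 then N u :\ y else N u| <= k.
    move=> yN; rewrite -ltnS; apply: leq_trans hk; rewrite (bigD1 u0) //= [X in _ < X](bigD1 u0) //=.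
    rewrite eqxx (cardsD1 y (N u0)) yN add1n addSn ltnS leq_add2l.
    by apply: leq_sum => u /andP[_ /negbTE->].
  have sub y u : (if u == u0 then N u :\ y else N u) \subset N u.
    by case: eqP => // _; apply: subsetDl.
  have [h1|h1] := hall_shrink h u0U y12 yN1 yN2.
    have [f [fi fN]] := IH _ (lt _ yN1) h1; exists f; split=> // u uU.
    by have [y fy yy] := fN u uU; exists y => //; apply: (subsetP (sub y1 u)).
  have [f [fi fN]] := IH _ (lt _ yN2) h1; exists f; split=> // u uU.
  by have [y fy yy] := fN u uU; exists y => //; apply: (subsetP (sub y2 u)).
have N1 u : u \in U -> exists y, N u = [set y].
  move=> uU; apply/cards1P; rewrite eqn_leq leqNgt hn //=.
  by have := h [set u]; rewrite sub1set uU cards1 /nbh big_set1; apply.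
exists (fun u => [pick y in N u]); split.
  move=> u v uU vU; have [y ey] := N1 u uU; have [z ez] := N1 v vU.
  case: pickP => [y'|/(_ y)]; last by rewrite ey set11.
  case: pickP => [z'|/(_ z)]; last by rewrite ez set11.
  rewrite ey ez !inE => /eqP -> /eqP -> [yz].
  apply/eqP; apply: contraT => uv; have := h [set u; v].
  rewrite subUset !sub1set uU vU cards2 uv => /(_ isT).
  by rewrite nbhU /nbh !big_set1 ey ez yz setUid cards1.
move=> u uU; have [y ey] := N1 u uU; case: pickP => [y'|/(_ y)]; last by rewrite ey set11.
by exists y'.
Qed.

End Hall.

Section Koenig.
Variable V : finType.
Implicit Types (W : {set V}) (L : rel V).

Definition bireg (U1 U2 : {set V}) L k :=
  (forall u, u \in U1 -> #|[set x in U2 | L u x]| = k) /\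
  (forall x, x \in U2 -> #|[set u in U1 | L u x]| = k).

Lemma bireg_matching U1 U2 L k : bireg U1 U2 L k.+1 ->
  exists f : V -> V, [/\ {in U1 &, injective f}, forall u, u \in U1 -> f u \in U2 /\ L u (f u) &
    forall x, x \in U2 -> exists2 u, u \in U1 & f u = x].
Proof.
move=> [r1 r2].
have h : hallc U1 (fun u => [set x in U2 | L u x]).
  move=> X XU; rewrite -(leq_pmul2r (ltn0Sn k)) -sum_nat_const.
  apply: (@leq_trans (\sum_(u in X) #|[set x in U2 | L u x]|)).
    by apply: leq_sum => u uX; rewrite r1 // (subsetP XU).
  rewrite -sum_nat_const.
  under eq_bigr => u _ do rewrite -sum1_card big_mkcond /=.
  rewrite exchange_big [X in _ <= X]big_mkcond /=; apply: leq_sum => x _.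
  have [xN|xN] := boolP (x \in nbh _ _).
    have xU : x \in U2 by move: xN => /bigcupP[u _]; rewrite inE => /andP[].
    rewrite -(r2 x xU) -sum1_card big_mkcond [X in _ <= X]big_mkcond /=.
    apply: leq_sum => u _; rewrite !inE; case: ifP => // /(subsetP XU) ->.
    by rewrite ?xU /=; case: (L u x).
  rewrite big1 // => u uX; case: ifP => // hx; case/negP: xN.
  by apply/bigcupP; exists u.
have [f [fi fN]] := hall h.
have [U0|[u0 u0U]] := set_0Vmem U1.
  exists id; split=> [u v|u|x xU]; rewrite ?U0 ?inE //.
  by move: (r2 x xU); rewrite U0 (_ : [set _ in _ | _] = set0) ?cards0 //; apply/setP=> t; rewrite !inE.
pose g u := odflt u0 (f u).
have gP u : u \in U1 -> f u = Some (g u) /\ (g u \in U2) && L u (g u).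
  by move=> uU; have [y fy yN] := fN u uU; rewrite /g fy; move: yN; rewrite inE.
have gi : {in U1 &, injective g}.
  by move=> u v uU vU e; apply: fi => //; rewrite (gP u uU).1 (gP v vU).1 e.
have c12 : #|U1| = #|U2|.
  apply/eqP; rewrite -(eqn_pmul2r (ltn0Sn k)) -!sum_nat_const; apply/eqP.
  transitivity (\sum_(u in U1) #|[set x in U2 | L u x]|); first by apply: eq_bigr => u /r1->.
  transitivity (\sum_(x in U2) #|[set u in U1 | L u x]|); last by apply: eq_bigr => u /r2->.
  transitivity (\sum_(u in U1) \sum_(x in U2) (L u x : nat)).
    by apply: eq_bigr => u _; rewrite -sum1_card -big_mkcondr; apply: eq_bigl => x; rewrite inE.
  rewrite exchange_big; apply: eq_bigr => u _; rewrite -sum1_card -big_mkcondr.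
  by apply: eq_bigl => x; rewrite inE.
exists g; split=> //; first by move=> u /gP[_ /andP[]].
have im : g @: U1 = U2.
  apply/eqP; rewrite eqEcard card_in_imset // c12 leqnn andbT.
  by apply/subsetP=> y /imsetP[u /gP[_ /andP[h1 _]] ->].
by move=> x; rewrite -im => /imsetP[u uU ->]; exists u.
Qed.

(** One perfect matching is removed for each element of [W]. The colours are the elements of [W]
    themselves, so that a colour can serve as the third point of a triple. *)
Lemma bireg_coloring U1 U2 W L : bireg U1 U2 L #|W| ->
  exists c : V -> V -> V,
  [/\ forall u x, u \in U1 -> x \in U2 -> L u x -> c u x \in W,
     forall u x y, u \in U1 -> x \in U2 -> y \in U2 -> L u x -> L u y -> c u x = c u y -> x = y &
     forall u v x, u \in U1 -> v \in U1 -> x \in U2 -> L u x -> L v x -> c u x = c v x -> u = v].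
Proof.
move: {2}#|W| (erefl #|W|) => k; elim: k W L => [|k IH] W L cW [r1 r2].
  exists (fun u _ => u).
  have no u x : u \in U1 -> x \in U2 -> L u x -> False.
    move=> uU xU lx; have := r1 u uU; rewrite cW => /eqP; rewrite cards_eq0 => /eqP/setP/(_ x).
    by rewrite !inE xU lx.
  by split=> [u x uU xU /(no _ _ uU xU)|u x y uU xU yU /(no _ _ uU xU)|u v x uU _ xU /(no _ _ uU xU)].
have [w0 w0W] : exists w0, w0 \in W by apply/card_gt0P; rewrite cW.
have cW' : #|W :\ w0| = k by move: (cardsD1 w0 W); rewrite w0W cW add1n => -[].
rewrite cW in r1 r2.
have [f [fi fL fs]] := bireg_matching (conj r1 r2).
have [|c [c1 c2 c3]] := IH (W :\ w0) (fun u x => L u x && (x != f u)) cW'.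
  rewrite cW'; split=> [u uU|x xU].
    have [fU Lf] := fL u uU.
    have := cardsD1 (f u) [set x in U2 | L u x]; rewrite r1 // inE fU Lf add1n => -[->].
    by apply: eq_card => x; rewrite !inE; case: (x \in U2); case: (L u x); case: (x == f u).
  have [u0 u0U fu0] := fs x xU; have [fU Lf] := fL u0 u0U.
  have := cardsD1 u0 [set u in U1 | L u x]; rewrite r2 // inE u0U -fu0 Lf add1n => -[->].
  apply: eq_card => u; rewrite !inE; case uU: (u \in U1); rewrite ?andbF //=.
  have -> : (f u0 == f u) = (u == u0) by apply/eqP/eqP => [/fi -> //|->].
  by case: (L u _); case: (u == u0).
exists (fun u x => if x == f u then w0 else c u x).
have in' u x : u \in U1 -> x \in U2 -> L u x -> x != f u -> c u x \in W /\ c u x != w0.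
  by move=> uU xU lx xf; have := c1 u x uU xU; rewrite lx xf => /(_ isT); rewrite !inE => /andP[].
split.
- by move=> u x uU xU lx; case: eqVneq => // xf; case: (in' u x).
- move=> u x y uU xU yU lx ly; case: eqVneq => [->|xf]; case: eqVneq => [->|yf] //.
  + by move=> e; have [_] := in' u y uU yU ly yf; rewrite -e eqxx.
  + by move=> e; have [_] := in' u x uU xU lx xf; rewrite e eqxx.
  + by apply: c2 => //; rewrite ?lx ?ly ?xf ?yf.
- move=> u v x uU vU xU lx ly; case: eqVneq => [xu|xf]; case: eqVneq => [xv|yf] //.
  + by move=> _; apply: fi => //; rewrite -xu.
  + by move=> e; have [_] := in' v x vU xU ly yf; rewrite -e eqxx.
  + by move=> e; have [_] := in' u x uU xU lx xf; rewrite e eqxx.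
  + by apply: c3 => //; rewrite ?lx ?ly ?xf ?yf.
Qed.

End Koenig.

(** * Completion of systems *)

Section Systems.
Variable V : finType.
Implicit Types (S Q : {set {set V}}) (e f : {set V}) (U W : {set V}).

Definition triples S := forall e, e \in S -> #|e| = 3.
Definition linsys S := forall e f x y, e \in S -> f \in S -> x != y ->
  x \in e -> y \in e -> x \in f -> y \in f -> e = f.

Lemma linsys_sts S : triples S -> linsys S -> (forall x y, x != y -> cov S x y) ->
  steiner_triple_system S.
Proof.
move=> t l c; apply/stsP; split=> // x y xy.
have /existsP[e /andP[eS /andP[xe ye]]] := c x y xy.
apply/eqP/cards1P; exists e; apply/setP => f; rewrite !inE.
apply/andP/eqP => [[fS /andP[xf yf]]|->]; last by rewrite eS xe.
exact: l xy xf yf xe ye.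
Qed.

Lemma packing_triples G Q : packing G Q -> triples Q.
Proof. by move=> /packingP[s _] e eQ; have /triP[] := subsetP s e eQ. Qed.

Lemma packing_linsys G Q : packing G Q -> linsys Q.
Proof.
move=> /packingP[_ h] e f x y eQ fQ xy xe ye xf yf.
have := h x y xy; rewrite leqNgt; apply: contraNeq => ef.
by apply/card_gt1P; exists e, f; rewrite !inE eQ fQ xe ye xf yf.
Qed.

Lemma linsysU S Q : linsys S -> linsys Q ->
  (forall x y, x != y -> cov S x y -> cov Q x y -> False) -> linsys (S :|: Q).
Proof.
move=> lS lQ d e f x y; have cv (P : {set {set V}}) g : g \in P -> x \in g -> y \in g -> cov P x y.
  by move=> gP xg yg; apply/existsP; exists g; rewrite gP xg.
rewrite !in_setU => /orP[eS|eQ] /orP[fS|fQ] xy xe ye xf yf.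
- exact: lS xy xe ye xf yf.
- by case: (d x y xy (cv _ _ eS xe ye) (cv _ _ fQ xf yf)).
- by case: (d x y xy (cv _ _ fS xf yf) (cv _ _ eQ xe ye)).
- exact: lQ xy xe ye xf yf.
Qed.

Lemma triplesU S Q : triples S -> triples Q -> triples (S :|: Q).
Proof. by move=> tS tQ e; rewrite in_setU => /orP[/tS|/tQ]. Qed.

Lemma cov_setU S Q x y : cov (S :|: Q) x y = cov S x y || cov Q x y.
Proof.
apply/existsP/orP => [[e /andP[]]|[/existsP[e /andP[eS h]]|/existsP[e /andP[eQ h]]]].
- by rewrite in_setU => /orP[eS|eQ] h; [left|right]; apply/existsP; exists e; rewrite ?eS ?eQ.
- by exists e; rewrite in_setU eS.
- by exists e; rewrite in_setU eQ orbT.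
Qed.

Lemma enum_bij (T : finType) W : #|T| = #|W| ->
  exists g : T -> V, [/\ injective g, forall t, g t \in W & forall x, x \in W -> exists t, g t = x].
Proof.
move=> c; pose g t := enum_val (cast_ord c (enum_rank t)).
have gi : injective g by move=> s t /enum_val_inj/cast_ord_inj/enum_rank_inj.
exists g; split=> // [t|x xW]; first exact: enum_valP.
have im : g @: T = W.
  apply/eqP; rewrite eqEcard card_imset // c leqnn andbT.
  by apply/subsetP=> y /imsetP[t _ ->]; apply: enum_valP.
by move: xW; rewrite -im => /imsetP[t _ ->]; exists t.
Qed.

Section Affine.
Variable j : nat.
Notation T := 'rV['Z_3]_j.
Local Open Scope ring_scope.

Lemma aff_torsion (x : T) : x + x + x = 0.
Proof.
apply/matrixP=> k i; rewrite !mxE; move: (x k i) => y; apply/val_inj.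
by case: y => [[|[|[|]]]].
Qed.

(** The line through [x] and [y] in the affine space over the field of three elements: three
    distinct points lie on a line when their sum is 0. *)
Definition aff (x y : T) : {set T} := [set x; y; - (x + y)].

Lemma aff_neq (x y : T) : x != y -> (x != - (x + y)) && (y != - (x + y)).
Proof.
move=> xy; apply/andP; split; apply: contraNneq xy => e.
  have : x + x + y = 0 by rewrite -addrA {1}e addNr.
  by move/eqP; rewrite -(aff_torsion x) => /eqP/addrI->.
have : y + y + x = 0 by rewrite -addrA [y + x]addrC {1}e addNr.
by move/eqP; rewrite -(aff_torsion y) => /eqP/addrI->.
Qed.

Lemma aff_eq (x y s t : T) : x != y -> s != t -> s \in aff x y -> t \in aff x y -> aff x y = aff s t.
Proof.
have r1 (a b : T) : - (a + - (a + b)) = b by rewrite opprD opprK addrA addNr add0r.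
have r2 (a b : T) : - (- (a + b) + a) = b by rewrite addrC r1.
move=> xy process_state; rewrite !inE -!orbA => /or3P[]/eqP es /or3P[]/eqP et; move: process_state; rewrite es et ?eqxx // => _.
- by rewrite {2}/aff r1 /aff setUAC.
- by rewrite /aff [y + x]addrC [[set y] :|: _]setUC.
- by rewrite {2}/aff {2}[x + y]addrC r1 /aff [RHS]setUC setUA.
- by rewrite {2}/aff r2 /aff [LHS]setUC setUA.
- by rewrite {2}/aff {2}[x + y]addrC r2 /aff [LHS]setUC -[RHS]setUA [[set y] :|: _]setUC.
Qed.

End Affine.

Lemma affine_system W j : #|W| = 3 ^ j -> exists S,
  [/\ triples S, linsys S, forall e, e \in S -> e \subset W &
    forall x y, x \in W -> y \in W -> x != y -> cov S x y].
Proof.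
move=> cW; have [|g [gi gW gs]] := @enum_bij 'rV['Z_3]_j W.
  by rewrite card_mx card_ord mul1n cW.
exists [set g @: aff xy.1 xy.2 | xy : 'rV['Z_3]_j * 'rV['Z_3]_j & xy.1 != xy.2].
split.
- move=> e /imsetP[[x y]]; rewrite inE /= => xy ->.
  rewrite card_imset //; have /andP[h1 h2] := aff_neq xy; exact: cards3.
- move=> e f p q /imsetP[[x y]]; rewrite inE /= => xy -> /imsetP[[x' y']].
  rewrite inE /= => xy' -> pq /imsetP[s s1 es] /imsetP[t t1 et].
  rewrite es et; rewrite !(mem_imset _ _ gi) => s2 t2.
  have process_state : s != t by apply: contraNneq pq => e'; rewrite es et e'.
  by rewrite (aff_eq xy process_state s1 t1) (aff_eq xy' process_state s2 t2).
- by move=> e /imsetP[[x y] _ ->]; apply/subsetP=> p /imsetP[s _ ->].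
- move=> x y /gs[s <-] /gs[t <-] process_state; apply/existsP; exists (g @: aff s t); apply/and3P; split.
  + by apply/imsetP; exists (s, t) => //; rewrite inE /=; apply: contraNneq process_state => ->.
  + by apply: imset_f; rewrite !inE eqxx.
  + by apply: imset_f; rewrite !inE eqxx orbT.
Qed.

(* The uncovered pairs between [U1] and [U2] split into #|W| perfect matchings
   indexed by [W]; an edge in the matching of [c] forms a triple with [c]. *)
Lemma completion (U1 U2 W : {set V}) Q j :
  [disjoint U1 & U2] -> W = ~: (U1 :|: U2) -> #|W| = 3 ^ j ->
  triples Q -> linsys Q -> (forall e, e \in Q -> e \subset U1 :|: U2) ->
  (forall x y, x \in U1 -> y \in U1 -> x != y -> cov Q x y) ->
  (forall x y, x \in U2 -> y \in U2 -> x != y -> cov Q x y) ->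
  bireg U1 U2 (fun u x => ~~ cov Q u x) #|W| ->
  exists S, steiner_triple_system S /\ Q \subset S.
Proof.
move=> d12 eW cW tQ lQ QU c1 c2 reg.
have [SW [tW lW sW covW]] := affine_system cW.
have [c [k1 k2 k3]] := bireg_coloring reg.
pose Lp := [set ux : V * V | [&& ux.1 \in U1, ux.2 \in U2 & ~~ cov Q ux.1 ux.2]].
pose blk (ux : V * V) := [set ux.1; ux.2; c ux.1 ux.2].
have inL ux : ux \in Lp -> [/\ ux.1 \in U1, ux.2 \in U2, ~~ cov Q ux.1 ux.2 & c ux.1 ux.2 \in W].
  by rewrite inE => /and3P[h1 h2 h3]; split=> //; apply: k1.
have n12 u x : u \in U1 -> x \in U2 -> u != x.
  by move=> uU xU; apply: contraTneq xU => <-; rewrite (disjointFr d12).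
have n1W u x : u \in U1 -> x \in W -> u != x.
  by move=> uU; apply: contraTneq => <-; rewrite eW !inE uU.
have n2W u x : u \in U2 -> x \in W -> u != x.
  by move=> uU; apply: contraTneq => <-; rewrite eW !inE uU orbT.
have bin ux p : ux \in Lp -> p \in blk ux ->
   [/\ p \in U1 -> p = ux.1, p \in U2 -> p = ux.2 & p \in W -> p = c ux.1 ux.2].
  move=> /inL[h1 h2 _ h3]; rewrite !inE -orbA => /or3P[]/eqP->; split=> // hp.
  - by have := n12 _ _ h1 hp; rewrite eqxx.
  - by have := n1W _ _ h1 hp; rewrite eqxx.
  - by have := n12 _ _ hp h2; rewrite eqxx.
  - by have := n2W _ _ h2 hp; rewrite eqxx.
  - by have := n1W _ _ hp h3; rewrite eqxx.
  - by have := n2W _ _ hp h3; rewrite eqxx.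
have tri3 p : [|| p \in U1, p \in U2 | p \in W].
  by rewrite eW !inE; case: (p \in U1); case: (p \in U2).
pose SL := blk @: Lp.
have tL : triples SL.
  move=> e /imsetP[ux /inL[h1 h2 _ h3] ->]; apply: cards3; [exact: n12|exact: n1W|exact: n2W].
(* Any two of the two ends and the colour of an uncovered cross pair determine it, because the
   colouring is proper at both ends. *)
have key ux vy p q : ux \in Lp -> vy \in Lp -> p != q -> p \in blk ux -> q \in blk ux ->
   p \in blk vy -> q \in blk vy -> ux = vy.
  move=> uL vL pq pu qu pv qv.
  have [a1 a2 a3] := bin _ _ uL pu; have [b1 b2 b3] := bin _ _ uL qu.
  have [a1' a2' a3'] := bin _ _ vL pv; have [b1' b2' b3'] := bin _ _ vL qv.
  have [u1 u2 u3 _] := inL _ uL; have [v1 v2 v3 _] := inL _ vL.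
  case: ux vy {uL vL pu qu pv qv} a1 a2 a3 b1 b2 b3 a1' a2' a3' b1' b2' b3' u1 u2 u3 v1 v2 v3 => u x [v y] /=.
  move=> a1 a2 a3 b1 b2 b3 a1' a2' a3' b1' b2' b3' u1 u2 u3 v1 v2 v3.
  case/or3P: (tri3 p) => hp; case/or3P: (tri3 q) => hq.
  - by move: pq; rewrite (a1 hp) (b1 hq) eqxx.
  - by rewrite -(a1 hp) -(a1' hp) -(b2 hq) -(b2' hq).
  - have e : u = v by rewrite -(a1 hp) (a1' hp).
    by subst v; rewrite (k2 u x y) // -(b3 hq) (b3' hq).
  - by rewrite -(a2 hp) -(a2' hp) -(b1 hq) -(b1' hq).
  - by move: pq; rewrite (a2 hp) (b2 hq) eqxx.
  - have e : x = y by rewrite -(a2 hp) (a2' hp).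
    by subst y; rewrite (k3 u v x) // -(b3 hq) (b3' hq).
  - have e : u = v by rewrite -(b1 hq) (b1' hq).
    by subst v; rewrite (k2 u x y) // -(a3 hp) (a3' hp).
  - have e : x = y by rewrite -(b2 hq) (b2' hq).
    by subst y; rewrite (k3 u v x) // -(a3 hp) (a3' hp).
  - by move: pq; rewrite (a3 hp) (b3 hq) eqxx.
have lL : linsys SL.
  move=> e f p q /imsetP[ux uL ->] /imsetP[vy vL ->] pq pu qu pv qv.
  by rewrite (key ux vy p q).
have covQU x y : cov Q x y -> (x \notin W) && (y \notin W).
  move=> /existsP[e /and3P[eQ xe ye]]; rewrite eW !in_setC !negbK.
  by rewrite !(subsetP (QU e eQ)).
have covWW x y : cov SW x y -> (x \in W) && (y \in W).
  by move=> /existsP[e /and3P[eQ xe ye]]; rewrite !(subsetP (sW e eQ)).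
have covLL x y : x != y -> cov SL x y -> ~~ cov Q x y /\ ~~ ((x \in W) && (y \in W)).
  move=> xy /existsP[e /and3P[/imsetP[ux uL ->] xe ye]].
  have [a1 a2 a3] := bin _ _ uL xe; have [b1 b2 b3] := bin _ _ uL ye; have [u1 u2 u3 u4] := inL _ uL.
  split; last by apply/negP => /andP[/a3 ex /b3 ey]; rewrite ex ey eqxx in xy.
  apply/negP => /[dup] cv /covQU/andP[xW yW].
  case/or3P: (tri3 x) => hx; case/or3P: (tri3 y) => hy; rewrite ?hx ?hy // in xW yW.
  - by rewrite (a1 hx) (b1 hy) eqxx in xy.
  - by rewrite (a1 hx) (b2 hy) (negbTE u3) in cv.
  - by rewrite (a2 hx) (b1 hy) cov_sym (negbTE u3) in cv.
  - by rewrite (a2 hx) (b2 hy) eqxx in xy.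
exists (Q :|: SL :|: SW); split; last by rewrite -setUA subsetUl.
apply: linsys_sts.
- by do 2!apply: triplesU => //.
- apply: linsysU => //; first apply: linsysU => //.
    by move=> x y xy h1 /(covLL _ _ xy)[h2 _]; rewrite h1 in h2.
  move=> x y xy; rewrite cov_setU => /orP[/covQU/andP[h _]|/(covLL _ _ xy)[_ h]] /covWW h2.
    by case/andP: h2 => h2; rewrite h2 in h.
  by rewrite h2 in h.
- have cvL u x p q : u \in U1 -> x \in U2 -> ~~ cov Q u x -> p \in blk (u, x) -> q \in blk (u, x) -> cov SL p q.
    move=> uU xU nc pb qb; apply/existsP; exists (blk (u, x)); rewrite pb qb !andbT.
    by apply/imsetP; exists (u, x) => //; rewrite inE /= uU xU.
  (* The colours at [u] are distinct and there are exactly [#|W|] of them, so each element of [W]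
     occurs. *)
  have surj1 u z : u \in U1 -> z \in W -> exists x, [/\ x \in U2, ~~ cov Q u x & c u x = z].
    move=> uU zW; pose N := [set x in U2 | ~~ cov Q u x].
    have inj : {in N &, injective (c u)}.
      by move=> x y /setIdP[xU nx] /setIdP[yU ny]; apply: k2.
    have im : c u @: N = W.
      apply/eqP; rewrite eqEcard card_in_imset // (reg.1 u uU) leqnn andbT.
      by apply/subsetP=> y /imsetP[x /setIdP[xU nx] ->]; apply: k1.
    by move: zW; rewrite -im => /imsetP[x /setIdP[xU nx] ->]; exists x.
  have surj2 x z : x \in U2 -> z \in W -> exists u, [/\ u \in U1, ~~ cov Q u x & c u x = z].
    move=> xU zW; pose N := [set u in U1 | ~~ cov Q u x].
    have inj : {in N &, injective (c^~ x)}.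
      by move=> u v /setIdP[uU nu] /setIdP[vU nv]; apply: k3.
    have im : c^~ x @: N = W.
      apply/eqP; rewrite eqEcard card_in_imset // (reg.2 x xU) leqnn andbT.
      by apply/subsetP=> y /imsetP[u /setIdP[uU nu] ->]; apply: k1.
    by move: zW; rewrite -im => /imsetP[u /setIdP[uU nu] ->]; exists u.
  have c12 x y : x \in U1 -> y \in U2 -> cov (Q :|: SL) x y.
    move=> xU yU; rewrite cov_setU; case: (boolP (cov Q x y)) => //= nc.
    by apply: (cvL x y) => //; rewrite !inE eqxx ?orbT.
  have c1W x y : x \in U1 -> y \in W -> cov (Q :|: SL) x y.
    move=> xU yU; have [z [zU nz <-]] := surj1 x y xU yU; rewrite cov_setU.
    by rewrite (cvL x z) ?orbT //= !inE eqxx ?orbT.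
  have c2W x y : x \in U2 -> y \in W -> cov (Q :|: SL) x y.
    move=> xU yU; have [z [zU nz <-]] := surj2 x y xU yU; rewrite cov_setU.
    by rewrite (cvL z x) ?orbT //= !inE eqxx ?orbT.
  move=> x y xy; rewrite cov_setU.
  case/or3P: (tri3 x) => hx; case/or3P: (tri3 y) => hy.
  - by rewrite cov_setU c1.
  - by rewrite c12.
  - by rewrite c1W.
  - by rewrite cov_sym c12.
  - by rewrite cov_setU c2.
  - by rewrite c2W.
  - by rewrite cov_sym c1W.
  - by rewrite cov_sym c2W.
  - by rewrite [cov SW x y]covW ?orbT.
Qed.

End Systems.

(** * Triples formed by inside pairs and their apexes *)

Section Apex.
Variable V : finType.
Implicit Types (S Q F : {set {set V}}) (e f : {set V}).

Section OneSide.
Variables (U B : {set V}) (F : {set {set V}}) (a : V -> {set {set V}}).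
Hypothesis UB : [disjoint U & B].
Hypothesis FU : forall e, e \in F -> #|e| = 2 /\ e \subset U.
Hypothesis aF : forall x, x \in B -> a x \subset F.
Hypothesis a_dis : forall x e f, x \in B -> e \in a x -> f \in a x -> e != f -> [disjoint e & f].
Hypothesis a_uniq : forall x y e, x \in B -> y \in B -> e \in a x -> e \in a y -> x = y.
Hypothesis a_cover : forall e, e \in F -> exists2 x, x \in B & e \in a x.

Definition apex_sys : {set {set V}} := \bigcup_(x in B) [set x |: e | e in a x].

Lemma apexP t : reflect (exists x e, [/\ x \in B, e \in a x & t = x |: e]) (t \in apex_sys).
Proof.
apply: (iffP bigcupP) => [[x xB /imsetP[e ea ->]]|[x [e [xB ea ->]]]]; first by exists x, e.
by exists x => //; apply: imset_f.
Qed.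

Lemma aU x e p : x \in B -> e \in a x -> p \in e -> p \in U.
Proof. by move=> xB /(subsetP (aF xB)) /FU[_ /subsetP]; apply. Qed.

Lemma nUB p : p \in U -> p \in B -> False.
Proof. by move=> pU pB; have := disjointFr UB pU; rewrite pB. Qed.

Lemma apex_triples : triples apex_sys.
Proof.
move=> t /apexP[x [e [xB ea ->]]]; have [c2 eU] := FU (subsetP (aF xB) e ea).
by rewrite cardsU1 c2; case: (boolP (x \in e)) => // /(aU xB ea)/nUB/(_ xB).
Qed.

Lemma in_blk x e p : x \in B -> e \in a x -> p \in x |: e ->
  (p \in B -> p = x) /\ (p \in U -> p \in e).
Proof.
move=> xB ea; rewrite in_setU1 => /orP[/eqP->|pe]; split=> //.
  by move=> xU; case: (nUB xU xB).
by move=> pB; case: (nUB (aU xB ea pe) pB).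
Qed.

Lemma apex_sub t : t \in apex_sys -> t \subset U :|: B.
Proof.
move=> /apexP[x [e [xB ea ->]]]; rewrite subUset sub1set in_setU xB orbT /=.
by apply/subsetP=> p pe; rewrite in_setU (aU xB ea pe).
Qed.

Lemma pair_eq e p q : #|e| = 2 -> p \in e -> q \in e -> p != q -> e = [set p; q].
Proof.
move=> c2 pe qe pq; apply/esym/eqP; rewrite eqEcard cards2 pq c2 leqnn andbT.
by rewrite subUset !sub1set pe qe.
Qed.

Lemma cov_apex_in p q : p \in U -> q \in U -> p != q -> cov apex_sys p q = ([set p; q] \in F).
Proof.
move=> pU qU pq; apply/existsP/idP => [[t /and3P[/apexP[x [e [xB ea ->]]] pt qt]]|eF].
  have [_ pe] := in_blk xB ea pt; have [_ qe] := in_blk xB ea qt.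
  have eF := subsetP (aF xB) e ea; have [c2 _] := FU eF.
  by rewrite -(pair_eq c2 (pe pU) (qe qU) pq).
have [x xB ea] := a_cover eF; exists (x |: [set p; q]).
by rewrite !inE !eqxx !orbT !andbT; apply/apexP; exists x, [set p; q].
Qed.

Lemma cov_apex_cross p q : p \in U -> q \in B -> cov apex_sys p q = (p \in \bigcup_(e in a q) e).
Proof.
move=> pU qB; apply/existsP/bigcupP => [[t /and3P[/apexP[x [e [xB ea ->]]] pt qt]]|[e ea pe]].
  have [_ pe] := in_blk xB ea pt; have [qx _] := in_blk xB ea qt.
  by exists e; [rewrite (qx qB)|apply: pe].
exists (q |: e); rewrite !inE eqxx pe orbT !andbT; apply/apexP; by exists q, e.
Qed.

Lemma cov_apex_apex p q : p \in B -> q \in B -> p != q -> cov apex_sys p q = false.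
Proof.
move=> pB qB pq; apply/existsP => -[t /and3P[/apexP[x [e [xB ea ->]]] pt qt]].
have [px _] := in_blk xB ea pt; have [qx _] := in_blk xB ea qt.
by rewrite px // qx // eqxx in pq.
Qed.

Lemma apex_linsys : linsys apex_sys.
Proof.
move=> s t p q /apexP[x [e [xB ea ->]]] /apexP[y [f [yB fa ->]]] pq ps qs pt qt.
have eF := subsetP (aF xB) e ea; have [ce _] := FU eF.
have fF := subsetP (aF yB) f fa; have [cf _] := FU fF.
have [ps1 ps2] := in_blk xB ea ps; have [qs1 qs2] := in_blk xB ea qs.
have [pt1 pt2] := in_blk yB fa pt; have [qt1 qt2] := in_blk yB fa qt.
have sub z g r : z \in B -> g \in a z -> r \in z |: g -> (r \in U) || (r \in B).
  move=> zB ga; rewrite in_setU1 => /orP[/eqP->|rg]; first by rewrite zB orbT.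
  by rewrite (aU zB ga rg).
have same r : r \in U -> x = y -> r \in e -> r \in f -> e = f.
  move=> rU xy re rf; apply/eqP; apply: contraT => ef.
  have fx : f \in a x by rewrite xy.
  by have := disjointFr (a_dis xB ea fx ef) re; rewrite rf.
case/orP: (sub _ _ _ xB ea ps) => hp; case/orP: (sub _ _ _ xB ea qs) => hq.
- have ef : e = f by rewrite (pair_eq ce (ps2 hp) (qs2 hq) pq) (pair_eq cf (pt2 hp) (qt2 hq) pq).
  by subst f; rewrite (a_uniq xB yB ea fa).
- have xy : x = y by rewrite -(qs1 hq) -(qt1 hq).
  by rewrite (same p hp xy (ps2 hp) (pt2 hp)) xy.
- have xy : x = y by rewrite -(ps1 hp) -(pt1 hp).
  by rewrite (same q hq xy (qs2 hq) (qt2 hq)) xy.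
- by rewrite (ps1 hp) (qs1 hq) eqxx in pq.
Qed.

(** The edges in one bin are disjoint, so distinct edges at [u] go to distinct apexes. *)
Lemma card_apex_at u :
  #|[set x in B | u \in \bigcup_(e in a x) e]| = #|[set e in F | u \in e]|.
Proof.
pose pk x := odflt set0 [pick e in a x | u \in e].
have pkP x : x \in B -> u \in \bigcup_(e in a x) e -> pk x \in a x /\ u \in pk x.
  move=> xB /bigcupP[e ea ue]; rewrite /pk; case: pickP => [g /andP[] //|/(_ e)].
  by rewrite ea ue.
rewrite -(card_in_imset (f:=pk)).
  apply: eq_card => e; apply/imsetP/setIdP => [[x /setIdP[xB xu] ->]|[eF ue]].
    by have [p1 p2] := pkP x xB xu; split=> //; apply: (subsetP (aF xB)).
  have [x xB ea] := a_cover eF; have xu : u \in \bigcup_(e in a x) e by apply/bigcupP; exists e.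
  exists x; first by rewrite inE xB.
  have [p1 p2] := pkP x xB xu; apply/eqP; apply: contraT => ne.
  by have := disjointFr (a_dis xB ea p1 ne) ue; rewrite p2.
move=> x y /setIdP[xB xu] /setIdP[yB yu] exy.
have [p1 _] := pkP x xB xu; have [p2 _] := pkP y yB yu.
by rewrite -exy in p2; apply: a_uniq p1 p2.
Qed.

Lemma card_apex_used x : x \in B -> #|\bigcup_(e in a x) e| = 2 * #|a x|.
Proof.
move=> xB; apply/eqP; rewrite eqn_leq; apply/andP; split.
  apply: leq_trans (card_bigcup_le _ _) _; rewrite mulnC -sum_nat_const; apply: leq_sum => e ea.
  by have [-> //] := FU (subsetP (aF xB) e ea).
rewrite mulnC -sum_nat_const.
apply: (@leq_trans (\sum_(e in a x) #|e|)).
  by apply: leq_sum => e ea; have [-> //] := FU (subsetP (aF xB) e ea).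
under eq_bigr => e _ do rewrite -sum1_card big_mkcond /=.
rewrite exchange_big -sum1_card [X in _ <= X]big_mkcond /=; apply: leq_sum => u _.
have [/bigcupP[e ea ue]|nu] := boolP (u \in _).
  rewrite (bigD1 e) //= ue big1 // => f /andP[fa fe]; case: ifP => // uf.
  by have := disjointFr (a_dis xB fa ea fe) uf; rewrite ue.
rewrite big1 // => e ea; case: ifP => // ue; case/negP: nu.
by apply/bigcupP; exists e.
Qed.

End OneSide.

Definition inside Q (U : {set V}) : {set {set V}} :=
  [set e : {set V} | [&& #|e| == 2, e \subset U & [forall x in e, forall y in e, (x != y) ==> ~~ cov Q x y]]].

Lemma inside_pair Q (U : {set V}) p q : p \in U -> q \in U -> p != q ->
  ([set p; q] \in inside Q U) = ~~ cov Q p q.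
Proof.
move=> pU qU pq; rewrite inE cards2 pq subUset !sub1set pU qU /=.
apply/forall_inP/idP => [/(_ p)|h x].
  by rewrite !inE eqxx => /(_ isT)/forall_inP/(_ q); rewrite !inE eqxx orbT => /(_ isT)/implyP/(_ pq).
rewrite !inE => /orP[]/eqP->; apply/forall_inP=> y; rewrite !inE => /orP[]/eqP->; apply/implyP; rewrite ?eqxx //.
by rewrite cov_sym.
Qed.

Lemma insideP Q (U : {set V}) e : e \in inside Q U -> #|e| = 2 /\ e \subset U.
Proof. by rewrite inE => /and3P[/eqP c s _]. Qed.

Section TwoSides.
Variables (U1 U2 W : {set V}) (Q : {set {set V}}) (q : V -> nat) (j : nat).
Variables (Delta qmin qmax a1 a3 a4 a5 : nat).
Notation okE G e x := [forall u in e, G u x].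
Notation X := (fun u x => ~~ cov Q u x).

(** These are the hypotheses of [exact_assignment] for pairs inside [U] with apexes in [B], with
    extra room [4 * qmax] and [Delta * Delta]. The extra room pays for the cross pairs already
    consumed by the other side. *)
Definition side_hyp (U B : {set V}) :=
  [/\ forall u, u \in U -> #|[set e in inside Q U | u \in e]| <= Delta,
     forall e, e \in inside Q U -> a1 + 2 * Delta + 4 * qmax <= #|[set x in B | okE X e x]|,
     forall A : {set {set V}}, A \subset inside Q U -> a1 * qmin <= #|A| ->
       #|[set x in B | #|[set e in A | okE X e x]| < a4 + Delta * Delta]| <= a3,
     forall y, y \in B -> a5 + Delta * Delta <= #|[set e in inside Q U | okE X e y]| &
     \sum_(x in B) q x = #|inside Q U|].

Hypothesis d12 : [disjoint U1 & U2].
Hypothesis eW : W = ~: (U1 :|: U2).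
Hypothesis cW : #|W| = 3 ^ j.
Hypothesis tQ : triples Q.
Hypothesis lQ : linsys Q.
Hypothesis QU : forall e, e \in Q -> e \subset U1 :|: U2.
Hypothesis q_bd : forall x, x \in U1 :|: U2 -> qmin <= q x <= qmax.
Hypothesis side1 : side_hyp U1 U2.
Hypothesis side2 : side_hyp U2 U1.
(** The balance at [u]: each inside pair at [u] will use one cross pair at [u], and each of the
    [q u] pairs with apex [u] will use two. Exactly [#|W|] cross pairs then remain, as the final
    bipartite graph requires. *)
Hypothesis deg1 : forall u, u \in U1 ->
  #|[set x in U2 | X u x]| = #|W| + #|[set e in inside Q U1 | u \in e]| + 2 * q u.
Hypothesis deg2 : forall x, x \in U2 ->
  #|[set u in U1 | X u x]| = #|W| + #|[set e in inside Q U2 | x \in e]| + 2 * q x.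
Hypothesis a4_big : 2 * qmax * Delta < a4.
Hypothesis a5_big : 2 * qmax * Delta + qmax * a3 < a5.

Lemma deg_all (U B : {set V}) : side_hyp U B -> forall u, #|[set e in inside Q U | u \in e]| <= Delta.
Proof.
move=> [h _ _ _ _] u; have [uU|uU] := boolP (u \in U); first exact: h.
rewrite (_ : [set _ in _ | _] = set0) ?cards0 //; apply/setP=> e; rewrite in_set in_set0.
by apply/negbTE/negP => /andP[/insideP[_ s] /(subsetP s)]; apply/negP.
Qed.

Lemma first_side : exists a : V -> {set {set V}},
  [/\ forall x, x \in U2 -> [/\ a x \subset inside Q U1, #|a x| = q x &
        forall e u, e \in a x -> u \in e -> X u x],
      forall x e e', x \in U2 -> e \in a x -> e' \in a x -> e != e' -> [disjoint e & e'],
      forall x x' e, x \in U2 -> x' \in U2 -> e \in a x -> e \in a x' -> x = x' &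
      forall e, e \in inside Q U1 -> exists2 x, x \in U2 & e \in a x].
Proof.
have [dg1 h11 h12 h13 s1] := side1.
apply: (@exact_assignment V (inside Q U1) U2 X q Delta qmin qmax a1 a3 a4 a5) => //.
- by move=> e /insideP[].
- exact: deg_all side1.
- by move=> x xU; apply: q_bd; rewrite in_setU xU orbT.
- by move=> e he; apply: leq_trans (h11 e he); apply: leq_addr.
- move=> A sA cA; apply: leq_trans (h12 A sA cA); apply/subset_leq_card/subsetP => x /setIdP[xU lx].
  by rewrite inE xU /=; apply: leq_trans lx (leq_addr _ _).
- by move=> y yU; apply: leq_trans (h13 y yU); apply: leq_addr.
Qed.

(** The pairs used by the first assignment are now forbidden. A point of [U1] loses at most [Delta]
    cross pairs and a point of [U2] at most [2 * qmax]; hence an inside pair of [U2] loses at most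
    [4 * qmax] apexes and an apex at most [Delta * Delta] pairs, which is the room left in
    [side_hyp]. *)
Lemma second_side (b1 : V -> {set {set V}}) :
  (forall x, x \in U2 -> b1 x \subset inside Q U1) ->
  (forall x, x \in U2 -> #|b1 x| = q x) ->
  (forall x e e', x \in U2 -> e \in b1 x -> e' \in b1 x -> e != e' -> [disjoint e & e']) ->
  (forall x x' e, x \in U2 -> x' \in U2 -> e \in b1 x -> e \in b1 x' -> x = x') ->
  (forall e, e \in inside Q U1 -> exists2 x, x \in U2 & e \in b1 x) ->
  exists a : V -> {set {set V}},
  [/\ forall x, x \in U1 -> [/\ a x \subset inside Q U2, #|a x| = q x &
        forall e u, e \in a x -> u \in e -> ~~ cov Q u x && (x \notin \bigcup_(e in b1 u) e)],
      forall x e e', x \in U1 -> e \in a x -> e' \in a x -> e != e' -> [disjoint e & e'],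
      forall x x' e, x \in U1 -> x' \in U1 -> e \in a x -> e \in a x' -> x = x' &
      forall e, e \in inside Q U2 -> exists2 x, x \in U1 & e \in a x].
Proof.
move=> b1F b1q b1d b1u b1c.
have [dg1 h11 h12 h13 s1] := side1; have [dg2 h21 h22 h23 s2] := side2.
pose forb u x := u \in \bigcup_(e in b1 x) e.
have fb_u u : u \in U1 -> #|[set x in U2 | forb u x]| <= Delta.
  by move=> uU; rewrite (card_apex_at b1F b1d b1u b1c) dg1.
have fb_x x : x \in U2 -> #|[set u in U1 | forb u x]| <= 2 * qmax.
  move=> xU; apply: (@leq_trans #|\bigcup_(e in b1 x) e|).
    by apply/subset_leq_card/subsetP => u /setIdP[].
  rewrite (card_apex_used (@insideP Q U1) b1F b1d xU) b1q // leq_mul2l.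
  by have /andP[_ ->] := q_bd (subsetP (subsetUr U1 U2) x xU).
pose ok2 v u := ~~ cov Q v u && ~~ forb u v.
have ok2E e u : okE ok2 e u = okE X e u && ~~ [exists v in e, forb u v].
  apply/forall_inP/andP => [h|[/forall_inP h1 /exists_inPn h2] v ve]; last first.
    by rewrite /ok2 h1 ?(h2 v ve).
  split; first by apply/forall_inP => v /h/andP[].
  by apply/exists_inPn => v /h/andP[].
have blkE u : u \in U1 -> #|[set e in inside Q U2 | [exists v in e, forb u v]]| <= Delta * Delta.
  move=> uU; apply: (@leq_trans (\sum_(v in [set x in U2 | forb u x]) #|[set e in inside Q U2 | v \in e]|)).
    apply: leq_trans (card_bigcup_le _ _); apply/subset_leq_card/subsetP => e /setIdP[eI /exists_inP[v ve fv]].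
    apply/bigcupP; exists v; last by rewrite inE eI.
    by rewrite inE fv andbT (subsetP (insideP eI).2).
  apply: (@leq_trans (\sum_(v in [set x in U2 | forb u x]) Delta)).
    by apply: leq_sum => v _; apply: deg_all side2 v.
  by rewrite sum_nat_const leq_mul2r fb_u ?orbT.
apply: (@exact_assignment V (inside Q U2) U1 ok2 q Delta qmin qmax a1 a3 a4 a5) => //.
- by move=> e /insideP[].
- exact: deg_all side2.
- by move=> x xU; apply: q_bd; rewrite in_setU xU.
- move=> e eI; rewrite -(leq_add2r (4 * qmax)); apply: leq_trans (h21 e eI) _.
  apply: (@leq_trans (#|[set x in U1 | okE ok2 e x]| + #|\bigcup_(v in e) [set u in U1 | forb u v]|)).
    apply: leq_trans (leq_card_setU _ _); apply/subset_leq_card/subsetP => u /setIdP[uU ou].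
    rewrite in_setU in_set uU ok2E ou /=; case: (boolP [exists v in e, forb u v]) => //= /exists_inP[v ve fv].
    by apply/bigcupP; exists v => //; rewrite inE uU.
  rewrite leq_add2l; apply: leq_trans (card_bigcup_le _ _) _.
  apply: (@leq_trans (\sum_(v in e) 2 * qmax)); last first.
    by rewrite sum_nat_const (insideP eI).1 mulnA.
  by apply: leq_sum => v ve; apply: fb_x; apply: (subsetP (insideP eI).2).
- move=> A sA cA; apply: leq_trans (h22 A sA cA); apply/subset_leq_card/subsetP => u /setIdP[uU lu].
  rewrite inE uU /=; apply: (@leq_ltn_trans (#|[set e in A | okE ok2 e u]| + Delta * Delta)); last by rewrite ltn_add2r.
  apply: (@leq_trans (#|[set e in A | okE ok2 e u]| + #|[set e in inside Q U2 | [exists v in e, forb u v]]|)); last by rewrite leq_add2l blkE.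
  apply: leq_trans (leq_card_setU _ _); apply/subset_leq_card/subsetP => e /setIdP[eA oe].
  by rewrite in_setU 2!in_set eA ok2E oe (subsetP sA) //=; case: [exists v in e, forb u v].
- move=> u uU; rewrite -(leq_add2r (Delta * Delta)); apply: leq_trans (h23 u uU) _.
  apply: (@leq_trans (#|[set e in inside Q U2 | okE ok2 e u]| + #|[set e in inside Q U2 | [exists v in e, forb u v]]|)); last by rewrite leq_add2l blkE.
  apply: leq_trans (leq_card_setU _ _); apply/subset_leq_card/subsetP => e /setIdP[eA oe].
  by rewrite in_setU 2!in_set eA ok2E oe /=; case: [exists v in e, forb u v].
Qed.

Lemma cardsD3 (A1 A2 A3 : {set V}) : A2 \subset A1 -> A3 \subset A1 :\: A2 ->
  #|A1| = #|A1 :\: A2 :\: A3| + #|A2| + #|A3|.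
Proof.
move=> s2 s3; rewrite -(cardsID A2 A1) (setIidPr s2) addnAC addnC; congr addn.
by rewrite -(cardsID A3 (A1 :\: A2)) (setIidPr s3) addnC.
Qed.

Lemma apex_completion : exists S, steiner_triple_system S /\ Q \subset S.
Proof.
have [b1 [b1a b1d b1u b1c]] := first_side.
have b1F x : x \in U2 -> b1 x \subset inside Q U1 by move=> /b1a[].
have b1q x : x \in U2 -> #|b1 x| = q x by move=> /b1a[].
have [b2 [b2a b2d b2u b2c]] := second_side b1F b1q b1d b1u b1c.
have b2F x : x \in U1 -> b2 x \subset inside Q U2 by move=> /b2a[].
have b2q x : x \in U1 -> #|b2 x| = q x by move=> /b2a[].
pose forb u x := u \in \bigcup_(e in b1 x) e.
have d21 : [disjoint U2 & U1] by rewrite disjoint_sym.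
pose T1 := apex_sys U2 b1; pose T2 := apex_sys U1 b2.
have I1 e : e \in inside Q U1 -> #|e| = 2 /\ e \subset U1 := @insideP Q U1 e.
have I2 e : e \in inside Q U2 -> #|e| = 2 /\ e \subset U2 := @insideP Q U2 e.
have c1in := cov_apex_in d12 I1 b1F b1c; have c1x := cov_apex_cross d12 I1 b1F.
have c1bb := cov_apex_apex d12 I1 b1F.
have c2in := cov_apex_in d21 I2 b2F b2c; have c2x := cov_apex_cross d21 I2 b2F.
have c2bb := cov_apex_apex d21 I2 b2F.
have side p (T : {set {set V}}) (U B : {set V}) : (forall t, t \in T -> t \subset U :|: B) ->
    forall r, cov T p r -> ((p \in U) || (p \in B)) && ((r \in U) || (r \in B)).
  move=> sT r /existsP[t /and3P[tT pt rt]].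
  by rewrite -!in_setU !(subsetP (sT t tT)).
have sub1 := @apex_sub U1 U2 _ _ I1 b1F; have sub2 := @apex_sub U2 U1 _ _ I2 b2F.
have forb_unc u x : u \in U1 -> x \in U2 -> forb u x -> ~~ cov Q u x.
  by move=> uU xU /bigcupP[e eb ue]; have [_ _ /(_ e u eb ue)] := b1a x xU.
have b2_unc v u : u \in U1 -> v \in \bigcup_(e in b2 u) e -> ~~ cov Q v u && ~~ forb u v.
  by move=> uU /bigcupP[e eb ue]; have [_ _ /(_ e v eb ue)] := b2a u uU.
have dis1 x y : x != y -> cov Q x y -> cov T1 x y -> False.
  move=> xy cq c1; case/andP: (side x T1 U1 U2 sub1 y c1) => /orP[] hx /orP[] hy.
  - by move: c1; rewrite c1in // inside_pair // cq.
  - by move: c1; rewrite c1x // => /(forb_unc _ _ hx hy); rewrite cq.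
  - by move: c1; rewrite cov_sym c1x // => /(forb_unc _ _ hy hx); rewrite cov_sym cq.
  - by move: c1; rewrite c1bb.
have dis2 x y : x != y -> cov Q x y -> cov T2 x y -> False.
  move=> xy cq c1; case/andP: (side x T2 U2 U1 sub2 y c1) => /orP[] hx /orP[] hy.
  - by move: c1; rewrite c2in // inside_pair // cq.
  - by move: c1; rewrite c2x // => /(b2_unc _ _ hy); rewrite cq.
  - by move: c1; rewrite cov_sym c2x // => /(b2_unc _ _ hx); rewrite cov_sym cq.
  - by move: c1; rewrite c2bb.
have dis3 x y : x != y -> cov T1 x y -> cov T2 x y -> False.
  move=> xy c1 c2; case/andP: (side x T2 U2 U1 sub2 y c2) => /orP[] hx /orP[] hy.
  - by move: c1; rewrite c1bb.
  - move: c1 c2; rewrite cov_sym c1x // c2x // => fb /(b2_unc _ _ hy)/andP[_ /negP]; exact.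
  - move: c1 c2; rewrite c1x // [cov T2 _ _]cov_sym c2x // => fb /(b2_unc _ _ hx)/andP[_ /negP]; exact.
  - by move: c2; rewrite c2bb.
have cQ' x y : cov (Q :|: T1 :|: T2) x y = [|| cov Q x y, cov T1 x y | cov T2 x y].
  by rewrite !cov_setU orbA.
have tQ' : triples (Q :|: T1 :|: T2).
  apply: triplesU; last exact: apex_triples d21 I2 b2F.
  by apply: triplesU => //; apply: apex_triples d12 I1 b1F.
have lQ' : linsys (Q :|: T1 :|: T2).
  apply: linsysU; last 2 first.
  - exact: apex_linsys d21 I2 b2F b2d b2u.
  - by move=> x y xy; rewrite cov_setU => /orP[]; [apply: dis2|apply: dis3].
  by apply: linsysU => //; apply: apex_linsys d12 I1 b1F b1d b1u.
have sQ' e : e \in Q :|: T1 :|: T2 -> e \subset U1 :|: U2.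
  by rewrite 2!in_setU -orbA => /or3P[/QU //|/sub1 //|/sub2]; rewrite setUC.
have in1 x y : x \in U1 -> y \in U1 -> x != y -> cov (Q :|: T1 :|: T2) x y.
  by move=> xU yU xy; rewrite cQ' c1in // inside_pair //; case: (cov Q x y).
have in2 x y : x \in U2 -> y \in U2 -> x != y -> cov (Q :|: T1 :|: T2) x y.
  by move=> xU yU xy; rewrite cQ' c2in // inside_pair //; case: (cov Q x y); rewrite ?orbT.
have reg : bireg U1 U2 (fun u x => ~~ cov (Q :|: T1 :|: T2) u x) #|W|.
  split=> [u uU|x xU].
    have := deg1 uU; rewrite -(card_apex_at b1F b1d b1u b1c).
    rewrite -(b2q u uU) -(card_apex_used I2 b2F b2d uU).
    rewrite (@cardsD3 [set x in U2 | ~~ cov Q u x] [set x in U2 | u \in \bigcup_(e in b1 x) e] (\bigcup_(e in b2 u) e)).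
    + move=> /eqP; rewrite eqn_add2r eqn_add2r => /eqP <-.
      apply: eq_card => x; rewrite !inE cQ' !negb_or.
      case xU: (x \in U2) => /=; last by rewrite !andbF.
      by rewrite c1x // [cov T2 _ _]cov_sym c2x //; case: (cov Q u x); case: (u \in _); case: (x \in _).
    + by apply/subsetP => x /setIdP[xU fb]; rewrite inE xU (forb_unc u x).
    + apply/subsetP => x xb; have xU : x \in U2.
        by move: xb => /bigcupP[e eb xe]; have [_ s] := I2 e (subsetP (b2F u uU) e eb); apply: (subsetP s).
      have /andP[h1 h2] := b2_unc x u uU xb.
      by rewrite !inE xU /= [cov Q u x]cov_sym h1 andbT.
  have := deg2 xU; rewrite -(card_apex_at b2F b2d b2u b2c).
  rewrite -(b1q x xU) -(card_apex_used I1 b1F b1d xU) addnAC.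
  rewrite (@cardsD3 [set u in U1 | ~~ cov Q u x] (\bigcup_(e in b1 x) e) [set u in U1 | x \in \bigcup_(e in b2 u) e]).
  + move=> /eqP; rewrite eqn_add2r eqn_add2r => /eqP <-.
    apply: eq_card => u; rewrite !inE cQ' !negb_or.
    case uU: (u \in U1) => /=; last by rewrite !andbF.
    by rewrite c1x // [cov T2 _ _]cov_sym c2x //; case: (cov Q u x); case: (u \in _); case: (x \in _).
  + apply/subsetP => u ub; have uU : u \in U1.
      by move: ub => /bigcupP[e eb ue]; have [_ s] := I1 e (subsetP (b1F x xU) e eb); apply: (subsetP s).
    by rewrite inE uU (forb_unc u x).
  + apply/subsetP => u /setIdP[uU xb]; have /andP[h1 h2] := b2_unc x u uU xb.
    by rewrite !inE uU /= [cov Q u x]cov_sym h1 andbT.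
have [S [SS sS]] := completion d12 eW cW tQ' lQ' sQ' in1 in2 reg.
exists S; split=> //; apply: subset_trans sS; by rewrite -setUA subsetUl.
Qed.

End TwoSides.
End Apex.

(** * Counting covered and uncovered pairs *)

Section InsideCounts.
Variable V : finType.
Variables (Q : {set {set V}}) (U : {set V}).
Notation X := (fun u x => ~~ cov Q u x).
Definition inbr (N : {set V}) u := #|[set v in N | (v != u) && ~~ cov Q u v]|.

Lemma inbrE (N : {set V}) u : N \subset U -> u \in N ->
  inbr N u = #|[set e in inside Q U | (e \subset N) && (u \in e)]|.
Proof.
move=> NU uN; have inj : {in [set v in N | (v != u) && ~~ cov Q u v] &, injective (fun v => [set u; v])}.
  move=> v v' /setIdP[_ /andP[vu _]] _ /setP/(_ v); rewrite !inE eqxx orbT (negbTE vu) /=.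
  by move/esym/eqP.
rewrite /inbr -(card_in_imset inj); apply: eq_card => e; apply/imsetP/setIdP.
  move=> [v /setIdP[vN /andP[vu nc]] ->]; split.
    by rewrite inside_pair ?(subsetP NU) // eq_sym.
  by rewrite subUset !sub1set uN vN !inE eqxx.
move=> [eI /andP[eN ue]]; have [c2 eU] := insideP eI.
have /card_gt0P[v] : 0 < #|e :\ u| by move: (cardsD1 u e); rewrite ue c2; case: #|_|.
rewrite !inE => /andP[vu ve]; have uv : u != v by rewrite eq_sym.
have ee := pair_eq c2 ue ve uv; exists v => //; rewrite inE (subsetP eN) //= vu /=.
by move: eI; rewrite ee inside_pair ?(subsetP NU) // (subsetP eN).
Qed.

Lemma inbr_sum (N : {set V}) : N \subset U ->
  \sum_(u in N) inbr N u = 2 * #|[set e in inside Q U | e \subset N]|.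
Proof.
move=> NU; rewrite mulnC -sum_nat_const (eq_bigr (fun u => #|[set e in inside Q U | (e \subset N) && (u \in e)]|)); last first.
  by move=> u uN; apply: inbrE.
under eq_bigr => u _ do rewrite -sum1_card big_mkcond /=.
rewrite exchange_big [RHS]big_mkcond /=; apply: eq_bigr => e _; rewrite inE.
have [/andP[eI eN]|ne] := boolP (_ && _).
  rewrite -(insideP eI).1 -sum1_card -big_mkcondr /=; apply: eq_bigl => u.
  rewrite inE eI eN /=; case ue: (u \in e); rewrite ?andbF // andbT.
  exact: (subsetP eN).
rewrite big1 // => u _; rewrite inE andbA; case: ifP => // /andP[h _].
by rewrite h in ne.
Qed.

Lemma inside_all : [set e in inside Q U | e \subset U] = inside Q U.
Proof.
apply/setP=> e; apply/setIdP/idP => [[] //|eI]; split=> //; by have [] := insideP eI.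
Qed.

Lemma inside_at u : u \in U -> inbr U u = #|[set e in inside Q U | u \in e]|.
Proof.
move=> uU; rewrite inbrE //; apply: eq_card => e; apply/setIdP/setIdP => -[eI ue]; split=> //.
  by case/andP: ue.
by rewrite ue andbT; have [] := insideP eI.
Qed.

Lemma cov_count u : triples Q -> linsys Q ->
  #|[set v | (v != u) && cov Q u v]| = 2 * #|[set e in Q | u \in e]|.
Proof.
move=> tQ lQ; rewrite mulnC -sum_nat_const.
transitivity (\sum_(e in [set e in Q | u \in e]) #|e :\ u|); last first.
  by apply: eq_bigr => e /setIdP[eQ ue]; move: (cardsD1 u e); rewrite ue tQ // => -[].
under [RHS]eq_bigr => e _ do rewrite -sum1_card big_mkcond /=.
rewrite exchange_big -sum1_card big_mkcond /=; apply: eq_bigr => v _.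
rewrite inE; have [->|vu] := eqVneq v u.
  by rewrite big1 // => e _; rewrite !inE eqxx.
have [/existsP[e /and3P[eQ ue ve]]|nc] := boolP (cov Q u v).
  rewrite (bigD1 e) /= ?inE ?eQ // ?ue // vu ve big1 // => f /andP[/setIdP[fQ uf] fe].
  rewrite !inE vu; case vf: (v \in f) => //=; case/eqP: fe.
  by apply: (lQ f e u v) => //; rewrite eq_sym.
rewrite big1 // => e /setIdP[eQ ue]; rewrite !inE vu /=; case ve: (v \in e) => //.
by case/negP: nc; apply/existsP; exists e; rewrite eQ ue.
Qed.

End InsideCounts.

Section PairCounts.
Variables (V : finType) (Q : {set {set V}}).
Hypotheses (tQ : triples Q) (lQ : linsys Q).

Lemma card_offdiag (A : {set V}) :
  #|[set xy : V * V | [&& xy.1 \in A, xy.2 \in A & xy.1 != xy.2]]| = #|A| * #|A|.-1.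
Proof.
rewrite -sum_nat_const -sum1_card.
rewrite (eq_bigl (fun xy : V * V => (xy.1 \in A) && (xy.2 \in A :\ xy.1))); last first.
  by move=> xy; rewrite !inE eq_sym andbA andbAC -!andbA; case: (_ \in A); case: (_ \in A); rewrite ?andbF.
rewrite -(pair_big_dep (fun x => x \in A) (fun x y => y \in A :\ x) (fun _ _ => 1)) /=.
apply: eq_bigr => x xA; rewrite sum1_card; move: (cardsD1 x A); rewrite xA => ->.
by rewrite add1n.
Qed.

Lemma card_cov_pairs (P : {set V * V}) : (forall xy, xy \in P -> xy.1 != xy.2) ->
  #|[set xy in P | cov Q xy.1 xy.2]| =
  \sum_(e in Q) #|[set xy in P | (xy.1 \in e) && (xy.2 \in e)]|.
Proof.
move=> hP; under [RHS]eq_bigr => e _ do rewrite -sum1_card big_mkcond /=.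
rewrite exchange_big -sum1_card big_mkcond /=; apply: eq_bigr => -[x y] _ /=.
rewrite inE /=; have [xyP|xyP] := boolP ((x, y) \in P); last first.
  by rewrite big1 // => e _; rewrite inE (negbTE xyP).
have xy := hP _ xyP; rewrite /= in xy.
have [/existsP[e /and3P[eQ ue ve]]|nc] /= := boolP (cov Q x y).
  rewrite (bigD1 e) //= inE xyP /= ue ve big1 // => f /andP[fQ fe].
  rewrite inE xyP /=; case: andP => // -[xf yf]; case/eqP: fe.
  exact: (lQ fQ eQ xy xf yf).
rewrite big1 // => e eQ; rewrite inE xyP /=; case: andP => // -[xe ye].
by case/negP: nc; apply/existsP; exists e; rewrite eQ xe.
Qed.

Variables (U1 U2 : {set V}).
Hypothesis d12 : [disjoint U1 & U2].
Hypothesis QU : forall e, e \in Q -> e \subset U1 :|: U2.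

Definition same : rel V := fun x y => (x \in U1) && (y \in U1) || (x \in U2) && (y \in U2).
Definition ingraph : rel V := fun x y => [&& x != y, same x y & ~~ cov Q x y].

Lemma same_sym : symmetric same.
Proof. by move=> x y; rewrite /same [in LHS]andbC [X in _ || X]andbC. Qed.

Lemma ingraph_sym : symmetric ingraph.
Proof. by move=> x y; rewrite /ingraph eq_sym same_sym cov_sym. Qed.

Lemma ingraph_irr : irreflexive ingraph.
Proof. by move=> x; rewrite /ingraph eqxx. Qed.

Lemma notin2 x : x \in U1 -> (x \in U2) = false.
Proof. by move=> h; apply: (disjointFr d12 h). Qed.

Lemma same1 x y : x \in U1 -> same x y = (y \in U1).
Proof. by move=> h; rewrite /same h notin2 //= orbF. Qed.

Lemma same2 x y : x \in U2 -> same x y = (y \in U2).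
Proof. by move=> h; rewrite /same h (disjointFl d12 h). Qed.

Lemma card_same_block (e : {set V}) :
  #|[set xy : V * V | [&& xy.1 \in e, xy.2 \in e & xy.1 != xy.2] && same xy.1 xy.2]| =
  #|e :&: U1| * #|e :&: U1|.-1 + #|e :&: U2| * #|e :&: U2|.-1.
Proof.
rewrite -2!card_offdiag -(cardsID [set xy : V * V | xy.1 \in U1]); congr addn.
  apply: eq_card => -[x y]; rewrite !inE /=; case xU: (x \in U1); rewrite ?andbF //=.
  by rewrite same1 //; do !case: (_ \in _); rewrite ?andbF ?andbT.
apply: eq_card => -[x y]; rewrite !inE /=; case xU: (x \in U1) => /=.
  by rewrite notin2 // andbF.
rewrite /same xU /=; by do !case: (_ \in _); rewrite ?andbF ?andbT.
Qed.

Lemma card_cross_block (e : {set V}) :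
  #|[set xy in setX U1 U2 | (xy.1 \in e) && (xy.2 \in e)]| = #|e :&: U1| * #|e :&: U2|.
Proof.
rewrite -cardsX; apply: eq_card => -[x y]; rewrite !inE /=.
by rewrite andbACA [X in X && _]andbC [X in _ && X]andbC.
Qed.

(* A triple meeting both sides covers two cross pairs and two ordered inside
   pairs, a triple within a side six ordered inside pairs: this gives the
   divisibility by 6 needed to stop the second phase at an exact number of pairs. *)
Lemma inside_cross_identity m : #|U1| = m -> #|U2| = m -> exists P,
  m * m + ecount ingraph + 6 * P = 2 * (m * m.-1) + \sum_(u in U1) #|[set x in U2 | ~~ cov Q u x]|.
Proof.
move=> c1 c2.
pose off := [set xy : V * V | (xy.1 != xy.2) && same xy.1 xy.2].
have hoff xy : xy \in off -> xy.1 != xy.2 by rewrite inE => /andP[].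
have coff : #|off| = 2 * (m * m.-1).
  have := card_same_block [set: V]; rewrite !setTI c1 c2 mul2n -addnn => <-.
  by apply: eq_card => xy; rewrite !inE.
have hX xy : xy \in setX U1 U2 -> xy.1 != xy.2.
  by rewrite inE => /andP[x1 x2]; apply: contraTneq x2 => <-; rewrite notin2.
have e1 : #|off| = ecount ingraph + \sum_(e in Q) #|[set xy in off | (xy.1 \in e) && (xy.2 \in e)]|.
  rewrite -card_cov_pairs // addnC -(cardsID [set xy | cov Q xy.1 xy.2] off); congr addn.
    by apply: eq_card => xy; rewrite !inE.
  by apply: eq_card => -[x y]; rewrite !inE /ingraph /=; case: (x == y); case: (cov Q x y); case: (same x y).
have e2 : m * m = \sum_(u in U1) #|[set x in U2 | ~~ cov Q u x]| +
    \sum_(e in Q) #|[set xy in setX U1 U2 | (xy.1 \in e) && (xy.2 \in e)]|.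
  rewrite -{1}c1 -c2 -cardsX -card_cov_pairs // addnC -(cardsID [set xy | cov Q xy.1 xy.2] (setX U1 U2)).
  congr addn; first by apply: eq_card => xy; rewrite !inE.
  under eq_bigr => u _ do rewrite -sum1_card.
  rewrite pair_big_dep /= sum1_card; apply: eq_card => xy; rewrite !inE /=.
  rewrite [in RHS]unfold_in inE; case: (xy.2 \in U2); case: (cov Q _ _); rewrite ?andbF ?andbT //.
pose P := \sum_(e in Q) ((#|e :&: U1| == 3) || (#|e :&: U2| == 3) : nat).
exists P; rewrite -coff e1 {1}e2.
suff -> : \sum_(e in Q) #|[set xy in off | (xy.1 \in e) && (xy.2 \in e)]| =
    \sum_(e in Q) #|[set xy in setX U1 U2 | (xy.1 \in e) && (xy.2 \in e)]| + 6 * P.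
  move: (ecount _) (\sum_(e in Q) _) (\sum_(u in U1) _) P; lia.
rewrite /P big_distrr -big_split /=; apply: eq_bigr => e eQ.
rewrite card_cross_block.
have -> : #|[set xy in off | (xy.1 \in e) && (xy.2 \in e)]| =
    #|e :&: U1| * #|e :&: U1|.-1 + #|e :&: U2| * #|e :&: U2|.-1.
  rewrite -card_same_block; apply: eq_card => xy; rewrite !inE.
  by do !case: (_ \in _); rewrite ?andbF ?andbT.
have : #|e :&: U1| + #|e :&: U2| = 3.
  rewrite -(tQ eQ) -(cardsID U1 e); congr addn; apply: eq_card => x; rewrite !inE.
  have [xe|xe] := boolP (x \in e); rewrite ?andbF //= andbT.
  have := subsetP (QU eQ) x xe; rewrite in_setU; case xU: (x \in U1) => //= _.
  by rewrite notin2.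
move: #|e :&: U1| #|e :&: U2|.
by case=> [|[|[|[|a]]]] [|[|[|[|b]]]] // _.
Qed.

End PairCounts.

(** * Tripartite holes *)

Section Holes.
Variable n : nat.
Implicit Types (X : {ffun 'I_3 -> {set 'I_n}}) (T : {set 'I_n}).

Definition noncrossing X : {set {set 'I_n}} :=
  [set T : {set 'I_n} | (#|T| == 3) && [exists i, [disjoint T & X i]]].

Definition disjoint_parts a X :=
  [forall i, #|X i| == a] && [forall i, forall j, (i != j) ==> [disjoint X i & X j]].

Lemma noncrossing_card a X : disjoint_parts a X -> #|noncrossing X| + a ^ 3 <= 'C(n, 3).
Proof.
move=> /andP[/forallP ca /forallP dX].
have dj i j x : i != j -> x \in X i -> x \in X j -> False.
  by move=> ij xi xj; have /implyP/(_ ij)/disjointFr/(_ xi) := forallP (dX i) j; rewrite xj.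
pose i0 : 'I_3 := ord0; pose i1 : 'I_3 := Ordinal (isT : 1 < 3); pose i2 : 'I_3 := ord_max.
have i01 : i0 != i1 by [].
have i02 : i0 != i2 by [].
have i12 : i1 != i2 by [].
have iE i : [|| i == i0, i == i1 | i == i2] by case: i => -[|[|[|]]].
pose f (t : 'I_n * 'I_n * 'I_n) : {set 'I_n} := [set t.1.1; t.1.2; t.2].
pose D := setX (setX (X i0) (X i1)) (X i2).
have cD : #|D| = a ^ 3 by rewrite !cardsX !(eqP (ca _)) !expnS expn0 muln1 mulnA.
have ne x y i j : i != j -> x \in X i -> y \in X j -> x != y.
  by move=> ij xi yj; apply/eqP => e; subst y; apply: (dj i j x).
have inj : {in D &, injective f}.
  move=> [[x y] z] [[x' y'] z'] /=; rewrite !in_setX /= => /andP[/andP[x0 y1] z2] /andP[/andP[x0' y1'] z2'] e.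
  have ex : x \in f (x', y', z') by rewrite -e !inE eqxx.
  have ey : y \in f (x', y', z') by rewrite -e !inE eqxx orbT.
  have ez : z \in f (x', y', z') by rewrite -e !inE eqxx orbT.
  move: ex ey ez; rewrite !inE /=.
  rewrite (negbTE (ne x y' _ _ i01 x0 y1')) (negbTE (ne x z' _ _ i02 x0 z2')) !orbF => /eqP->.
  rewrite [y == x']eq_sym (negbTE (ne x' y _ _ i01 x0' y1)) (negbTE (ne y z' _ _ i12 y1 z2')) !orbF /= => /eqP->.
  by rewrite [z == x']eq_sym (negbTE (ne x' z _ _ i02 x0' z2)) [z == y']eq_sym (negbTE (ne y' z _ _ i12 y1' z2)) /= => /eqP->.
have <- : #|[set T : {set 'I_n} | #|T| == 3]| = 'C(n, 3) by rewrite card_draws card_ord.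
rewrite -cD -(card_in_imset inj).
have dis : noncrossing X :&: f @: D = set0.
  apply/setP=> T; rewrite in_setI in_set0; apply/negbTE/negP => /andP[].
  rewrite inE => /andP[_ /existsP[i di]] /imsetP[[[x y] z]]; rewrite !in_setX /= => /andP[/andP[x0 y1] z2] eT.
  have h t j : t \in T -> t \in X j -> i == j -> False.
    by move=> tT tX /eqP ij; move: (disjointFr di tT); rewrite ij tX.
  by case/or3P: (iE i) => hi; [apply: (h x _ _ x0 hi)|apply: (h y _ _ y1 hi)|apply: (h z _ _ z2 hi)];
    rewrite eT !inE eqxx ?orbT.
have := cardsUI (noncrossing X) (f @: D); rewrite dis cards0 addn0 => <-.
apply: subset_leq_card; rewrite subUset; apply/andP; split.
  by apply/subsetP=> T; rewrite !inE => /andP[].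
apply/subsetP=> T /imsetP[[[x y] z]]; rewrite !in_setX /= => /andP[/andP[x0 y1] z2] ->.
by rewrite inE cards3 // ?(ne _ _ _ _ i01 x0 y1) ?(ne _ _ _ _ i02 x0 z2) ?(ne _ _ _ _ i12 y1 z2).
Qed.

Lemma hole_noncrossing (S : {set {set 'I_n}}) a : steiner_triple_system S -> tripartite_hole S a ->
  exists X, disjoint_parts a X /\ S \subset noncrossing X.
Proof.
move=> /andP[/forall_inP uS _] /existsP[X /and3P[h1 h2 /forall_inP h3]]; exists X.
split; first by rewrite /disjoint_parts h1.
by apply/subsetP=> T TS; rewrite inE uS // h3.
Qed.

Lemma alpha3_star_gt (S : {set {set 'I_n}}) k :
  k < alpha3_star S -> exists a, k < a /\ tripartite_hole S a.
Proof.
rewrite ltnNge => /bigmax_leqP h.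
have [/existsP[a /andP[ka ha]]|nh] := boolP [exists a : 'I_(#|'I_n|.+1), (k < a) && tripartite_hole S a].
  by exists a.
case: h => a ha; rewrite leqNgt; apply: contra nh => ka; apply/existsP; exists a.
by rewrite ka.
Qed.

Local Open Scope ring_scope.

(** The size [a] varies with the system but is determined by [X]. The sum therefore runs over the
    [8 ^ n] families [X] only, with no further factor for the choice of [a]. *)
Lemma union_bound (R : realType) (P : pred nat) (Sb : {set {set {set 'I_n}}}) (b : R) :
  (forall S, S \in Sb -> steiner_triple_system S /\ exists a, P a /\ tripartite_hole S a) ->
  (forall X a, P a -> disjoint_parts a X ->
     #|[set S in Sb | S \subset noncrossing X]|%:R * 8 ^+ n <= b) -> 0 <= b -> #|Sb|%:R <= b.
Proof.
move=> hS hX b0.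
pose BX X := [set S in Sb | S \subset noncrossing X & [exists a : 'I_n.+1, P a && disjoint_parts a X]].
have BXb X : #|BX X|%:R * 8 ^+ n <= b.
  have [/existsP[a /andP[Pa da]]|nex] := boolP [exists a : 'I_n.+1, P a && disjoint_parts a X].
    apply: le_trans (hX X a Pa da); rewrite ler_pM2r ?exprn_gt0 // ler_nat.
    by apply: subset_leq_card; apply/subsetP=> S; rewrite !inE => /and3P[-> -> _].
  rewrite (_ : BX X = set0) ?cards0 ?mul0r //.
  by apply/setP=> S; rewrite !inE (negbTE nex) !andbF.
have sub : Sb \subset \bigcup_(X : {ffun 'I_3 -> {set 'I_n}}) BX X.
  apply/subsetP=> S SSb; have [sS [a [Pa ha]]] := hS S SSb.
  have [X [dX SX]] := hole_noncrossing sS ha.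
  apply/bigcupP; exists X => //; rewrite inE SSb SX /=.
  have an : (a < n.+1)%N.
    have /andP[/forallP/(_ ord0)/eqP <- _] := dX.
    by rewrite ltnS -[X in (_ <= X)%N]card_ord; apply: max_card.
  by apply/existsP; exists (Ordinal an); rewrite /= Pa.
have c8 : #|{ffun 'I_3 -> {set 'I_n}}| = (8 ^ n)%N.
  rewrite card_ffun card_ord -cardsT -powersetT card_powerset cardsT card_ord.
  by rewrite -expnM mulnC expnM.
have le1 : (#|Sb| <= \sum_(X : {ffun 'I_3 -> {set 'I_n}}) #|BX X|)%N.
  by apply: leq_trans (subset_leq_card sub) _; apply: card_bigcup_le.
have e0 : 0 < (8 : R) ^+ n by rewrite exprn_gt0.
rewrite -(ler_pM2r e0); apply: (@le_trans _ _ (\sum_(X : {ffun 'I_3 -> {set 'I_n}}) (#|BX X|%:R * 8 ^+ n))).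
  by rewrite -mulr_suml ler_pM2r // -natr_sum ler_nat.
apply: (@le_trans _ _ (\sum_(X : {ffun 'I_3 -> {set 'I_n}}) b)); first by apply: ler_sum.
by rewrite sumr_const c8 -[X in X <= _]mulr_natr natrX.
Qed.

End Holes.

Local Open Scope ring_scope.

(** * Random triangle removal *)

Section RealIneq.
Variable R : realType.
Implicit Types x y p h : R.

Lemma expR_le_inv x : x < 1 -> expR x <= (1 - x)^-1.
Proof.
move=> x1; rewrite -[x in expR x]opprK expRN lef_pV2 ?posrE ?expR_gt0 ?subr_gt0 //.
by apply: le_trans (expR_ge1Dx _); rewrite lerD2l.
Qed.

Lemma expR_quad x : x <= 2^-1 -> expR x <= 1 + x + 2 * x ^+ 2.
Proof.
move=> hx; apply: le_trans (expR_le_inv _) _; first by lra.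
rewrite -div1r ler_pdivrMr; last by lra.
have := sqr_ge0 x; rewrite !expr2; nra.
Qed.

Lemma bernoulli (x : R) n : 0 <= x -> 1 + n%:R * x <= (1 + x) ^+ n.
Proof.
move=> x0; elim: n => [|n IH]; first by rewrite mul0r addr0.
rewrite exprS; apply: (@le_trans _ _ ((1 + x) * (1 + n%:R * x))); last first.
  by rewrite ler_pM2l //; lra.
rewrite -addn1 natrD; have : 0 <= n%:R * x * x by rewrite !mulr_ge0.
by lra.
Qed.

Lemma one_sub_exp_bounds (y : R) k : (0 < k <= 4)%N -> 0 <= y <= 1 ->
  k%:R * y * (1 - 4 * y) <= 1 - (1 - y) ^+ k <= k%:R * y.
Proof.
move=> hk /andP[y0 y1].
have y2 : 0 <= y * y by rewrite mulr_ge0.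
have y3 : 0 <= y * y * (1 - y) by rewrite !mulr_ge0 // subr_ge0.
have y4 : 0 <= y * y * y by rewrite !mulr_ge0.
have y6 : 0 <= y * y * y * y by rewrite !mulr_ge0.
have y5 : 0 <= y * y * y * (1 - y) by rewrite !mulr_ge0 // subr_ge0.
have : (k = 1 \/ k = 2 \/ k = 3 \/ k = 4)%N by lia.
move=> [->|[->|[->|->]]]; rewrite ?expr1 ?expr2 ?exprS ?expr0 /=; apply/andP; split; lra.
Qed.

Lemma inv_exp_growth p h j : 0 < p -> 0 <= h < p ->
  p^-1 ^+ j * (1 + j%:R * (h / p)) <= (p - h)^-1 ^+ j.
Proof.
move=> p0 /andP[h0 hp].
have q0 : 0 < p - h by rewrite subr_gt0.
have y0 : 0 <= h / p by rewrite divr_ge0 // ltW.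
apply: (@le_trans _ _ (p^-1 ^+ j * (1 + h / p) ^+ j)).
  by rewrite ler_wpM2l ?bernoulli // exprn_ge0 // invr_ge0 ltW.
have i0 : 0 <= p^-1 by rewrite invr_ge0 ltW.
rewrite -exprMn; apply: lerXn2r; rewrite ?nnegrE.
- by rewrite mulr_ge0 // addr_ge0.
- by rewrite invr_ge0 ltW.
rewrite -(div1r (p - h)) ler_pdivlMr //.
have -> : p^-1 * (1 + h / p) * (p - h) = 1 - (h / p) ^+ 2 by field; rewrite gt_eqF.
by have := sqr_ge0 (h / p); lra.
Qed.

(* The drift estimate behind the process: [y] is the relative decrease of the
   density in one step, [l] the average loss of a tracked quantity [Y]. *)
Lemma drift_ineq (sg rate gam P y s Y y0 dP dG l : R) k :
  (0 < k <= 4)%N -> sg = 1 \/ sg = -1 ->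
  0 < P -> 0 <= y <= 1 -> 0 < s -> 0 <= y0 <= 2 * s ->
  0 < gam <= 1 -> 0 <= rate <= gam / 4 -> 8 * y <= gam ->
  `|Y - P * y0| <= gam * P * s -> 0 <= Y ->
  (1 - 6 * gam) * (Y * (k%:R * y)) <= l <= (1 + 6 * gam) * (Y * (k%:R * y)) ->
  k%:R * y * (1 - 4 * y) * P <= dP <= k%:R * y * P ->
  gam * P * (196%:R * y) <= dG -> gam <= 100^-1 ->
  - sg * l + 6 * rate * l + sg * dP * y0 - dG * s <= 0.
Proof.
move=> hk hsg P0 /andP[y0' y1] s0 /andP[yy0 yy1] /andP[g0 g1] /andP[l0 l1] yg hY Y0 /andP[hl1 hl2] /andP[d1 d2] hG gs.
set a := k%:R * y in hl1 hl2 d1 d2.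
have a0 : 0 <= a by rewrite mulr_ge0.
have a4 : a <= 4 * y by rewrite ler_wpM2r // (ler_nat _ k 4); case/andP: hk.
have /andP[Y1 Y2] : P * y0 - gam * P * s <= Y <= P * y0 + gam * P * s.
  by move: hY; rewrite ler_distl.
have Ps : 0 < P * s by rewrite mulr_gt0.
have Py : P * y0 <= 2 * (P * s) by rewrite mulrCA ler_pM2l.
have Py0 : 0 <= P * y0 by rewrite mulr_ge0 // ltW.
have gPs : gam * (P * s) <= P * s by rewrite ger_pMl.
have Y3 : Y <= 3 * (P * s) by lra.
have aY : 0 <= a * Y by rewrite mulr_ge0.
have aY3 : a * Y <= 12 * y * (P * s).
  have e1 : a * Y <= a * (3 * (P * s)) by rewrite ler_wpM2l.
  have e2 : a * (3 * (P * s)) <= 4 * y * (3 * (P * s)) by rewrite ler_wpM2r // mulr_ge0 // ltW.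
  by lra.
have gaY : gam * (a * Y) <= gam * (12 * y * (P * s)) by rewrite ler_pM2l.
have yPs : 0 <= y * (P * s) by rewrite mulr_ge0 // ltW.
have gyPs : 0 <= gam * (y * (P * s)) by rewrite mulr_ge0 // ltW.
have l2' : l <= 24 * y * (P * s).
  have : gam * (a * Y) <= 1 / 100 * (a * Y) by rewrite ler_wpM2r //; lra.
  by lra.
have l3 : 0 <= l.
  have : gam * (a * Y) <= 1 / 100 * (a * Y) by rewrite ler_wpM2r //; lra.
  by lra.
have ll : 6 * rate * l <= 36 * (gam * (y * (P * s))).
  have e1 : rate * l <= rate * (24 * y * (P * s)) by rewrite ler_wpM2l.
  have e2 : rate * (24 * y * (P * s)) <= gam / 4 * (24 * y * (P * s)).
    by rewrite ler_wpM2r //; lra.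
  by lra.
have G1 : 196 * (gam * (y * (P * s))) <= dG * s.
  have : gam * P * (196%:R * y) * s <= dG * s by rewrite ler_wpM2r // ltW.
  by lra.
have aPs : a * (gam * (P * s)) <= 4 * y * (gam * (P * s)).
  by rewrite ler_wpM2r // mulr_ge0 // ltW.
case: hsg => ->.
  have h1 : dP * y0 <= a * P * y0 by rewrite ler_wpM2r.
  have h2 : a * (P * y0 - gam * P * s) <= a * Y by rewrite ler_wpM2l.
  by lra.
have h1 : a * (1 - 4 * y) * P * y0 <= dP * y0 by rewrite ler_wpM2r.
have h2 : a * Y <= a * (P * y0 + gam * P * s) by rewrite ler_wpM2l.
have h3 : a * y * (P * y0) <= 4 * y * (gam / 8) * (2 * (P * s)).
  have i1 : a * y <= 4 * y * (gam / 8) by apply: ler_pM => //; lra.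
  have i2 : 0 <= a * y by rewrite mulr_ge0.
  by apply: ler_pM.
by lra.
Qed.

(** There are about [e0 * p ^ 3 * D / 6] triples, and each element of the tracked set is removed by
    about [k * p ^ 2 * D] of them, whence the mean relative loss [k * 6 / (e0 * p)]. The 16 is the
    overcount [#|Z| ^ 2] of [hit_count_ge] for [#|Z| <= 4]. *)
Lemma avg_loss_ineq (T L e0 p D gam Y : R) k : (0 < k)%N ->
  0 < e0 -> 0 < p -> 0 < D -> 0 < gam <= 100^-1 -> 0 <= Y ->
  16 <= gam * (p ^+ 2 * D) ->
  `|6 * T - e0 * p ^+ 3 * D| <= 2 * gam * (e0 * p ^+ 3 * D) ->
  Y * (k%:R * (p ^+ 2 * D * (1 - 2 * gam)) - 16) <= L <=
     Y * (k%:R * (p ^+ 2 * D * (1 + 2 * gam))) ->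
  (1 - 6 * gam) * (Y * (k%:R * (6 / e0 / p))) <= L / T <=
  (1 + 6 * gam) * (Y * (k%:R * (6 / e0 / p))) /\ 0 < T.
Proof.
move=> hk e0' p0 D0 /andP[g0 g1] Y0 h16 hT /andP[L1 L2].
have E0 : 0 < e0 * p ^+ 3 * D by rewrite !mulr_gt0 ?exprn_gt0.
set E := e0 * p ^+ 3 * D in hT E0.
have gE : gam * E <= 100^-1 * E by rewrite ler_pM2r.
have gE0 : 0 < gam * E by rewrite mulr_gt0.
move: hT; rewrite ler_distl => /andP[T1 T2].
have T0 : 0 < T by lra.
split=> //; rewrite ler_pdivlMr // ler_pdivrMr //.
have k0 : 0 < k%:R :> R by rewrite ltr0n.
have k1 : 1 <= k%:R :> R by rewrite ler1n.
set W := p ^+ 2 * D in h16 L1 L2.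
have W0 : 0 < W by rewrite mulr_gt0 ?exprn_gt0.
have eqW : E * (6 / e0 / p) = 6 * W.
  by rewrite /E /W; field; rewrite !gt_eqF.
have ee : 0 < 6 / e0 / p by rewrite !divr_gt0.
have Yk : 0 <= Y * k%:R by rewrite mulr_ge0 // ltW.
have gW0 : 0 < gam * W by rewrite mulr_gt0.
have gW : gam * W <= 100^-1 * W by rewrite ler_pM2r.
have gg0 : 0 <= gam * (gam * W) by rewrite mulr_ge0 // ltW.
have gg : gam * (gam * W) <= 100^-1 * (gam * W) by rewrite ler_pM2r.
have Tup : T * (6 / e0 / p) <= W * (1 + 2 * gam).
  have : 6 * T * (6 / e0 / p) <= (E + 2 * gam * E) * (6 / e0 / p) by rewrite ler_pM2r.
  have -> : (E + 2 * gam * E) * (6 / e0 / p) = (1 + 2 * gam) * (E * (6 / e0 / p)) by ring.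
  by rewrite eqW; lra.
have Tlo : W * (1 - 2 * gam) <= T * (6 / e0 / p).
  have : (E - 2 * gam * E) * (6 / e0 / p) <= 6 * T * (6 / e0 / p) by rewrite ler_pM2r.
  have -> : (E - 2 * gam * E) * (6 / e0 / p) = (1 - 2 * gam) * (E * (6 / e0 / p)) by ring.
  by rewrite eqW; lra.
apply/andP; split.
  apply: le_trans L1.
  have -> : (1 - 6 * gam) * (Y * (k%:R * (6 / e0 / p))) * T
    = Y * k%:R * ((1 - 6 * gam) * (T * (6 / e0 / p))) by ring.
  have h1 : (1 - 6 * gam) * (T * (6 / e0 / p)) <= (1 - 6 * gam) * (W * (1 + 2 * gam)).
    by rewrite ler_pM2l //; lra.
  have h2 : (1 - 6 * gam) * (W * (1 + 2 * gam)) <= W * (1 - 2 * gam) - 16 by lra.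
  have : Y * k%:R * ((1 - 6 * gam) * (T * (6 / e0 / p))) <= Y * k%:R * (W * (1 - 2 * gam) - 16).
    by rewrite ler_wpM2l //; lra.
  have : Y <= Y * k%:R by rewrite ler_peMr.
  by lra.
apply: le_trans L2 _.
have -> : (1 + 6 * gam) * (Y * (k%:R * (6 / e0 / p))) * T
    = Y * k%:R * ((1 + 6 * gam) * (T * (6 / e0 / p))) by ring.
have h1 : (1 + 6 * gam) * (W * (1 - 2 * gam)) <= (1 + 6 * gam) * (T * (6 / e0 / p)).
  by rewrite ler_pM2l //; lra.
by rewrite mulrA ler_wpM2l //; lra.
Qed.

End RealIneq.

(** * The process and its exponential potential *)

Section Process.
Variables (R : realType) (V : finType) (G0 : rel V).
Hypotheses (sG : symmetric G0) (iG : irreflexive G0).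
Variables (F : {set {set V} * {set V}}) (s : {set V} * {set V} -> R) (D g0 : R).

Notation idx := ({set V} * {set V})%type.
Variable K : nat.
Hypothesis K200 : (200 <= K)%N.
(** A triple uses six ordered pairs, so [dens i] is exactly the proportion of ordered pairs of [G0]
    left after [i] steps. *)
Definition stepsz : R := 6 / (ecount G0)%:R.
Definition dens (i : nat) : R := 1 - i%:R * stepsz.
(* The allowed relative error [tol] grows like [p ^- K] as the density [p] drops:
   this growth absorbs both the drift and the second-order terms, so that the
   exponential potential [Phi] is a supermartingale while [Phi < 1]. *)
Definition tol (p : R) : R := g0 * p^-1 ^+ K.
Definition tracked_count (Q : {set {set V}}) (i : idx) : R := #|cnbr (unc G0 Q) i.1 i.2|%:R.
(** Negative for both signs [sg] as long as the count is strictly within its tolerance around the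
    value expected in a random graph of density [dens i]. *)
Definition deviation (sg : R) i Q (j : idx) : R :=
  sg * (tracked_count Q j - dens i ^+ #|j.1| * tracked_count set0 j) - tol (dens i) * dens i ^+ #|j.1| * s j.
Definition rate : R := g0 / 4.
Definition Phi i Q : R :=
  \sum_(j in F) (expR (rate * deviation 1 i Q j) + expR (rate * deviation (-1) i Q j)).
Definition legal i Q := (ecount (unc G0 Q) + 6 * i == ecount G0)%N.

Hypothesis g0_gt0 : 0 < g0.
Hypothesis D_gt0 : 0 < D.
Hypothesis F_ok : forall j, j \in F ->
  [/\ (0 < #|j.1| <= 4)%N, 0 < s j & tracked_count set0 j <= 2 * s j].
Hypothesis F_edge : forall x y, G0 x y ->
  [/\ ([set x; y], [set: V]) \in F, s ([set x; y], [set: V]) = D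
    & `|tracked_count set0 ([set x; y], [set: V]) - D| <= g0 * D].

Lemma Phi_ge0 i Q : 0 <= Phi i Q.
Proof. by apply: sumr_ge0 => j _; rewrite addr_ge0 ?expR_ge0. Qed.

(** All summands of [Phi] are nonnegative, so each is less than 1 and each exponent is negative. *)
Lemma tracked_count_dev i Q j : Phi i Q < 1 -> j \in F ->
  `|tracked_count Q j - dens i ^+ #|j.1| * tracked_count set0 j| <= tol (dens i) * dens i ^+ #|j.1| * s j.
Proof.
move=> hPhi jF.
have h1 : expR (rate * deviation 1 i Q j) + expR (rate * deviation (-1) i Q j) < 1.
  apply: le_lt_trans hPhi; rewrite /Phi (bigD1 j) //= lerDl.
  by apply: sumr_ge0 => l _; rewrite addr_ge0 ?expR_ge0.
have lam0 : 0 < rate by rewrite divr_gt0.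
have h2 : deviation 1 i Q j < 0.
  have : expR (rate * deviation 1 i Q j) < 1 by apply: le_lt_trans h1; rewrite lerDl expR_ge0.
  by rewrite expR_lt1 pmulr_rlt0.
have h3 : deviation (-1) i Q j < 0.
  have : expR (rate * deviation (-1) i Q j) < 1 by apply: le_lt_trans h1; rewrite lerDr expR_ge0.
  by rewrite expR_lt1 pmulr_rlt0.
by move: h2 h3; rewrite /deviation ler_norml => h2 h3; lra.
Qed.

Section Step.
Variables (i : nat) (Q : {set {set V}}).
Notation p := (dens i).
Notation h := stepsz.
Hypothesis Phi1 : Phi i Q < 1.
Hypothesis leg : legal i Q.
Hypothesis p_gt0 : 0 < p.
Hypothesis hp : h < p.
Hypothesis E_gt0 : (0 < ecount G0)%N.
Hypothesis h_small : 8 * (h / p) <= tol p.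
Hypothesis tol_small : tol p <= 100^-1.
Hypothesis D_big : 16 <= tol p * (p ^+ 2 * D).
Notation gam := (tol p).

Lemma gam_gt0 : 0 < gam.
Proof. by rewrite mulr_gt0 // exprn_gt0 // invr_gt0. Qed.

Lemma h_gt0 : 0 < h.
Proof. by rewrite divr_gt0 // ltr0n. Qed.

Lemma p_le1 : p <= 1.
Proof. by rewrite lerBlDr lerDl mulr_ge0 // ltW // h_gt0. Qed.

Lemma g0_le_gam : g0 <= gam.
Proof.
apply: ler_peMr; first exact: ltW.
by apply: exprn_ege1; rewrite invf_ge1 // p_le1.
Qed.

Lemma sU : symmetric (unc G0 Q). Proof. exact: unc_sym. Qed.
Lemma iU : irreflexive (unc G0 Q). Proof. exact: unc_irr. Qed.

(** One [gam] is the tracked deviation; the other pays for the initial codegree, which differs from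
    [D] by a factor up to [g0 <= gam]. *)
Lemma codeg_dev x y : unc G0 Q x y ->
  `|(codeg (unc G0 Q) x y)%:R - p ^+ 2 * D| <= 2 * gam * (p ^+ 2 * D).
Proof.
move=> /[dup] gxy /andP[g _]; have [jF sD dD] := F_edge g.
have := tracked_count_dev Phi1 jF; rewrite sD /tracked_count /= cards2 (G_neq iG g).
rewrite -/(codeg _ _ _).
move: (codeg _ _ _)%:R dD; rewrite /tracked_count /=; move: (#|cnbr _ _ _|%:R) => Y0 Y dD h1.
have h2 : p ^+ 2 * `|Y0 - D| <= p ^+ 2 * (gam * D).
  rewrite ler_pM2l ?exprn_gt0 // (le_trans dD) //.
  by apply: ler_wpM2r; [exact: ltW|exact: g0_le_gam].
have -> : Y - p ^+ 2 * D = (Y - p ^+ 2 * Y0) + p ^+ 2 * (Y0 - D) by ring.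
apply: le_trans (ler_normD _ _) _.
have p2 : 0 <= p ^+ 2 by apply: sqr_ge0.
rewrite normrM [`|p ^+ 2|]ger0_norm //; lra.
Qed.

Lemma ecountE : (ecount (unc G0 Q))%:R = (ecount G0)%:R * p.
Proof.
rewrite /dens /stepsz -(eqP leg) natrD natrM; field.
by rewrite -natrM -natrD (eqP leg) pnatr_eq0 -lt0n.
Qed.

Lemma tri_dev : `|6 * #|tri (unc G0 Q)|%:R - (ecount G0)%:R * p ^+ 3 * D|
  <= 2 * gam * ((ecount G0)%:R * p ^+ 3 * D).
Proof.
rewrite -(natrM _ 6) tri_count; [|exact: sU|exact: iU].
have -> : (ecount G0)%:R * p ^+ 3 * D = \sum_(xy : V * V | unc G0 Q xy.1 xy.2) (p ^+ 2 * D).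
  rewrite sumr_const.
  have -> : (#|[pred xy : V * V | unc G0 Q xy.1 xy.2]| = ecount (unc G0 Q))%N.
    by apply: eq_card => xy; rewrite !inE.
  by rewrite -[RHS]mulr_natr ecountE; ring.
rewrite natr_sum -sumrB mulr_sumr; apply: le_trans (ler_norm_sum _ _ _) _.
by apply: ler_sum => -[x y] /= gxy; apply: codeg_dev.
Qed.

Lemma loss_bounds (j : idx) (L : R) : j \in F ->
  L = \sum_(e in tri (unc G0 Q)) (\sum_(x in cnbr (unc G0 Q) j.1 j.2) hit j.1 x e)%:R ->
  tracked_count Q j * (#|j.1|%:R * (p ^+ 2 * D * (1 - 2 * gam)) - 16) <= L <=
     tracked_count Q j * (#|j.1|%:R * (p ^+ 2 * D * (1 + 2 * gam))).
Proof.
move=> jF eqL; have [/andP[_ k4] _ _] := F_ok jF.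
have LE : L = \sum_(x in cnbr (unc G0 Q) j.1 j.2)
     #|[set e in tri (unc G0 Q) | hit j.1 x e]|%:R.
  rewrite eqL -!natr_sum exchange_big /=; congr _%:R; apply: eq_bigr => x _.
  by rewrite -sum1_card -big_mkcondr; apply: eq_bigl => e; rewrite [RHS]inE.
have mem x : x \in cnbr (unc G0 Q) j.1 j.2 -> x \in cnbr (unc G0 Q) j.1 [set: V].
  by rewrite !inE => /andP[_ ->].
have cd x : x \in cnbr (unc G0 Q) j.1 j.2 ->
   #|j.1|%:R * (p ^+ 2 * D * (1 - 2 * gam)) <= ((\sum_(z in j.1) codeg (unc G0 Q) z x)%:R : R)
   <= #|j.1|%:R * (p ^+ 2 * D * (1 + 2 * gam)).
  move=> hx; rewrite natr_sum.
  have b z : z \in j.1 -> p ^+ 2 * D * (1 - 2 * gam) <= ((codeg (unc G0 Q) z x)%:R : R)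
       <= p ^+ 2 * D * (1 + 2 * gam).
    move=> zZ; have gz : unc G0 Q z x by move: hx; rewrite inE => /andP[_ /forall_inP]; apply.
    by have := codeg_dev gz; rewrite ler_distl; lra.
  have cE (c : R) : #|j.1|%:R * c = \sum_(z in j.1) c by rewrite sumr_const mulr_natl.
  rewrite !cE; apply/andP; split; apply: ler_sum => z zZ.
    by case/andP: (b z zZ).
  by case/andP: (b z zZ).
have tE c : tracked_count Q j * c = \sum_(x in cnbr (unc G0 Q) j.1 j.2) c.
  by rewrite sumr_const mulr_natl.
rewrite LE !tE; apply/andP; split; apply: ler_sum => x hx; have /andP[c1 c2] := cd x hx.
  have := hit_count_ge sU iU (mem x hx); rewrite -(ler_nat R) natrD => hh.
  have : (#|j.1| * #|j.1|)%:R <= 16 :> R by rewrite (ler_nat R _ 16); apply: (leq_mul k4 k4).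
  by lra.
have := hit_count_le sU iU (mem x hx); rewrite -(ler_nat R) => hh; lra.
Qed.

Lemma tri_gt0 : 0 < #|tri (unc G0 Q)|%:R :> R.
Proof.
have E0 : 0 < (ecount G0)%:R * p ^+ 3 * D by rewrite !mulr_gt0 ?exprn_gt0 // ltr0n.
have := tri_dev; rewrite ler_distl.
have : 2 * gam * ((ecount G0)%:R * p ^+ 3 * D) <= 2 * 100^-1 * ((ecount G0)%:R * p ^+ 3 * D).
  by rewrite ler_pM2r // ler_pM2l.
by lra.
Qed.

(** A step changes a count by at most 3, so the quadratic term [2 * (rate * Le) ^ 2] of the
    exponential is at most [6 * rate ^ 2 * Le], which is linear in the loss. After averaging,
    everything is expressed by the mean loss, and the growth of the tolerance makes the total
    exponent nonpositive. *)
Lemma step1 (j : idx) (sg : R) : j \in F -> sg = 1 \/ sg = -1 -> rate <= 12^-1 ->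
  \sum_(e in tri (unc G0 Q)) expR (rate * deviation sg i.+1 (e |: Q) j)
  <= #|tri (unc G0 Q)|%:R * expR (rate * deviation sg i Q j).
Proof.
move=> jF hsg lam12; have [k4 s0 Y0s] := F_ok jF.
set T := #|_|%:R; set k := #|j.1|.
pose Le e : R := (\sum_(x in cnbr (unc G0 Q) j.1 j.2) hit j.1 x e)%:R.
have lam0 : 0 < rate by rewrite divr_gt0.
have p'E : dens i.+1 = p - h by rewrite /dens -natr1; ring.
pose dG := tol (dens i.+1) * dens i.+1 ^+ k - tol p * p ^+ k.
pose dP := p ^+ k - dens i.+1 ^+ k.
have devE e : e \in tri (unc G0 Q) ->
   deviation sg i.+1 (e |: Q) j = deviation sg i Q j + (sg * dP * tracked_count set0 j - dG * s j) - sg * Le e.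
  move=> et; rewrite /deviation -/k.
  have -> : tracked_count (e |: Q) j = tracked_count Q j - Le e.
    apply/eqP; rewrite eq_sym subr_eq -natrD eq_sym; apply/eqP; congr _%:R.
    exact: card_cnbr_unc.
  by rewrite /dP /dG; ring.
set c := sg * dP * tracked_count set0 j - dG * s j in devE.
have Le0 e : 0 <= Le e by [].
have Le3 e : e \in tri (unc G0 Q) -> Le e <= 3.
  by move=> /triP[c3 _]; rewrite (ler_nat R _ 3); apply: hit_le3.
have eE e : e \in tri (unc G0 Q) -> expR (- (rate * sg * Le e)) <=
   1 - rate * sg * Le e + 6 * rate ^+ 2 * Le e.
  move=> et; have l3 := Le3 e et; have l0 := Le0 e.
  have q : rate * Le e <= 12^-1 * 3 by apply: ler_pM => //; apply: ltW.
  have q2 : 0 <= rate * Le e by rewrite mulr_ge0 // ltW.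
  have q3 : rate * Le e * Le e * rate <= rate * Le e * 3 * rate.
    by rewrite ler_pM2r // ler_wpM2l.
  have : - (rate * sg * Le e) <= 2^-1 by case: hsg => ->; lra.
  move/expR_quad/le_trans; apply.
  by rewrite !expr2; case: hsg => ->; lra.
pose L := \sum_(e in tri (unc G0 Q)) Le e.
have T0 : 0 < T := tri_gt0.
pose l := L / T.
have step : \sum_(e in tri (unc G0 Q)) expR (- (rate * sg * Le e)) <= T * expR (- rate * sg * l + 6 * rate ^+ 2 * l).
  apply: (@le_trans _ _ (T * (1 - rate * sg * l + 6 * rate ^+ 2 * l))).
    apply: (@le_trans _ _ (\sum_(e in tri (unc G0 Q)) (1 - rate * sg * Le e + 6 * rate ^+ 2 * Le e))).
      by apply: ler_sum.
    rewrite big_split sumrB /= -!mulr_sumr -/L sumr_const -/T /l.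
    have e1 : T * (L / T) = L by rewrite mulrC divfK // gt_eqF.
    rewrite le_eqVlt; apply/orP; left; apply/eqP.
    transitivity (T - rate * sg * (T * (L / T)) + 6 * rate ^+ 2 * (T * (L / T))); last by ring.
    by rewrite e1.
  rewrite ler_pM2l //; apply: le_trans (expR_ge1Dx _).
  by lra.
have drift : - rate * sg * l + 6 * rate ^+ 2 * l + rate * c <= 0.
  have h0 := h_gt0; have p1 := p_le1; have gg := g0_le_gam; have gam0 := gam_gt0.
  have y01 : 0 <= h / p <= 1.
    by apply/andP; split; [apply: divr_ge0; apply: ltW|rewrite ler_pdivrMr // mul1r ltW].
  have pn : p - h = p * (1 - h / p) by field; rewrite gt_eqF.
  have dPb : k%:R * (h / p) * (1 - 4 * (h / p)) * p ^+ k <= dP <= k%:R * (h / p) * p ^+ k.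
    have /andP[o1 o2] := one_sub_exp_bounds k4 y01.
    have -> : dP = (1 - (1 - h / p) ^+ k) * p ^+ k by rewrite /dP p'E pn exprMn; ring.
    by rewrite !ler_pM2r ?exprn_gt0 // o1.
  (* [tol p * p ^ k] is [g0] times the power [K - k] of [p ^- 1], and [K - k >= 196]; Bernoulli's
     inequality gives the relative growth [196 * (h / p)] in one step. *)
  have dGb : gam * p ^+ k * (196%:R * (h / p)) <= dG.
    have k4' : (k <= 4)%N by case/andP: k4.
    have kK : (k <= K)%N by apply: leq_trans k4' (leq_trans _ K200).
    have tolE q : 0 < q -> tol q * q ^+ k = g0 * q^-1 ^+ (K - k).
      move=> q0; have e : q^-1 ^+ k * q ^+ k = 1.
        by rewrite -exprMn mulVf ?expr1n // gt_eqF.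
      by rewrite /tol -{1}(subnK kK) exprD -!mulrA e mulr1.
    have q0 : 0 < p - h by rewrite subr_gt0.
    rewrite /dG p'E !tolE // -mulrBr -mulrA ler_pM2l //.
    have hh : 0 <= h < p by rewrite hp ltW.
    have := inv_exp_growth (K - k) p_gt0 hh.
    have : p^-1 ^+ (K - k) * (196 * (h / p)) <= p^-1 ^+ (K - k) * ((K - k)%:R * (h / p)).
      rewrite ler_pM2l ?exprn_gt0 ?invr_gt0 // ler_wpM2r //; first by case/andP: y01.
      by rewrite (ler_nat R 196); apply: (leq_trans (leq_sub2l 200 k4')); apply: leq_sub2r.
    by lra.
  have := @avg_loss_ineq R T L (ecount G0)%:R p D gam (tracked_count Q j) k.
  case=> //; first by case/andP: k4.
  - by rewrite ltr0n.
  - by rewrite gam0.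
  - exact: tri_dev.
  - exact: loss_bounds.
  rewrite -/h -/l => lb _.
  have := @drift_ineq R sg rate gam (p ^+ k) (h / p) (s j) (tracked_count Q j) (tracked_count set0 j) dP dG l k k4 hsg.
  have -> : (- rate * sg * l + 6 * rate ^+ 2 * l + rate * c) =
    rate * (- sg * l + 6 * rate * l + sg * dP * tracked_count set0 j - dG * s j) by rewrite /c; ring.
  move=> H; rewrite pmulr_rle0 //; apply: H => //.
  - by rewrite exprn_gt0.
  - by rewrite Y0s andbT /tracked_count.
  - by rewrite gam0 /= (le_trans tol_small) // invf_le1 ?ler1n ?ltr0n.
  - by rewrite ltW //= /rate ler_pM2r // invr_gt0 ltr0n.
  - by apply: tracked_count_dev.
apply: (@le_trans _ _ (\sum_(e in tri (unc G0 Q))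
    expR (rate * deviation sg i Q j + rate * c) * expR (- (rate * sg * Le e)))).
  apply: ler_sum => e et; rewrite devE // -expRD ler_expR.
  rewrite le_eqVlt; apply/orP; left; apply/eqP; ring.
rewrite -mulr_sumr; apply: le_trans (ler_wpM2l (expR_ge0 _) step) _.
rewrite mulrCA ler_pM2l // -expRD ler_expR; lra.
Qed.

Lemma Phi_step : rate <= 12^-1 ->
  \sum_(e in tri (unc G0 Q)) Phi i.+1 (e |: Q) <= #|tri (unc G0 Q)|%:R * Phi i Q.
Proof.
move=> l12; rewrite exchange_big /= mulr_sumr; apply: ler_sum => j jF.
by rewrite big_split /= mulrDr lerD // step1 //; [left|right].
Qed.

End Step.

Definition process_state i Q := [/\ packing G0 Q, #|Q| = i & legal i Q].

Lemma process_state0 : process_state 0 set0.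
Proof.
split; [exact: packing0|exact: cards0|].
rewrite /legal addn0; apply/eqP/eq_card => xy.
by rewrite !inE unc0.
Qed.

Lemma process_stateS i Q e : process_state i Q -> e \in tri (unc G0 Q) -> process_state i.+1 (e |: Q).
Proof.
move=> [h1 h2 h3] he; split; first exact: packingU.
  by rewrite cardsU1 h2 (tri_unc_notin he).
by move: h3; rewrite /legal -(ecount_unc iG he) mulnS addnA.
Qed.

Variable M : nat.
Hypothesis E_gt0 : (0 < ecount G0)%N.
Hypothesis pM_gt0 : 0 < dens M.
Hypothesis h_small : 8 * stepsz <= g0 * dens M.
Hypothesis tol_small : tol (dens M) <= 100^-1.
Hypothesis D_big : 16 <= g0 * (dens M ^+ 2 * D).

Lemma dens_ge i : (i <= M)%N -> dens M <= dens i.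
Proof.
move=> iM; rewrite lerD2l lerN2 ler_wpM2r ?ler_nat //.
by rewrite divr_ge0.
Qed.

Lemma g0_small : g0 <= 100^-1.
Proof. exact: le_trans (g0_le_gam pM_gt0 E_gt0) tol_small. Qed.

Lemma lam_small : rate <= 12^-1.
Proof. by rewrite /rate; have := g0_small; lra. Qed.

Lemma step_conditions i : (i <= M)%N ->
  [/\ 0 < dens i, stepsz < dens i, 8 * (stepsz / dens i) <= tol (dens i),
   tol (dens i) <= 100^-1 & 16 <= tol (dens i) * (dens i ^+ 2 * D)].
Proof.
move=> iM; have pp := dens_ge iM; have p0 : 0 < dens i := lt_le_trans pM_gt0 pp.
have gg := g0_le_gam p0 E_gt0; have gs := g0_small.
have gp : g0 * dens i <= 100^-1 * dens i by rewrite ler_pM2r.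
have gp2 : g0 * dens M <= g0 * dens i by rewrite ler_pM2l.
have h0 := h_gt0 E_gt0.
have hs := h_small.
split=> //; first by lra.
- rewrite mulrA ler_pdivrMr //; apply: le_trans h_small _.
  by apply: le_trans gp2 _; rewrite ler_pM2r.
- apply: le_trans tol_small; rewrite /tol ler_pM2l //; apply: lerXn2r.
  + by rewrite nnegrE invr_ge0 ltW.
  + by rewrite nnegrE invr_ge0 ltW.
  + by rewrite lef_pV2.
- apply: le_trans D_big _; apply: ler_pM => //; first exact: ltW.
    by rewrite mulr_ge0 ?sqr_ge0 // ltW.
  by rewrite ler_pM2r //; apply: lerXn2r => //; rewrite nnegrE; apply: ltW.
Qed.

Lemma process_step i Q : (i <= M)%N -> process_state i Q -> Phi i Q < 1 ->
  [/\ \sum_(e in tri (unc G0 Q)) Phi i.+1 (e |: Q) <= #|tri (unc G0 Q)|%:R * Phi i Q,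
   0 < #|tri (unc G0 Q)|%:R :> R &
   (ecount G0)%:R * dens i ^+ 3 * D * (1 - 2 * tol (dens i)) / 6 <= #|tri (unc G0 Q)|%:R].
Proof.
move=> iM [_ _ leg] Phi1; have [c1 c2 c3 c4 c5] := step_conditions iM.
split.
- by apply: Phi_step => //; apply: lam_small.
- exact: (tri_gt0 Phi1 leg c1 E_gt0 c4).
have := tri_dev Phi1 leg c1 E_gt0; rewrite ler_distl; lra.
Qed.

(** By conditional expectations: the average of [Phi] over the next triple is at most its present
    value, so some choice keeps it below 1. *)
Lemma process_extend i Q : (i <= M)%N -> process_state i Q -> Phi i Q < 1 ->
  exists Q' : {set {set V}}, [/\ Q \subset Q', process_state M Q' & Phi M Q' < 1].
Proof.
move: {2}(M - i)%N (erefl (M - i)%N) => j; elim: j i Q => [|j IH] i Q ij iM sti P1.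
  by exists Q; have -> : M = i by apply/eqP; rewrite eqn_leq iM -subn_eq0 ij.
have iM1 : (i < M)%N by rewrite -subn_gt0 ij.
have ij1 : (M - i.+1 = j)%N by rewrite subnS ij.
have [s1 s2 _] := process_step iM sti P1.
have [/exists_inP[e et Pe]|/exists_inPn hn] := boolP [exists e in tri (unc G0 Q), Phi i.+1 (e |: Q) < 1].
  have [Q' [sQ sM PM]] := IH i.+1 (e |: Q) ij1 iM1 (process_stateS sti et) Pe.
  by exists Q'; split=> //; apply: fintype.subset_trans sQ; apply: subsetUr.
exfalso; have : #|tri (unc G0 Q)|%:R <= #|tri (unc G0 Q)|%:R * Phi i Q.
  apply: le_trans s1; rewrite -sumr_const; apply: ler_sum => e et.
  by rewrite leNgt hn.
by apply/negP; rewrite -ltNge gtr_pMr.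
Qed.

Variable W : {set {set V}} -> nat.
Variables (N M1 : nat).
Hypothesis M1M : (M1 <= M)%N.
Hypothesis M1N : (M1 <= N)%N.
Hypothesis W_rec : forall Q : {set {set V}}, (\sum_(e | e \notin Q) W (e |: Q) = W Q * (N - #|Q|))%N.
Hypothesis W_base : forall Q : {set {set V}}, process_state M1 Q -> Phi M1 Q < 1 -> (0 < W Q)%N.

Definition LB i : R := (ecount G0)%:R * dens i ^+ 3 * D * (1 - 2 * tol (dens i)) / 6.

Lemma LB_ge0 i : (i <= M)%N -> 0 <= LB i.
Proof.
move=> iM; have [c1 c2 c3 c4 c5] := step_conditions iM.
have q : 0 <= 1 - 2 * tol (dens i) by lra.
rewrite /LB; apply: mulr_ge0; last by rewrite invr_ge0.
have d0 : 0 <= dens i by apply: ltW.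
have D0 : 0 <= D by apply: ltW.
by rewrite !mulr_ge0 // exprn_ge0.
Qed.

(** The quantity [1 - Phi] plays the part of a lower bound for the proportion of runs that stay
    good. It does not decrease on average, it is at most 1 at the end, where [W] is at least 1, and
    when [Phi >= 1] the left side is nonpositive, so runs that leave the good region cost
    nothing. *)
Lemma process_lower i Q : (i <= M1)%N -> process_state i Q ->
  (1 - Phi i Q) * \prod_(i <= l < M1) LB l <= (W Q * (N - i) ^_ (M1 - i))%:R.
Proof.
move: {2}(M1 - i)%N (erefl (M1 - i)%N) => j; elim: j i Q => [|j IH] i Q ij iM sti.
  have e : i = M1 by apply/eqP; rewrite eqn_leq iM -subn_eq0 ij.
  subst i; rewrite big_geq // mulr1 subnn ffactn0 muln1.
  have [P1|P1] := ltP (Phi M1 Q) 1; last by apply: (@le_trans _ _ 0); rewrite ?subr_le0.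
  by apply: (@le_trans _ _ 1); [rewrite lerBlDr lerDl Phi_ge0|rewrite ler1n W_base].
have iM' : (i < M1)%N by rewrite -subn_gt0 ij.
have ij1 : (M1 - i.+1 = j)%N by rewrite subnS ij.
have LBp : 0 <= \prod_(i.+1 <= l < M1) LB l.
  rewrite big_nat; apply: prodr_ge0 => l /andP[_ lM]; apply: LB_ge0.
  exact: leq_trans (ltnW lM) M1M.
have iMM : (i <= M)%N by apply: leq_trans iM M1M.
rewrite big_ltn //.
have [P1|P1] := ltP (Phi i Q) 1; last first.
  apply: (@le_trans _ _ 0) => //; rewrite mulr_le0_ge0 ?subr_le0 // mulr_ge0 // LB_ge0 //.
have [s1 s2 s3] := process_step iMM sti P1.
have cQ : #|Q| = i by case: sti.
have -> : (W Q * (N - i) ^_ (M1 - i) = \sum_(e | e \notin Q) W (e |: Q) * (N - i.+1) ^_ (M1 - i.+1))%N.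
  rewrite -big_distrl /= W_rec cQ -mulnA; congr muln.
  by rewrite ij ij1 ffactnS subnS.
apply: (@le_trans _ _ (\sum_(e in tri (unc G0 Q)) (W (e |: Q) * (N - i.+1) ^_ (M1 - i.+1))%:R)); last first.
  rewrite -natr_sum ler_nat big_mkcond [X in (_ <= X)%N]big_mkcond; apply: leq_sum => e _.
  by case: ifP => // et; rewrite (tri_unc_notin et).
apply: (@le_trans _ _ (\sum_(e in tri (unc G0 Q)) (1 - Phi i.+1 (e |: Q)) * \prod_(i.+1 <= l < M1) LB l)); last first.
  by apply: ler_sum => e et; apply: IH; [exact: ij1|exact: iM'|exact: process_stateS].
rewrite -mulr_suml mulrA ler_wpM2r // sumrB sumr_const.
apply: (@le_trans _ _ (#|tri (unc G0 Q)|%:R * (1 - Phi i Q))).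
  by rewrite mulrC ler_wpM2r // subr_ge0 ltW.
by rewrite mulrBr mulr1 lerD2l lerN2.
Qed.

End Process.

(** * Completion of quasirandom packings *)

Section Mixing.
Variables (R : realFieldType) (V I : finType).
Variables (B : {set V}) (A : {set I}) (ok : I -> pred V) (conf : rel I).
Variables (p m eps : R) (Dl : nat).

(* Second moment method: the counts a(x) = #{e in A : ok e x} have mean about
   c = p^2 |A|, and the pair counts bound their variance. *)
Lemma mixing (T : nat) :
  0 < p <= 1 -> 0 < m -> 0 <= eps <= 1 -> #|B|%:R = m -> (0 < #|A|)%N ->
  {in A, forall e, (1 - eps) * (p ^+ 2 * m) <= #|[set x in B | ok e x]|%:R <= 2 * (p ^+ 2 * m)} ->
  {in A &, forall e f, ~~ conf e f ->
     #|[set x in B | ok e x && ok f x]|%:R <= (1 + eps) * (p ^+ 4 * m)} ->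
  {in A, forall e, (#|[set f in A | conf e f]| <= Dl)%N} ->
  T%:R <= p ^+ 2 * #|A|%:R / 4 ->
  #|[set x in B | (#|[set e in A | ok e x]| < T)%N]|%:R
    <= (6 * eps + 4 * (Dl%:R / (p ^+ 2 * #|A|%:R))) * m.
Proof.
move=> /andP[p0 p1] m0 /andP[e0 e1] cB A0 h1 h2 h3 hT.
set bad := [set x in B | _].
pose a x : R := \sum_(e in A) (ok e x)%:R.
have aE x : a x = #|[set e in A | ok e x]|%:R.
  rewrite /a -natr_sum; congr _%:R; rewrite -sum1_card -big_mkcondr.
  by apply: eq_bigl => e; rewrite inE.
pose c : R := p ^+ 2 * #|A|%:R.
have AR : 0 < #|A|%:R :> R by rewrite ltr0n.
have p2 : 0 < p ^+ 2 by rewrite exprn_gt0.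
have c0 : 0 < c by rewrite mulr_gt0.
have cnt (P : pred V) : \sum_(x in B) (P x)%:R = #|[set x in B | P x]|%:R :> R.
  rewrite -natr_sum; congr _%:R; rewrite -sum1_card -big_mkcondr.
  by apply: eq_bigl => e; rewrite inE.
have S1 : #|A|%:R * ((1 - eps) * (p ^+ 2 * m)) <= \sum_(x in B) a x.
  rewrite exchange_big /= mulr_natl -sumr_const; apply: ler_sum => e eA.
  by rewrite (cnt (ok e)); case/andP: (h1 e eA).
have S2 : \sum_(x in B) a x ^+ 2 <=
    #|A|%:R * (#|A|%:R * ((1 + eps) * (p ^+ 4 * m)) + Dl%:R * (2 * (p ^+ 2 * m))).
  have -> : \sum_(x in B) a x ^+ 2 = \sum_(e in A) \sum_(f in A) #|[set x in B | ok e x && ok f x]|%:R.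
    transitivity (\sum_(x in B) \sum_(e in A) \sum_(f in A) (ok e x && ok f x)%:R : R).
      apply: eq_bigr => x _; rewrite expr2 /a mulr_suml; apply: eq_bigr => e _.
      rewrite mulr_sumr; apply: eq_bigr => f _.
      by case: (ok e x); case: (ok f x); rewrite ?mulr0 ?mul0r ?mulr1.
    rewrite exchange_big /=; apply: eq_bigr => e _; rewrite exchange_big /=.
    by apply: eq_bigr => f _; rewrite (cnt (fun x => ok e x && ok f x)).
  rewrite mulr_natl -sumr_const; apply: ler_sum => e eA.
  rewrite (bigID (conf e)) /= addrC; apply: lerD.
    apply: (@le_trans _ _ (\sum_(f in A | ~~ conf e f) ((1 + eps) * (p ^+ 4 * m)))).
      by apply: ler_sum => f /andP[fA ncf]; apply: h2.
    rewrite sumr_const -[X in X <= _]mulr_natl ler_wpM2r //.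
      by rewrite !mulr_ge0 ?exprn_ge0 ?addr_ge0 // ltW.
    by rewrite ler_nat; apply/subset_leq_card/subsetP => f /andP[].
  apply: (@le_trans _ _ (\sum_(f in A | conf e f) (2 * (p ^+ 2 * m)))).
    apply: ler_sum => f /andP[fA cf]; case/andP: (h1 e eA) => _; apply: le_trans.
    by rewrite ler_nat; apply/subset_leq_card/subsetP => x; rewrite !inE => /and3P[-> ->].
  rewrite sumr_const -[X in X <= _]mulr_natl ler_wpM2r //.
    by rewrite !mulr_ge0 ?exprn_ge0 // ltW.
  rewrite ler_nat; apply: leq_trans (h3 e eA); apply/subset_leq_card/subsetP => f /andP[fA cf].
  by rewrite inE fA.
have var : \sum_(x in B) (a x - c) ^+ 2 <= (3 * eps + 2 * (Dl%:R / (p ^+ 2 * #|A|%:R))) * (c ^+ 2 * m).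
  have -> : \sum_(x in B) (a x - c) ^+ 2 = \sum_(x in B) a x ^+ 2 - 2 * c * \sum_(x in B) a x + c ^+ 2 * m.
    rewrite (eq_bigr (fun x => a x ^+ 2 + (- (2 * c)) * a x + c ^+ 2)); last by move=> x _; ring.
    by rewrite !big_split /= -mulr_sumr sumr_const -[c ^+ 2 *+ _]mulr_natr cB mulNr.
  have c2 : 0 <= 2 * c by rewrite mulr_ge0 // ltW.
  have := ler_wpM2l c2 S1.
  have -> : (3 * eps + 2 * (Dl%:R / (p ^+ 2 * #|A|%:R))) * (c ^+ 2 * m) =
    3 * eps * (c ^+ 2 * m) + #|A|%:R * (Dl%:R * (2 * (p ^+ 2 * m))).
    by rewrite /c; field; rewrite !gt_eqF.
  move: S2; rewrite mulrDr.
  have -> : #|A|%:R * (#|A|%:R * ((1 + eps) * (p ^+ 4 * m))) = (1 + eps) * (c ^+ 2 * m) by rewrite /c; ring.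
  have -> : 2 * c * (#|A|%:R * ((1 - eps) * (p ^+ 2 * m))) = 2 * (1 - eps) * (c ^+ 2 * m) by rewrite /c; ring.
  by lra.
(* Chebyshev: as [T <= c / 4], an exceptional [x] deviates from [c] by at least [3 / 4 * c]; the
   factor [16 / 9] is then rounded up to 2. *)
have low : #|bad|%:R * ((3 / 4 * c) ^+ 2) <= \sum_(x in B) (a x - c) ^+ 2.
  apply: (@le_trans _ _ (\sum_(x in bad) (a x - c) ^+ 2)).
    rewrite mulr_natl -sumr_const; apply: ler_sum => x /setIdP[xB].
    rewrite -(ltr_nat R) -aE => lt.
    have q : 3 / 4 * c <= c - a x by rewrite /c; lra.
    by rewrite -[X in _ <= X]sqrrN opprB; apply: lerXn2r; rewrite ?nnegrE //; lra.
  rewrite big_mkcond [X in _ <= X]big_mkcond /=; apply: ler_sum => x _.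
  by rewrite inE; case: (x \in B) => //=; case: ifP => // _; rewrite sqr_ge0.
have c2m : 0 < c ^+ 2 by rewrite exprn_gt0.
have fin := le_trans low var.
rewrite -(ler_pM2r c2m).
have : (3 * eps + 2 * (Dl%:R / (p ^+ 2 * #|A|%:R))) * m * c ^+ 2 >= 9 / 16 * (#|bad|%:R * c ^+ 2).
  by move: fin; rewrite exprMn; lra.
have z0 : 0 <= (3 * eps + 2 * (Dl%:R / (p ^+ 2 * #|A|%:R))) * m * c ^+ 2.
  have d0 : 0 <= Dl%:R / (p ^+ 2 * #|A|%:R) by rewrite divr_ge0 // ltW.
  by apply: mulr_ge0; [apply: mulr_ge0; [lra|exact: ltW]|exact: ltW].
have -> : (6 * eps + 4 * (Dl%:R / (p ^+ 2 * #|A|%:R))) * m * c ^+ 2 =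
  2 * ((3 * eps + 2 * (Dl%:R / (p ^+ 2 * #|A|%:R))) * m * c ^+ 2) by ring.
lra.
Qed.

End Mixing.

(** * Quasirandom conditions and exact quotas *)

Section QuasiCompletion.
Variables (R : realType) (V : finType) (Q : {set {set V}}) (m fN : nat) (p f eps : R).
Notation X := (fun u x => ~~ cov Q u x).
Notation M := (m%:R : R).

(** Here [p] is the density of uncovered cross pairs and [f] the typical number of uncovered inside
    pairs at a point. Requiring [f] to be small against [p ^ 4 * m] makes the edges to be assigned
    few compared with the codegrees available to them. *)
Definition quasi_numerics :=
  [/\ 0 < p <= 1, 0 <= eps <= (10 * 20)^-1, eps * (p * M) <= f / (20 * 20) &
      [/\ f * (10 * 10 * 10) <= p ^+ 4 * M, (10 * 10) <= f, fN%:R <= f < fN%:R + 1 & (20 * (10 * 10 * 10)) <= p ^+ 6 * M]].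

(** Sets [Z] of four points occur because the second moment in [mixing] involves two disjoint inside
    pairs. The last clause gives every point [y] enough inside pairs for which it may be the
    apex. *)
Definition quasi_side (U B : {set V}) :=
  [/\ forall Z : {set V}, Z \subset U -> (0 < #|Z| <= 4)%N ->
        `|#|cnbr X Z B|%:R - p ^+ #|Z| * M| <= eps * (p ^+ #|Z| * M),
      forall v, v \in U -> `|#|[set e in inside Q U | v \in e]|%:R - f| <= f / 20 &
      forall u y, u \in U -> y \in B -> ~~ cov Q u y -> 3 / 5 * (p * f) <=
        #|[set v in U | [&& v != u, ~~ cov Q u v & ~~ cov Q v y]]|%:R].

Notation a1 := (Num.truncn (p ^+ 2 * M / 2)).
Notation a3 := (Num.truncn (p ^+ 2 * M / 16)).

Lemma trunc_bounds (x : R) : 0 <= x -> (Num.truncn x)%:R <= x /\ x - 1 <= (Num.truncn x)%:R.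
Proof.
move=> x0; have /andP[h1 h2] := truncn_itv x0; split=> //.
by move: h2; rewrite -addn1 natrD; lra.
Qed.

Hypothesis num : quasi_numerics.

Lemma scale_facts :
  [/\ 0 < M, p ^+ 4 * M <= p ^+ 3 * M, p ^+ 3 * M <= p ^+ 2 * M, p ^+ 2 * M <= p * M & ((10 * 10) * (10 * 10 * 10)) <= p ^+ 4 * M].
Proof.
have [/andP[p0 p1] _ _ [h1 h2 _ _]] := num.
have P4 : ((10 * 10) * (10 * 10 * 10)) <= p ^+ 4 * M by lra.
have M0 : 0 < M.
  rewrite lt0r ler0n andbT; apply/eqP => m0; move: P4; rewrite m0 mulr0; lra.
have process_state k : p ^+ k.+1 * M <= p ^+ k * M.
  by rewrite exprS -mulrA ler_piMl // mulr_ge0 ?exprn_ge0 // ltW.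
by split=> //; rewrite -[p in X in _ <= X]expr1.
Qed.

Lemma fN_facts : [/\ (10 * 10 - 1) <= fN%:R :> R, fN%:R <= f, f <= fN%:R + 1 & f * f * (10 * 10 * 10) <= p ^+ 4 * M * f].
Proof.
have [_ _ _ [h1 h2 /andP[h3 h4] _]] := num.
split=> //; [by lra|exact: ltW|].
by rewrite mulrAC ler_pM2r //; lra.
Qed.

Lemma qmin_bound : (f - 4) / 4 <= (fN %/ 4)%:R.
Proof.
have [h1 h2 h3 _] := fN_facts.
have e : (fN <= 4 * (fN %/ 4) + 3)%N by rewrite {1}(divn_eq fN 4) mulnC leq_add2l -ltnS ltn_mod.
by move: e; rewrite -(ler_nat R) natrD natrM; move: h3 h2; lra.
Qed.

End QuasiCompletion.

(** The quotas will be about [f / 2], which [fN %/ 4] and [fN] bracket safely. The value of [a1] is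
    half the expected codegree [p ^ 2 * m], and [a3] a sixteenth of it, so that [qmax * a3] stays
    below the roughly [3 / 10 * f * p ^ 2 * m] inside pairs allowed at an apex. *)
Lemma quasi_side_hyp (R : realType) (V : finType) (Q : {set {set V}}) (m fN : nat) (p f eps : R)
  (U B : {set V}) (q : V -> nat) : quasi_numerics m fN p f eps -> #|B| = m ->
  quasi_side Q m p f eps U B -> (forall y, y \in B -> (1 - eps) * (p * m%:R) <= #|[set u in U | ~~ cov Q u y]|%:R) ->
  (\sum_(x in B) q x = #|inside Q U|)%N ->
  side_hyp Q q (2 * fN) (fN %/ 4) fN (Num.truncn (p ^+ 2 * m%:R / 2)) (Num.truncn (p ^+ 2 * m%:R / 16)) (4 * fN * fN + 1) (4 * fN * fN + fN * Num.truncn (p ^+ 2 * m%:R / 16) + 1) U B.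
Proof.
move=> num cB [b1 b2 b3] degB sq.
have [/andP[p0 p1] /andP[e0 e1] e2 [n1 n2 n3 n4]] := num.
have [M0 P43 P32 P21 P4] := scale_facts num; have [f1 f2 f3 f4] := fN_facts num; have qm := qmin_bound num.
have P20 : 0 <= p ^+ 2 * m%:R / 2 by lra.
have [a1u a1l] := trunc_bounds P20.
set a1 := Num.truncn _ in a1u a1l *.
have P20' : 0 <= p ^+ 2 * m%:R / 16 by lra.
have [a3u a3l] := trunc_bounds P20'.
set a3 := Num.truncn _ in a3u a3l *.
have eP2 : eps * (p ^+ 2 * m%:R) <= (10 * 20)^-1 * (p ^+ 2 * m%:R) by rewrite ler_wpM2r //; lra.
have ins_le u : u \in U -> (#|[set e in inside Q U | u \in e]| <= 2 * fN)%N.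
  by move=> uU; have := b2 u uU; rewrite ler_distl -(ler_nat R) natrM => /andP[_ h]; lra.
have ff : fN%:R * fN%:R <= f * f by rewrite ler_pM.
have ff100 : (10 * 10) * f <= f * f by rewrite ler_pM2r //; move: n2; clear; lra.
have f2P : f * (p ^+ 4 * m%:R) <= f * (p ^+ 2 * m%:R) by rewrite ler_pM2l ?(le_trans P43 P32) //; lra.
have fa3 : fN%:R * a3%:R <= f * (p ^+ 2 * m%:R / 16) by rewrite ler_pM.
split=> //.
- move=> e /insideP[c2 eU]; rewrite -(ler_nat R) 2!natrD !natrM.
  have := b1 e eU; rewrite c2 => /(_ isT); rewrite ler_distl => /andP[h _]; move: h eP2 a1u a1l n2 f1 f2 f3 f4 P20 P4 P43 P32 n1; clear; lra.
- move=> A sA cA.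
  have AR : a1%:R * (fN %/ 4)%:R <= #|A|%:R :> R by rewrite -natrM ler_nat.
  have A1 : 49 / (10 * 10) * (p ^+ 2 * m%:R) * (24 / (10 * 10) * f) <= #|A|%:R.
    apply: le_trans AR; apply: ler_pM.
    - by move: P20; clear; lra.
    - by move: n2; clear; lra.
    - by move: a1l P43 P32 P4; clear; lra.
    - by move: qm n2; clear; lra.
  have PA : (12 * (7 * 14)) / (10 * (10 * 10 * 10)) * (p ^+ 4 * m%:R * f) <= p ^+ 2 * #|A|%:R.
    have : p ^+ 2 * (49 / (10 * 10) * (p ^+ 2 * m%:R) * (24 / (10 * 10) * f)) <= p ^+ 2 * #|A|%:R.
      by rewrite ler_pM2l // exprn_gt0.
    have -> : p ^+ 2 * (49 / (10 * 10) * (p ^+ 2 * m%:R) * (24 / (10 * 10) * f)) = (12 * (7 * 14)) / (10 * (10 * 10 * 10)) * (p ^+ 4 * m%:R * f) by field.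
    by [].
  have f0 : 0 < f by move: n2; clear; lra.
  have PMf : 0 < p ^+ 4 * m%:R * f by rewrite mulr_gt0 // mulr_gt0 // exprn_gt0.
  have A0 : (0 < #|A|)%N.
    rewrite -(ltr_nat R); rewrite -(pmulr_rgt0 _ (_ : 0 < p ^+ 2)) ?exprn_gt0 //; move: PA PMf; clear; lra.
  have ok2 (e e' : {set V}) : #|[set x in B | [forall u in e, ~~ cov Q u x] && [forall u in e', ~~ cov Q u x]]| = #|cnbr (fun u x => ~~ cov Q u x) (e :|: e') B|.
    apply: eq_card => x; rewrite [RHS]in_set [LHS]in_set; congr (_ && _).
    apply/andP/forall_inP => [[/forall_inP h /forall_inP h'] u|h].
      by rewrite in_setU => /orP[/h|/h'].
    by split; apply/forall_inP => u ue; apply: h; rewrite in_setU ue ?orbT.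
  rewrite -(ler_nat R).
  apply: (@le_trans _ _ ((6 * eps + 4 * ((4 * fN)%:R / (p ^+ 2 * #|A|%:R))) * m%:R)).
    (* Two inside pairs conflict when they meet, which happens for at most [2 * Delta = 4 * fN]
       partners; otherwise their union is a four-point set controlled by [quasi_side]. *)
    apply: (@mixing R V {set V} B A (fun (e : {set V}) x => [forall u in e, ~~ cov Q u x])
      (fun e e' : {set V} => ~~ [disjoint e & e']) p m%:R eps (4 * fN)).
    - by rewrite p0.
    - exact: M0.
    - by rewrite e0 /=; move: e1; clear; lra.
    - by rewrite cB.
    - exact: A0.
    - move=> e /(subsetP sA)/insideP[c2 eU].
      by have := b1 e eU; rewrite c2 => /(_ isT); rewrite ler_distl /cnbr; move: eP2 P20; clear; lra.
    - move=> e e' /(subsetP sA)/insideP[c2 eU] /(subsetP sA)/insideP[c2' eU']; rewrite negbK => dis.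
      have c4 : #|e :|: e'| = 4 by rewrite cardsU (disjoint_setI0 dis) cards0 c2 c2'.
      rewrite ok2; have := b1 (e :|: e'); rewrite subUset eU eU' c4 => /(_ isT isT).
      by rewrite ler_distl => /andP[_]; rewrite mulrDl mul1r.
    - move=> e /(subsetP sA)/insideP[c2 eU].
      apply: (@leq_trans (\sum_(u in e) #|[set g in inside Q U | u \in g]|)).
        apply: leq_trans (card_bigcup_le _ _); apply/subset_leq_card/subsetP => g /setIdP[gA].
        rewrite -setI_eq0 => /set0Pn[u /setIP[ue ug]]; apply/bigcupP; exists u => //.
        by rewrite inE (subsetP sA).
      apply: (@leq_trans (\sum_(u in e) 2 * fN)%N); last by rewrite sum_nat_const c2 mulnA.
      by apply: leq_sum => u ue; apply: ins_le; apply: (subsetP eU).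
    - by rewrite 2!natrD !natrM; move: PA f4 ff ff100 n2; clear; lra.
  have h0 : 0 < p ^+ 2 * #|A|%:R by rewrite mulr_gt0 ?exprn_gt0 // ltr0n.
  have d1 : (4 * fN)%:R / (p ^+ 2 * #|A|%:R) <= 4 * f / ((12 * (7 * 14)) / (10 * (10 * 10 * 10)) * (p ^+ 4 * m%:R * f)).
    rewrite natrM; apply: ler_pM.
    - by rewrite mulr_ge0.
    - by rewrite invr_ge0 ltW.
    - by rewrite ler_pM2l.
    - by rewrite lef_pV2 ?posrE //; move: PMf; clear; lra.
  have d2 : 4 * f / ((12 * (7 * 14)) / (10 * (10 * 10 * 10)) * (p ^+ 4 * m%:R * f)) * m%:R <= 40 / p ^+ 4.
    have -> : 4 * f / ((12 * (7 * 14)) / (10 * (10 * 10 * 10)) * (p ^+ 4 * m%:R * f)) * m%:R = 40 * (10 * 10 * 10) / (12 * (7 * 14)) / p ^+ 4.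
      by field; rewrite !gt_eqF.
    by rewrite ler_pM2r ?invr_gt0 ?exprn_gt0 //; clear; lra.
  have d3 : 40 / p ^+ 4 <= p ^+ 2 * m%:R / (5 * 10 * 10).
    rewrite ler_pdivrMr ?exprn_gt0 //.
    have -> : p ^+ 2 * m%:R / (5 * 10 * 10) * p ^+ 4 = p ^+ 6 * m%:R / (5 * 10 * 10) by field.
    move: n4; clear; lra.
  have d4 : (4 * fN)%:R / (p ^+ 2 * #|A|%:R) * m%:R <= p ^+ 2 * m%:R / (5 * 10 * 10).
    by apply: le_trans d3; apply: le_trans d2; rewrite ler_pM2r.
  have e3 : eps * m%:R <= p ^+ 2 * m%:R / ((20 * 20) * (10 * 10 * 10)).
    rewrite -(ler_pM2l p0).
    have -> : p * (eps * m%:R) = eps * (p * m%:R) by ring.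
    have -> : p * (p ^+ 2 * m%:R / ((20 * 20) * (10 * 10 * 10))) = p ^+ 3 * m%:R / ((20 * 20) * (10 * 10 * 10)) by field.
    move: e2 n1 P43; clear; lra.
  have -> : (6 * eps + 4 * ((4 * fN)%:R / (p ^+ 2 * #|A|%:R))) * m%:R =
    6 * (eps * m%:R) + 4 * ((4 * fN)%:R / (p ^+ 2 * #|A|%:R) * m%:R) by ring.
  move: e3 d4 a3l P43 P32 P4; move: (_ / _ * m%:R) => z; clear; lra.
(* Each [u] in [N] has at least [3 / 5 * (p * f)] uncovered inside partners which again lie in [N];
   the sum over [N] counts every allowed pair twice. *)
- move=> y yB; pose N := [set u in U | ~~ cov Q u y].
  have NU : N \subset U by apply/subsetP => u /setIdP[].
  have eN : #|[set e in inside Q U | [forall u in e, ~~ cov Q u y]]| = #|[set e in inside Q U | e \subset N]|.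
    apply: eq_card => e; rewrite [LHS]in_set [RHS]in_set; case eI: (e \in inside Q U) => //=.
    have [c2 eU] := insideP eI.
    apply/forall_inP/subsetP => h u ue; first by rewrite inE (subsetP eU) //= h.
    by have := h u ue; rewrite inE => /andP[].
  rewrite eN -(ler_nat R) 3!natrD !natrM.
  have := inbr_sum Q NU; move/(congr1 (fun x => x%:R : R)); rewrite natr_sum natrM => es.
  have lo : #|N|%:R * (3 / 5 * (p * f)) <= \sum_(i in N) (inbr Q N i)%:R.
    rewrite mulr_natl -sumr_const; apply: ler_sum => u /setIdP[uU uy].
    apply: le_trans (b3 u y uU yB uy) _; rewrite ler_nat /inbr; apply/subset_leq_card/subsetP => v.
    by rewrite !inE => /and4P[-> -> -> ->].
  have cN := degB y yB.
  have pf0 : 0 < 3 / 5 * (p * f).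
    have f0 : 0 < f by move: n2; clear; lra.
    by rewrite !mulr_gt0 // invr_gt0.
  have lo2 : (1 - eps) * (p * m%:R) * (3 / 5 * (p * f)) <= #|N|%:R * (3 / 5 * (p * f)).
    by rewrite ler_pM2r.
  have lo3 : (10 * 20 - 1) / (10 * 20) * (p * m%:R) * (3 / 5 * (p * f)) <= (1 - eps) * (p * m%:R) * (3 / 5 * (p * f)).
    rewrite ler_pM2r // ler_pM2r; [by move: e1; clear; lra|exact: mulr_gt0].
  have : (10 * 20 - 1) / (10 * 20) * (p * m%:R) * (3 / 5 * (p * f)) = (3 * (10 * 20 - 1)) / (10 * 10 * 10) * (f * (p ^+ 2 * m%:R)) by field.
  by move: lo lo2 lo3 es f2P f4 ff ff100 fa3 n2; clear; lra.
Qed.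

Section TwoSided.
Variables (R : realType) (V : finType) (U1 U2 W : {set V}) (Q : {set {set V}}) (j m fN : nat) (p f eps : R).
Notation X := (fun u x => ~~ cov Q u x).
Notation M := (m%:R : R).
Hypothesis num : quasi_numerics m fN p f eps.
Hypothesis d12 : [disjoint U1 & U2].
Hypothesis eW : W = ~: (U1 :|: U2).
Hypothesis cW : #|W| = (3 ^ j)%N.
Hypothesis c1 : #|U1| = m.
Hypothesis c2 : #|U2| = m.
Hypothesis tQ : triples Q.
Hypothesis lQ : linsys Q.
Hypothesis QU : forall e, e \in Q -> e \subset U1 :|: U2.
Hypothesis qs1 : quasi_side Q m p f eps U1 U2.
Hypothesis qs2 : quasi_side Q m p f eps U2 U1.
(** Each inside pair will consume two cross pairs at its apex, and [m * 3 ^ j] cross pairs must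
    remain for the matchings with [W]. *)
Hypothesis total : (\sum_(u in U1) #|[set x in U2 | X u x]| =
  m * 3 ^ j + 2 * #|inside Q U1| + 2 * #|inside Q U2|)%N.

Definition cdeg v := if v \in U1 then #|[set x in U2 | X v x]| else #|[set u in U1 | X u v]|.
Definition ideg v := if v \in U1 then #|[set e in inside Q U1 | v \in e]|
   else #|[set e in inside Q U2 | v \in e]|.
Definition quota v := (cdeg v - 3 ^ j - ideg v)./2.

Lemma U2_notin1 v : v \in U2 -> (v \in U1) = false.
Proof. by move=> vU; apply: disjointFl d12 vU. Qed.

Lemma cdeg2 v : v \in U2 -> cdeg v = #|cnbr X [set v] U1|.
Proof.
move=> vU; rewrite /cdeg U2_notin1 //; apply: eq_card => u; rewrite !inE; congr (_ && _).
by apply/idP/forall_inP => [h z|/(_ v)]; rewrite inE ?eqxx; [move/eqP->; rewrite cov_sym|rewrite cov_sym; apply].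
Qed.

Lemma cdeg1 v : v \in U1 -> cdeg v = #|cnbr X [set v] U2|.
Proof.
move=> vU; rewrite /cdeg vU; apply: eq_card => u; rewrite !inE; congr (_ && _).
by apply/idP/forall_inP => [h z|/(_ v)]; rewrite inE ?eqxx; [move/eqP->|apply].
Qed.

Lemma cdeg_bounds v : v \in U1 :|: U2 -> `|(cdeg v)%:R - p * M| <= eps * (p * M).
Proof.
have [q1 _ _] := qs1; have [q2 _ _] := qs2.
rewrite in_setU => /orP[vU|vU].
  by rewrite cdeg1 //; have := q1 [set v]; rewrite sub1set vU cards1 expr1; apply.
by rewrite cdeg2 //; have := q2 [set v]; rewrite sub1set vU cards1 expr1; apply.
Qed.

Lemma ideg_bounds v : v \in U1 :|: U2 -> `|(ideg v)%:R - f| <= f / 20.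
Proof.
have [_ q1 _] := qs1; have [_ q2 _] := qs2.
rewrite in_setU /ideg => /orP[vU|vU]; first by rewrite vU q1.
by rewrite U2_notin1 // q2.
Qed.

Lemma ideg_sum1 : (\sum_(v in U1) ideg v = 2 * #|inside Q U1|)%N.
Proof.
rewrite -(inside_all Q) -inbr_sum //; apply: eq_bigr => v vU.
by rewrite /ideg vU inside_at.
Qed.

Lemma ideg_sum2 : (\sum_(v in U2) ideg v = 2 * #|inside Q U2|)%N.
Proof.
rewrite -(inside_all Q) -inbr_sum //; apply: eq_bigr => v vU.
by rewrite /ideg U2_notin1 // inside_at.
Qed.

Lemma cdeg_sum2 : (\sum_(v in U2) cdeg v = \sum_(u in U1) #|[set x in U2 | X u x]|)%N.
Proof.
transitivity (\sum_(u in U1) \sum_(x in U2) (X u x : nat))%N.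
  rewrite exchange_big /=; apply: eq_bigr => v vU; rewrite /cdeg U2_notin1 //.
  by rewrite -sum1_card -big_mkcondr; apply: eq_bigl => u; rewrite inE.
by apply: eq_bigr => u uU; rewrite -sum1_card -big_mkcondr; apply: eq_bigl => v; rewrite inE.
Qed.

(** Averaging the hypothesis [total] over the [m] points of a side: the mean cross degree, about
    [p * m], is [3 ^ j] plus two mean inside degrees. *)
Lemma w_bounds : 19 / 20 * (2 * f) - eps * (p * M) <= p * M - (3 ^ j)%:R <= 21 / 20 * (2 * f) + eps * (p * M).
Proof.
have [M0 _ _ _ _] := scale_facts num.
have t : (\sum_(u in U1) cdeg u)%:R = M * (3 ^ j)%:R + (\sum_(v in U1) ideg v)%:R + (\sum_(v in U2) ideg v)%:R :> R.
  rewrite ideg_sum1 ideg_sum2 -natrM -!natrD -total; congr _%:R.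
  by apply: eq_bigr => u uU; rewrite /cdeg uU.
have cE (c : R) (A : {set V}) : #|A| = m -> M * c = \sum_(v in A) c.
  by move=> cA; rewrite sumr_const cA mulr_natl.
have b1 : M * (p * M - eps * (p * M)) <= (\sum_(u in U1) cdeg u)%:R <= M * (p * M + eps * (p * M)).
  rewrite natr_sum !(cE _ _ c1); apply/andP; split; apply: ler_sum => u uU;
    by have := @cdeg_bounds u; rewrite in_setU uU => /(_ isT); rewrite ler_distl; case/andP.
have b2 (A : {set V}) : #|A| = m -> A \subset U1 :|: U2 -> M * (f - f / 20) <= (\sum_(u in A) ideg u)%:R <= M * (f + f / 20).
  move=> cA sA; rewrite natr_sum !(cE _ _ cA); apply/andP; split; apply: ler_sum => u uU;
    by have := @ideg_bounds u; rewrite (subsetP sA) // => /(_ isT); rewrite ler_distl; case/andP.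
have /andP[b21 b22] := b2 U1 c1 (subsetUl _ _); have /andP[b23 b24] := b2 U2 c2 (subsetUr _ _).
case/andP: b1 => b11 b12; rewrite t in b11 b12.
apply/andP; split; rewrite -(ler_pM2l M0); lra.
Qed.

(** The other [2 * m - 1] points of [U1 :|: U2] are either joined to [v] by an uncovered pair or
    grouped in twos by the blocks through [v]. Hence [cdeg v + ideg v] is odd, and as [3 ^ j] is odd
    the halving in [quota] is exact. *)
Lemma parity v : v \in U1 :|: U2 -> (cdeg v + ideg v + 2 * #|[set e in Q | v \in e]|).+1 = (2 * m)%N.
Proof.
move=> vU; have cU : #|U1 :|: U2| = (2 * m)%N.
  by rewrite cardsU (disjoint_setI0 d12) cards0 c1 c2 subn0 mul2n addnn.
rewrite -cov_count // -cU (cardsD1 v (U1 :|: U2)) vU add1n; congr _.+1.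
have -> : #|[set v0 | (v0 != v) && cov Q v v0]| = #|[set x in (U1 :|: U2) :\ v | cov Q v x]|.
  apply: eq_card => x; rewrite [LHS]in_set [RHS]in_set in_setD1.
  have [->|xv] //= := eqVneq x v; case cv: (cov Q v x); rewrite ?andbF // andbT.
  by case/existsP: cv => e /and3P[eQ _ xe]; rewrite (subsetP (QU eQ)).
have -> : (cdeg v + ideg v)%N = #|[set x in (U1 :|: U2) :\ v | ~~ cov Q v x]|.
  case: (boolP (v \in U1)) => v1.
    rewrite /cdeg /ideg v1 -inside_at // /inbr -cardsUI.
    rewrite [X in (_ + X)%N](_ : _ = 0%N) ?addn0; last first.
      apply/eqP; rewrite cards_eq0; apply/eqP/setP => x; rewrite !inE.
      by case x1: (x \in U1); rewrite ?andbF //= (disjointFr d12 x1).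
    apply: eq_card => x; rewrite !inE.
    have [->|xv] := eqVneq x v; first by rewrite v1 (disjointFr d12 v1).
    case x1: (x \in U1); first by rewrite (disjointFr d12 x1).
    by rewrite /= orbF.
  have v2 : v \in U2 by move: vU; rewrite in_setU (negbTE v1).
  rewrite /cdeg /ideg (negbTE v1) -inside_at // /inbr -cardsUI.
  rewrite [X in (_ + X)%N](_ : _ = 0%N) ?addn0; last first.
    apply/eqP; rewrite cards_eq0; apply/eqP/setP => x; rewrite !inE.
    by case x1: (x \in U1); rewrite ?andbF //= (disjointFr d12 x1) ?andbF.
  apply: eq_card => x; rewrite !inE.
  have [->|xv] := eqVneq x v; first by rewrite (negbTE v1) /= andbF.
  case x1: (x \in U1); first by rewrite (disjointFr d12 x1) /= orbF cov_sym.
  by [].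
rewrite -[RHS](cardsID [set x | cov Q v x]) addnC; congr addn; apply: eq_card => x.
  by rewrite [LHS]in_set in_setI in_set.
by rewrite [LHS]in_set [RHS]in_setD [x \in [set _ | _]]in_set [RHS]andbC.
Qed.

Lemma quota_spec v : v \in U1 :|: U2 ->
  cdeg v = (3 ^ j + ideg v + 2 * quota v)%N /\ (fN %/ 4 <= quota v <= fN)%N.
Proof.
move=> vU; have [/andP[p0 p1] /andP[e0 e1] e2 [n1 n2 /andP[n3 n4] n5]] := num.
have /andP[w1 w2] := w_bounds.
have := cdeg_bounds vU; rewrite ler_distl => /andP[d1 d2].
have := ideg_bounds vU; rewrite ler_distl => /andP[i1 i2].
have le : (3 ^ j + ideg v <= cdeg v)%N by rewrite -(ler_nat R) natrD; lra.
have odd3 : odd (3 ^ j) by rewrite oddX orbT.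
have ev : ~~ odd (cdeg v - 3 ^ j - ideg v).
  have := parity vU; move/(congr1 odd); rewrite !mul2n /= !oddD !odd_double addbF => pe.
  rewrite -subnDA oddB // oddD odd3 /=.
  by move: pe; case: (odd (cdeg v)); case: (odd (ideg v)).
have eq : (cdeg v = 3 ^ j + ideg v + 2 * quota v)%N.
  rewrite /quota mul2n halfK (negbTE ev) subn0 -subnDA subnKC //.
split=> //; have eR : (cdeg v)%:R = (3 ^ j)%:R + (ideg v)%:R + 2 * (quota v)%:R :> R.
  by rewrite {1}eq 2!natrD natrM.
apply/andP; split; rewrite -(ler_nat R).
  apply: (@le_trans _ _ (f / 4)); last by lra.
  have : (4 * (fN %/ 4) <= fN)%N by rewrite mulnC leq_trunc_div.
  by rewrite -(ler_nat R) natrM; lra.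
lra.
Qed.

Lemma quota_sum1 : (\sum_(x in U2) quota x = #|inside Q U1|)%N.
Proof.
have d : (\sum_(x in U2) 2 * quota x = 2 * \sum_(x in U2) quota x)%N by rewrite big_distrr.
have e : (\sum_(x in U2) cdeg x = \sum_(x in U2) (3 ^ j + ideg x + 2 * quota x))%N.
  by apply: eq_bigr => x xU; have [|<- //] := @quota_spec x; rewrite in_setU xU orbT.
move: e; rewrite cdeg_sum2 total 2!big_split /= ideg_sum2 sum_nat_const c2 d.
have arith a b c d' : (a + 2 * b + 2 * c = a + 2 * c + 2 * d' -> d' = b)%N by lia.
by apply: arith.
Qed.

Lemma quota_sum2 : (\sum_(x in U1) quota x = #|inside Q U2|)%N.
Proof.
have d : (\sum_(x in U1) 2 * quota x = 2 * \sum_(x in U1) quota x)%N by rewrite big_distrr.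
have e : (\sum_(x in U1) cdeg x = \sum_(x in U1) (3 ^ j + ideg x + 2 * quota x))%N.
  by apply: eq_bigr => x xU; have [|<- //] := @quota_spec x; rewrite in_setU xU.
have e2 : (\sum_(x in U1) cdeg x = \sum_(u in U1) #|[set x in U2 | X u x]|)%N.
  by apply: eq_bigr => u uU; rewrite /cdeg uU.
move: e; rewrite e2 total 2!big_split /= ideg_sum1 sum_nat_const c1 d.
have arith a b c d' : (a + 2 * b + 2 * c = a + 2 * b + 2 * d' -> d' = c)%N by lia.
by apply: arith.
Qed.

Lemma quasi_completion : exists S, steiner_triple_system S /\ Q \subset S.
Proof.
have h1 y : y \in U2 -> (1 - eps) * (p * M) <= #|[set u in U1 | ~~ cov Q u y]|%:R.
  move=> yU; have := @cdeg_bounds y; rewrite in_setU yU orbT => /(_ isT).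
  by rewrite /cdeg U2_notin1 // ler_distl => /andP[h _]; lra.
have h2 y : y \in U1 -> (1 - eps) * (p * M) <= #|[set u in U2 | ~~ cov Q u y]|%:R.
  move=> yU; have := @cdeg_bounds y; rewrite in_setU yU => /(_ isT).
  rewrite /cdeg yU ler_distl => /andP[h _].
  have -> : #|[set u in U2 | ~~ cov Q u y]| = #|[set x in U2 | ~~ cov Q y x]|.
    by apply: eq_card => u; rewrite !inE cov_sym.
  by lra.
have s1 := quasi_side_hyp num c2 qs1 h1 quota_sum1.
have s2 := quasi_side_hyp num c1 qs2 h2 quota_sum2.
apply: (apex_completion d12 eW cW tQ lQ QU _ s1 s2).
- by move=> x /quota_spec[].
- move=> u uU; have [|e _] := @quota_spec u; first by rewrite in_setU uU.
  by rewrite cW; move: e; rewrite /cdeg /ideg uU.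
- move=> u uU; have [|e _] := @quota_spec u; first by rewrite in_setU uU orbT.
  by rewrite cW; move: e; rewrite /cdeg /ideg U2_notin1.
- by rewrite addn1 ltnS -mulnA mulnCA mulnA; lia.
- by rewrite addn1 ltnS leq_add2r; lia.
Qed.

End TwoSided.

(** * The phase inside the two sides *)

Lemma dens0 (R : realType) (V : finType) (G : rel V) : dens R G 0 = 1.
Proof. by rewrite /dens mul0r subr0. Qed.

(** At the start every count equals its expected value, so each deviation is exactly
    [- g0 * s j]. *)
Lemma Phi_init (R : realType) (V : finType) (G : rel V) (F : {set {set V} * {set V}})
  (s : {set V} * {set V} -> R) (g0 smin : R) K : 0 < g0 ->
  (forall j, j \in F -> smin <= s j) ->
  Phi G F s g0 K 0 set0 <= (2 * #|F|)%:R * expR (- (g0 ^+ 2 / 4 * smin)).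
Proof.
move=> g00 hs; rewrite mulnC natrM -mulrA mulr_natl -sumr_const; apply: ler_sum => j jF.
have h sg : expR (rate g0 * deviation G s g0 K sg 0 set0 j) <= expR (- (g0 ^+ 2 / 4 * smin)).
  rewrite ler_expR /deviation dens0 expr1n mul1r subrr mulr0 /tol invr1 expr1n /rate.
  have : g0 ^+ 2 / 4 * smin <= g0 ^+ 2 / 4 * s j.
    by rewrite ler_wpM2l ?hs // divr_ge0 // sqr_ge0.
  by rewrite expr2; lra.
by rewrite mulr_natl mulr2n lerD.
Qed.

Section Numerics2.
Variable R : realType.
Variables (m w E X p g : R) (K : nat).
Hypothesis K200 : (200 <= K)%N.
Hypothesis p01 : 0 < p <= 1.
Hypothesis g_gt0 : 0 < g.
Hypothesis m_ge1 : 1 <= m.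
Hypothesis gap : p ^+ 4 * m / (2 * (10 * 10 * 10)) <= p * m - w <= p ^+ 4 * m / (10 * 10 * 10).
Hypothesis g_small : g * (3 * (10 * 10)) <= p * (p ^+ 3 / (5 * (10 * 10 * 10))) ^+ K.
Hypothesis g_big : (10 * 10 * 10) * (10 * 10 * 10) * (10 * 10 * 10) <= g * (p ^+ 8 * m).
Hypothesis E_dev : `|E - 2 * m * (p * m)| <= 3 * g * (2 * m * (p * m)).
Hypothesis X_dev : `|X - m * (p * m)| <= 2 * g * (m * (p * m)).
Notation p' := ((X - m * w) / E).
Notation f := ((X / m - w) / 2).

(** The exponent [K] in [g_small] is weakened to 2, which already makes [g] negligible against every
    power of [p] occurring in the estimates below. *)
Lemma g_le_p7 : g * ((10 * 10 * 10) * (10 * 10 * 10) * (10 * 10 * 10)) <= p ^+ 7.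
Proof.
have /andP[p0 p1] := p01.
pose y : R := p ^+ 3 / (5 * (10 * 10 * 10)); have g_small' := g_small; rewrite -/y in g_small'.
have y0 : 0 <= y by rewrite divr_ge0 ?exprn_ge0 //; [exact: ltW|lra].
have y1 : y <= 1.
  rewrite /y ler_pdivrMr ?mul1r; last by lra.
  have : p ^+ 3 <= 1 by rewrite exprn_ile1 // ltW.
  by lra.
have yK : y ^+ K <= y ^+ 2.
  have -> : K = (2 + (K - 2))%N by rewrite subnKC // (leq_trans _ K200).
  by rewrite exprD ler_piMr ?exprn_ge0 // exprn_ile1.
have h : g * (3 * (10 * 10)) <= p * y ^+ 2.
  by apply: le_trans g_small' _; rewrite ler_pM2l.
have e : p * y ^+ 2 = p ^+ 7 / ((5 * (10 * 10 * 10)) * (5 * (10 * 10 * 10))).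
  by rewrite /y; field.
have P7 : 0 <= p ^+ 7 by rewrite exprn_ge0 // ltW.
move: h P7; rewrite e; move: (p ^+ 7); move=> P h P7; lra.
Qed.

Lemma pow_facts : [/\ p ^+ 8 * m <= p ^+ 6 * m, p ^+ 8 * m <= p ^+ 4 * m, p ^+ 8 * m <= p * m & 0 < p ^+ 8 * m].
Proof.
have /andP[p0 p1] := p01; have m0 : 0 < m := lt_le_trans ltr01 m_ge1.
have process_state a b : (a <= b)%N -> p ^+ b * m <= p ^+ a * m.
  move=> ab; rewrite ler_pM2r //.
  by rewrite -(subnKC ab) exprD ler_piMr ?exprn_ge0 ?exprn_ile1 //; apply: ltW.
have := process_state 1 8 isT; rewrite expr1 => h.
by split=> //; [exact: process_state|exact: process_state|rewrite mulr_gt0 ?exprn_gt0].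
Qed.

Lemma g_tiny : g * ((10 * 10 * 10) * (10 * 10 * 10) * (10 * 10 * 10)) <= 1.
Proof.
have /andP[p0 p1] := p01; apply: le_trans g_le_p7 _.
by rewrite exprn_ile1 // ltW.
Qed.

Lemma gpm : g * (p * m) * ((10 * 10 * 10) * (10 * 10 * 10) * (10 * 10 * 10)) <= p ^+ 8 * m.
Proof.
have /andP[p0 p1] := p01; have m0 : 0 < m := lt_le_trans ltr01 m_ge1.
have -> : p ^+ 8 * m = p ^+ 7 * (p * m) by ring.
rewrite mulrAC ler_pM2r ?mulr_gt0 //; exact: g_le_p7.
Qed.

Lemma f_bounds : p ^+ 4 * m / (41 * (10 * 10)) <= f <= p ^+ 4 * m / (19 * (10 * 10)).
Proof.
have m0 : 0 < m := lt_le_trans ltr01 m_ge1.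
have h : `|X / m - p * m| <= 2 * (g * (p * m)).
  have e : X - m * (p * m) = (X / m - p * m) * m by field; rewrite gt_eqF.
  have := X_dev; rewrite e normrM (gtr0_norm m0) => h; rewrite -(ler_pM2r m0).
  by move: h; lra.
have gp := gpm; have [_ h4 _ h0] := pow_facts.
move: h gp h4 h0 gap; rewrite ler_distl.
move: (g * (p * m)) (p ^+ 8 * m) (p ^+ 4 * m) (X / m) (p * m); move=> a b c d e.
by move=> /andP[h1 h2] h3 h4 h5 /andP[h6 h7]; apply/andP; split; lra.
Qed.

Lemma E_bounds : [/\ 0 < E, 2 * m * (p * m) * (1 - 3 * g) <= E & E <= 2 * m * (p * m) * (1 + 3 * g)].
Proof.
have /andP[p0 p1] := p01; have m0 : 0 < m := lt_le_trans ltr01 m_ge1.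
have e0 : 0 < 2 * m * (p * m) by rewrite !mulr_gt0.
have gt := g_tiny.
have h3 : 3 * g * (2 * m * (p * m)) <= 2^-1 * (2 * m * (p * m)) by rewrite ler_pM2r //; lra.
by move: E_dev; rewrite ler_distl => /andP[h1 h2]; split; lra.
Qed.

(** Both sides equal [X - m * w], the number of ordered inside pairs that must be left: [p'] is the
    density at which the second phase stops, and [f] the resulting mean inside degree. *)
Lemma f_eq : p' * E = 2 * m * f.
Proof.
have [E0 _ _] := E_bounds; have m0 : 0 < m := lt_le_trans ltr01 m_ge1.
by field; rewrite !gt_eqF.
Qed.

Lemma f_gt : [/\ 0 < f, f * (10 * 10 * 10) <= p ^+ 4 * m & 10 * 10 <= f].
Proof.
have [_ h4 _ h0] := pow_facts; have gt := g_tiny; have gb := g_big.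
have : g * (p ^+ 8 * m) <= 1 * (p ^+ 8 * m).
  by rewrite ler_pM2r //; lra.
move: f_bounds h4 h0 gb; move: f (p ^+ 4 * m) (g * (p ^+ 8 * m)) (p ^+ 8 * m).
move=> F a b c /andP[h1 h2] h4 h0 gb h5; split; lra.
Qed.

Lemma p'_f : [/\ 0 < p', (1 - 3 * g) * (p' * (p * m)) <= f, f <= (1 + 3 * g) * (p' * (p * m))
   & p ^+ 3 / (5 * (10 * 10 * 10)) <= p'].
Proof.
have /andP[p0 p1] := p01; have m0 : 0 < m := lt_le_trans ltr01 m_ge1.
have [E0 E1 E2] := E_bounds; have [f0 _ _] := f_gt; have gt := g_tiny.
have fe := f_eq; have fb := f_bounds.
have q0 : 0 < p' by rewrite -(pmulr_lgt0 _ E0) fe; apply: mulr_gt0 => //; apply: mulr_gt0.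
have m20 : 0 < 2 * m by lra.
have a1 : (1 - 3 * g) * (p' * (p * m)) <= f.
  rewrite -(ler_pM2l m20) -fe.
  have -> : 2 * m * ((1 - 3 * g) * (p' * (p * m))) = p' * (2 * m * (p * m) * (1 - 3 * g)) by ring.
  by rewrite ler_pM2l.
have a2 : f <= (1 + 3 * g) * (p' * (p * m)).
  rewrite -(ler_pM2l m20) -fe.
  have -> : 2 * m * ((1 + 3 * g) * (p' * (p * m))) = p' * (2 * m * (p * m) * (1 + 3 * g)) by ring.
  by rewrite ler_pM2l.
split=> //.
have pm0 : 0 < p * m by rewrite mulr_gt0.
rewrite -(ler_pM2r pm0).
have -> : p ^+ 3 / (5 * (10 * 10 * 10)) * (p * m) = p ^+ 4 * m / (5 * (10 * 10 * 10)).
  by field.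
have z0 : 0 < p' * (p * m) by rewrite mulr_gt0.
have z1 : 3 * g * (p' * (p * m)) <= 3 / (10 * 10) * (p' * (p * m)) by rewrite ler_pM2r //; lra.
case/andP: fb => fb _.
have p4 : 0 < p ^+ 4 * m by rewrite mulr_gt0 ?exprn_gt0.
move: a2 fb z0 z1 p4; move: f (p ^+ 4 * m) (p' * (p * m)); move=> F a z *; lra.
Qed.

(** This dictates the form of [g_small]: the stopping density [p'] is only bounded below by a
    multiple of [p ^ 3], and the tolerance has grown by the power [K] of its inverse. *)
Lemma tol2 : 3 * g * (p'^-1) ^+ K <= p / (10 * 10).
Proof.
have /andP[p0 p1] := p01; have [q0 _ _ q1] := p'_f.
have r0 : 0 < p ^+ 3 / (5 * (10 * 10 * 10)) by rewrite divr_gt0 ?exprn_gt0 //; lra.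
have h : (p ^+ 3 / (5 * (10 * 10 * 10))) ^+ K <= p' ^+ K by rewrite lerXn2r // nnegrE ltW.
rewrite exprVn ler_pdivrMr ?exprn_gt0 //.
have : p * (p ^+ 3 / (5 * (10 * 10 * 10))) ^+ K <= p * p' ^+ K by rewrite ler_pM2l.
move: g_small; move: (_ ^+ K) (p' ^+ K) => a b; lra.
Qed.

Lemma step2 : 8 * (6 / E) <= 3 * g * p'.
Proof.
have /andP[p0 p1] := p01; have m0 : 0 < m := lt_le_trans ltr01 m_ge1.
have [E0 E1 E2] := E_bounds; have [q0 _ _ q1] := p'_f.
rewrite mulrA ler_pdivrMr // -[3 * g * _ * _]mulrA f_eq.
have [_ _ f3] := f_gt.
have gm : (10 * 10) <= g * m.
  have gb := g_big.
  have : g * (p ^+ 8 * m) <= g * m.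
    by rewrite ler_pM2l // ler_piMl ?exprn_ile1 //; apply: ltW.
  by move: gb; move: (g * _) (g * m) => a b; lra.
have : 1 * (10 * 10) <= (g * m) * f by apply: ler_pM => //; lra.
by lra.
Qed.

Lemma D2_big : 16 <= 3 * g * (p' ^+ 2 * (p ^+ 2 * m)).
Proof.
have /andP[p0 p1] := p01; have m0 : 0 < m := lt_le_trans ltr01 m_ge1.
have [q0 _ _ q1] := p'_f.
have r0 : 0 < p ^+ 3 / (5 * (10 * 10 * 10)) by rewrite divr_gt0 ?exprn_gt0 //; lra.
have h : (p ^+ 3 / (5 * (10 * 10 * 10))) ^+ 2 * (p ^+ 2 * m) <= p' ^+ 2 * (p ^+ 2 * m).
  by rewrite ler_pM2r ?mulr_gt0 ?exprn_gt0 // lerXn2r // nnegrE ltW.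
have : g * ((p ^+ 3 / (5 * (10 * 10 * 10))) ^+ 2 * (p ^+ 2 * m)) <= g * (p' ^+ 2 * (p ^+ 2 * m)).
  by rewrite ler_pM2l.
have -> : g * ((p ^+ 3 / (5 * (10 * 10 * 10))) ^+ 2 * (p ^+ 2 * m)) =
  g * (p ^+ 8 * m) / ((5 * (10 * 10 * 10)) * (5 * (10 * 10 * 10))) by field.
move: g_big; move: (g * (p ^+ 8 * m)) (p' ^+ 2 * (p ^+ 2 * m)); move=> a b h1 h2; lra.
Qed.

Lemma quasi_num_facts fN : fN = Num.truncn f ->
  forall mN : nat, m = mN%:R -> quasi_numerics mN fN p f (2 * g).
Proof.
move=> -> mN em; have [f0 f1 f2] := f_gt; have gt := g_tiny; have gp := gpm.
have /andP[t1 t2] := truncn_itv (ltW f0).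
have [p6 p4 _ p8] := pow_facts; have gb := g_big; have fb := f_bounds.
split=> //; rewrite -?em.
- by have g0 := g_gt0; move: g0 gt; move: g => a; lra.
- move: gp p4 fb p8; rewrite -[2 * g * _]mulrA; move: (g * (p * m)) (p ^+ 8 * m) (p ^+ 4 * m) f.
  by move=> a b c F h1 h2 /andP[h3 _] h4; lra.
split=> //; first by rewrite t1 natr1.
have : g * (p ^+ 8 * m) <= 1 * (p ^+ 8 * m) by rewrite ler_pM2r //; lra.
move: gb p6; move: (g * (p ^+ 8 * m)) (p ^+ 8 * m) (p ^+ 6 * m); move=> a b c; lra.
Qed.

End Numerics2.

Lemma sum_dev (R : realType) (T : finType) (U : {set T}) (a : T -> R) (c d : R) :
  (forall v, v \in U -> `|a v - c| <= d) ->
  `|\sum_(v in U) a v - #|U|%:R * c| <= #|U|%:R * d.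
Proof.
move=> h; have e (b : R) : #|U|%:R * b = \sum_(v in U) b by rewrite sumr_const mulr_natl.
by rewrite !e -sumrB; apply: le_trans (ler_norm_sum _ _ _) _; apply: ler_sum.
Qed.

Lemma cnbr1 (V : finType) (G : rel V) v (S : {set V}) :
  cnbr G [set v] S = [set z in S | G v z].
Proof.
apply/setP=> z; rewrite !inE; congr andb; apply/forall_inP/idP => [|h x /set1P->//].
by apply; rewrite set11.
Qed.

Lemma cov_packing (V : finType) (G : rel V) Q x y : packing G Q -> x != y -> cov Q x y -> G x y.
Proof.
move=> /packingP[s _] xy /existsP[e /and3P[eQ xe ye]].
by have /triP[_ h] := subsetP s e eQ; apply: h.
Qed.

Lemma predn_mul n : (n * n.-1 = n * n - n)%N.
Proof. by case: n => // k; rewrite /= mulnS addKn. Qed.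

Lemma steps_arith (t P e x a b c : nat) : (a + e + 6 * P = 2 * (a - c) + x)%N -> (c <= a)%N ->
  (a + b = 6 * t + 2 * c)%N -> (x <= e + b)%N -> (6 * (t - P) + x = e + b)%N.
Proof. lia. Qed.

Lemma quad_arith n : (1 <= n)%N -> (n * n + n * n.+1 <= 3 * n ^ 2)%N.
Proof. by move=> h; rewrite !mulnS -mulnn; have : (n <= n * n)%N; [rewrite leq_pmulr|lia]. Qed.

Lemma leg_arith a b x e c : (a + 6 * b = e -> 6 * b + x = e + c -> a + c = x)%N.
Proof. lia. Qed.

Section Phase2.
Variables (R : realType) (V : finType) (U1 U2 W : {set V}) (Q1 : {set {set V}}).
Variables (m j K t : nat) (p g : R).
Notation X := (fun u x => ~~ cov Q1 u x).
Notation M := (m%:R : R).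
Notation w := ((3 ^ j)%:R : R).
Notation G := (ingraph Q1 U1 U2).

(** The factor 3 in place of 2 absorbs the one or two excluded points. The last clause provides the
    initial value for tracking the inside neighbours of [u] that are joined to a point [y] of the
    other side. *)
Definition phase1_side (U B : {set V}) :=
  [/\ forall Z : {set V}, Z \subset U -> (0 < #|Z| <= 4)%N ->
        `|#|cnbr X Z B|%:R - p ^+ #|Z| * M| <= 2 * g * (p ^+ #|Z| * M),
      forall v, v \in U -> `|#|[set z in U | (z != v) && X v z]|%:R - p * M| <= 3 * g * (p * M),
      forall x y, x \in U -> y \in U -> x != y ->
        `|#|[set z in U | [&& z != x, z != y, X x z & X y z]]|%:R - p ^+ 2 * M| <= 3 * g * (p ^+ 2 * M) &
      forall u y, u \in U -> y \in B ->
        `|#|[set z in U | [&& z != u, X u z & X y z]]|%:R - p ^+ 2 * M| <= 3 * g * (p ^+ 2 * M)].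

Hypothesis d12 : [disjoint U1 & U2].
Hypothesis eW : W = ~: (U1 :|: U2).
Hypothesis cW : #|W| = (3 ^ j)%N.
Hypothesis c1 : #|U1| = m.
Hypothesis c2 : #|U2| = m.
Hypothesis t1 : triples Q1.
Hypothesis l1 : linsys Q1.
Hypothesis QU : forall e, e \in Q1 -> e \subset U1 :|: U2.
Hypothesis side1 : phase1_side U1 U2.
Hypothesis side2 : phase1_side U2 U1.
Hypothesis div6 : (m * m + m * 3 ^ j = 6 * t + 2 * m)%N.

Hypothesis K200 : (200 <= K)%N.
Hypothesis p01 : 0 < p <= 1.
Hypothesis g_gt0 : 0 < g.
Hypothesis m_ge1 : 1 <= M.
Hypothesis gap : p ^+ 4 * M / (2 * (10 * 10 * 10)) <= p * M - w <= p ^+ 4 * M / (10 * 10 * 10).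
Hypothesis g_small : g * (3 * (10 * 10)) <= p * (p ^+ 3 / (5 * (10 * 10 * 10))) ^+ K.
Hypothesis g_big : (10 * 10 * 10) * (10 * 10 * 10) * (10 * 10 * 10) <= g * (p ^+ 8 * M).
Hypothesis V13 : (13 <= #|V|)%N.
Hypothesis exp_big : #|V|%:R ^+ 5 <= expR (g ^+ 2 / 4 * (p ^+ 2 * M)).

Lemma ingraph1 a z : a \in U1 -> G a z = [&& z \in U1, z != a & X a z].
Proof. by move=> aU; rewrite /ingraph same1 // eq_sym andbCA. Qed.

Lemma ingraph2 a z : a \in U2 -> G a z = [&& z \in U2, z != a & X a z].
Proof. by move=> aU; rewrite /ingraph same2 // eq_sym andbCA. Qed.

Definition good_side (U B : {set V}) := phase1_side U B /\
  forall a z, a \in U -> G a z = [&& z \in U, z != a & X a z].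

Lemma side_of x : x \in U1 :|: U2 -> exists U B : {set V}, x \in U /\ good_side U B.
Proof.
rewrite in_setU => /orP[xU|xU].
  by exists U1, U2; split=> //; split=> // *; apply: ingraph1.
by exists U2, U1; split=> //; split=> // *; apply: ingraph2.
Qed.

Lemma G_in x y : G x y -> x \in U1 :|: U2.
Proof. by move=> /and3P[_ /orP[] /andP[h _] _]; rewrite in_setU h ?orbT. Qed.

Lemma sum_sides (a : V -> nat) : (\sum_(v in U1 :|: U2) a v = \sum_(v in U1) a v + \sum_(v in U2) a v)%N.
Proof. by rewrite -bigU //=; apply: eq_bigl => x; rewrite !inE. Qed.

Lemma ecountG : (ecount G = \sum_(v in U1) #|[set z in U1 | (z != v) && X v z]| +
   \sum_(v in U2) #|[set z in U2 | (z != v) && X v z]|)%N.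
Proof.
have -> : ecount G = (\sum_(v in U1 :|: U2) #|[set z | G v z]|)%N.
  under eq_bigr => u _ do rewrite -sum1_card.
  rewrite pair_big_dep /= sum1_card; apply: eq_card => xy; rewrite !inE /= [in RHS]unfold_in inE.
  by case h: (G _ _); rewrite ?andbF // (G_in h).
rewrite sum_sides; congr addn; apply: eq_bigr => v vU; apply: eq_card => z; rewrite !inE.
  exact: ingraph1.
exact: ingraph2.
Qed.

Notation E := ((ecount G)%:R : R).
Definition crossn := (\sum_(u in U1) #|[set x in U2 | X u x]|)%N.
Notation X0 := (crossn%:R : R).

Lemma ecountG_dev : `|E - 2 * M * (p * M)| <= 3 * g * (2 * M * (p * M)).
Proof.
have [_ h1 _ _] := side1; have [_ h2 _ _] := side2.
have := sum_dev h1; have := sum_dev h2; rewrite c1 c2 -!natr_sum.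
rewrite ecountG natrD; move: (\sum_(v in U1) _)%N (\sum_(v in U2) _)%N => a b.
rewrite !ler_distl; move: (a%:R) (b%:R) => a' b' /andP[? ?] /andP[? ?].
by apply/andP; split; lra.
Qed.

Lemma crossn_dev : `|X0 - M * (p * M)| <= 2 * g * (M * (p * M)).
Proof.
have [h _ _ _] := side1.
have h1 v : v \in U1 -> `|#|[set x in U2 | X v x]|%:R - p * M| <= 2 * g * (p * M).
  move=> vU; have := h [set v]; rewrite cards1 sub1set expr1 cnbr1; exact.
have := sum_dev h1; rewrite c1 -natr_sum -/crossn.
by rewrite [M * (2 * g * _)]mulrCA.
Qed.

(* Stopping when [ecount + m * w = crossn] makes the total number of apexes
   equal to the number of uncovered pairs inside the sides. *)
Lemma steps_exist : exists M2, (6 * M2 + crossn = ecount G + m * 3 ^ j)%N.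
Proof.
have [P hP] := inside_cross_identity t1 l1 d12 QU c1 c2.
have : (crossn <= ecount G + m * 3 ^ j)%N.
  rewrite -(ler_nat R) natrD; apply: ler_wpDr; first exact: ler0n.
  have [h0 h1 _] := E_bounds K200 p01 m_ge1 g_small ecountG_dev.
  have := crossn_dev; rewrite ler_distl => /andP[_ h2].
  have gt := g_tiny K200 p01 g_small.
  have mp : 0 < M * (p * M).
    have /andP[p0 _] := p01; have m0 := lt_le_trans ltr01 m_ge1; by rewrite !mulr_gt0.
  have h3 : g * (M * (p * M)) <= 10^-1 * (M * (p * M)) by rewrite ler_pM2r //; lra.
  by move: h1 h2 h3 mp; lra.
have dv := div6; move: hP; rewrite -/crossn.
have -> : (m * m.-1 = m * m - m)%N by exact: predn_mul.
have : (m <= m * m)%N by case: (m) => // k; rewrite leq_pmull.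
move: dv; move: (ecount _) crossn (m * m)%N (m * 3 ^ j)%N => e x a b h2 h1 h4 h3.
(* With [P] from the counting identity, [div6] makes the required number of steps the integer
   [t - P]. *)
by exists (t - P)%N; apply: steps_arith h4 h1 h2 h3.
Qed.

Notation g3 := (3 * g).
Notation p' := ((X0 - M * w) / E).
Notation f := ((X0 / M - w) / 2).
Definition uncovered_nbrs y : {set V} := [set z | ~~ cov Q1 y z].
(** Edges with the full set give the codegrees that drive the process. Single points give inside
    degrees for [None], and for [Some y] the inside degrees restricted to points not yet joined to
    [y] by a block, as the last clause of [quasi_side] requires. *)
Definition tracked_inside : {set {set V} * {set V}} :=
  [set ([set xy.1; xy.2], [set: V]) | xy in [set xy : V * V | G xy.1 xy.2]] :|:
  [set ([set vo.1], if vo.2 is Some y then uncovered_nbrs y else [set: V]) |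
     vo in setX (U1 :|: U2) [set: option V]].
(** Degrees restricted to [uncovered_nbrs y] are of order [p ^ 2 * m] but are measured at scale
    [p * m]; the final tolerance is therefore required to be at most [p / 100], not merely a small
    constant. *)
Definition scale_inside (i : {set V} * {set V}) : R := if #|i.1| == 1 then p * M else p ^+ 2 * M.

Lemma tracked_inside_card : (#|tracked_inside| <= 3 * #|V| ^ 2)%N.
Proof.
have h1 : (#|[set xy : V * V | G xy.1 xy.2]| <= #|V| * #|V|)%N by rewrite -card_prod; apply: max_card.
have h2 : (#|setX (U1 :|: U2) [set: option V]| <= #|V| * (#|V|).+1)%N.
  by rewrite cardsX cardsT card_option leq_mul // max_card.
apply: leq_trans (leq_card_setU _ _).1 _.
apply: leq_trans (leq_add (leq_imset_card _ _) (leq_imset_card _ _)) _.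
by apply: leq_trans (leq_add h1 h2) _; apply: quad_arith; apply: leq_trans V13.
Qed.

Lemma pm_gt0 : 0 < p * M /\ 0 < p ^+ 2 * M.
Proof.
have /andP[p0 _] := p01; have m0 := lt_le_trans ltr01 m_ge1.
by rewrite !mulr_gt0 ?exprn_gt0.
Qed.

Lemma g_le1 : g <= (10 * 10)^-1.
Proof. have := g_tiny K200 p01 g_small; lra. Qed.

Lemma scale_inside_ge i : p ^+ 2 * M <= scale_inside i.
Proof.
rewrite /scale_inside; case: ifP => // _; have [h1 h2] := pm_gt0; have /andP[p0 p1] := p01.
by rewrite expr2 -mulrA ler_piMl // ltW.
Qed.

Lemma trk0E (Z S : {set V}) : tracked_count R G set0 (Z, S) = #|cnbr G Z S|%:R.
Proof.
rewrite /tracked_count /=; congr _%:R; apply: eq_card => x; rewrite !inE; congr andb.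
by apply: eq_forallb_in => z _; rewrite unc0.
Qed.

Lemma codegG x y : G x y -> `|(codeg G x y)%:R - p ^+ 2 * M| <= g3 * (p ^+ 2 * M).
Proof.
move=> gxy; have [U [B [xU [[_ _ h _] hG]]]] := side_of (G_in gxy).
have := gxy; rewrite hG // => /and3P[yU yx _].
have xy : x != y by rewrite eq_sym.
have := h x y xU yU xy; congr (`| _%:R - _ | <= _).
apply: eq_card => z; rewrite cnbr2E !hG // !inE.
by case: (z \in U); case: (z != x); case: (z != y); rewrite ?andbF.
Qed.

Lemma degG v (S : {set V}) : v \in U1 :|: U2 -> (#|cnbr G [set v] S|%:R : R) <= 2 * (p * M).
Proof.
move=> /side_of[U [B [vU [[_ h _ _] hG]]]].
have := h v vU; rewrite ler_distl => /andP[_ h2].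
apply: (@le_trans _ _ #|[set z in U | (z != v) && X v z]|%:R).
  rewrite ler_nat cnbr1; apply: subset_leq_card; apply/subsetP=> z; rewrite !inE => /andP[_].
  by rewrite hG.
apply: le_trans h2 _; have [pm _] := pm_gt0.
have : g3 * (p * M) <= 1 * (p * M) by rewrite ler_pM2r //; have := g_le1; lra.
by lra.
Qed.

Lemma tracked_inside_ok i : i \in tracked_inside -> [/\ (0 < #|i.1| <= 4)%N, 0 < scale_inside i & tracked_count R G set0 i <= 2 * scale_inside i].
Proof.
move=> iF; have [pm1 pm2] := pm_gt0.
have sp : 0 < scale_inside i by apply: lt_le_trans (scale_inside_ge i).
move: iF; rewrite in_setU => /orP[/imsetP[[x y]]|/imsetP[[v o]]].
  rewrite inE /= => gxy ei; have xy := G_neq (ingraph_irr Q1 U1 U2) gxy.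
  split=> //; rewrite ei /= ?cards2 ?xy //.
  rewrite trk0E -/(codeg _ _ _) /scale_inside /= cards2 xy /=.
  have := codegG gxy; rewrite ler_distl => /andP[_ h].
  have : g3 * (p ^+ 2 * M) <= 1 * (p ^+ 2 * M) by rewrite ler_pM2r //; have := g_le1; lra.
  by lra.
rewrite in_setX => /andP[/= vU _] ei; split=> //; rewrite ei /= ?cards1 //.
by rewrite trk0E /scale_inside /= cards1 eqxx; apply: degG.
Qed.

Lemma tracked_inside_edge x y : G x y -> [/\ ([set x; y], [set: V]) \in tracked_inside,
  scale_inside ([set x; y], [set: V]) = p ^+ 2 * M &
  `|tracked_count R G set0 ([set x; y], [set: V]) - p ^+ 2 * M| <= g3 * (p ^+ 2 * M)].
Proof.
move=> gxy; have xy := G_neq (ingraph_irr Q1 U1 U2) gxy; split.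
- by rewrite in_setU; apply/orP; left; apply/imsetP; exists (x, y); rewrite ?inE.
- by rewrite /scale_inside /= cards2 xy.
by rewrite trk0E; apply: codegG.
Qed.

Lemma Phi_inside_lt1 : Phi G tracked_inside scale_inside g3 K 0 set0 < 1.
Proof.
have g30 : 0 < g3 by rewrite mulr_gt0.
apply: le_lt_trans (Phi_init G K g30 (fun j _ => scale_inside_ge j)) _.
have n0 : 0 < #|V|%:R :> R by rewrite ltr0n (leq_trans _ V13).
have h1 : #|V|%:R ^+ 5 <= expR (g3 ^+ 2 / 4 * (p ^+ 2 * M)).
  apply: le_trans exp_big _; rewrite ler_expR ler_pM2r; last by case: pm_gt0.
  rewrite exprMn; have := sqr_ge0 g; move: (g ^+ 2) => a a0; lra.
have e0 := expR_gt0 (g3 ^+ 2 / 4 * (p ^+ 2 * M)).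
rewrite expRN -ltr_pdivlMr ?invr_gt0 // invrK mul1r; apply: lt_le_trans h1.
rewrite -natrX ltr_nat; apply: (@leq_ltn_trans (2 * (3 * #|V| ^ 2))); first by rewrite leq_mul2l tracked_inside_card.
rewrite mulnA (expnD _ 3 2) ltn_pmul2r ?expn_gt0 ?(leq_trans _ V13) //.
by apply: (@leq_trans (13 ^ 3)) => //; rewrite leq_exp2r.
Qed.

Lemma phase2_extend : exists M2 (Q2 : {set {set V}}),
  [/\ packing G Q2, (ecount (unc G Q2) + m * 3 ^ j = crossn)%N, dens R G M2 = p' &
      Phi G tracked_inside scale_inside g3 K M2 Q2 < 1].
Proof.
have [M2 hM] := steps_exist; exists M2.
have [E0 _ _] := E_bounds K200 p01 m_ge1 g_small ecountG_dev.
have dE : dens R G M2 = p'.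
  have : (6 * M2 + crossn)%:R = (ecount G + m * 3 ^ j)%:R :> R by rewrite hM.
  rewrite /dens /stepsz !natrD !natrM => e.
  have -> : X0 = E + M * w - 6 * M2%:R by rewrite -e; ring.
  by field; rewrite gt_eqF.
have g30 : 0 < g3 by rewrite mulr_gt0.
have [p0 _ _ p3] := p'_f K200 p01 m_ge1 gap g_small g_big ecountG_dev crossn_dev.
have [] := @process_extend R V G (@ingraph_sym _ Q1 U1 U2) (@ingraph_irr _ Q1 U1 U2) tracked_inside scale_inside
   (p ^+ 2 * M) g3 K K200 g30 pm_gt0.2 tracked_inside_ok tracked_inside_edge M2 _ _ _ _ _ 0 set0 _ _ _ => //.
- by rewrite -(ltr_nat R).
- by rewrite dE.
- rewrite dE; exact: (step2 K200 p01 g_gt0 m_ge1 gap g_small g_big ecountG_dev crossn_dev).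
- rewrite dE /tol; apply: le_trans (tol2 K200 p01 m_ge1 gap g_small g_big ecountG_dev crossn_dev) _.
  by have /andP[_ p1] := p01; move: p1; lra.
- rewrite dE; exact: (D2_big K200 p01 g_gt0 m_ge1 gap g_small g_big ecountG_dev crossn_dev).
- exact: process_state0.
- exact: Phi_inside_lt1.
move=> Q2 [_ [pk _ leg] ph]; exists Q2; split=> //.
by move: leg; rewrite /legal => /eqP leg; apply: leg_arith leg hM.
Qed.

Section Final.
Variables (M2 : nat) (Q2 : {set {set V}}).
Hypothesis pk : packing G Q2.
Hypothesis leg2 : (ecount (unc G Q2) + m * 3 ^ j = crossn)%N.
Hypothesis dM2 : dens R G M2 = p'.
Hypothesis Phi2 : Phi G tracked_inside scale_inside g3 K M2 Q2 < 1.

Lemma cov_Q2 x y : x != y -> ~~ G x y -> cov (Q1 :|: Q2) x y = cov Q1 x y.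
Proof.
move=> xy ng; rewrite cov_setU; case: (cov Q1 x y) => //=.
by apply: contraNF ng => h; apply: cov_packing pk xy h.
Qed.

Lemma unc_G2 x y : G x y -> unc G Q2 x y = ~~ cov (Q1 :|: Q2) x y.
Proof. by rewrite /unc cov_setU negb_or => h; rewrite h; case/and3P: h => _ _ ->. Qed.

Lemma p'_facts : [/\ 0 < p', (1 - 3 * g) * (p' * (p * M)) <= f, f <= (1 + 3 * g) * (p' * (p * M)) &
   g3 * (p'^-1) ^+ K <= p / (10 * 10)].
Proof.
have [h1 h2 h3 _] := p'_f K200 p01 m_ge1 gap g_small g_big ecountG_dev crossn_dev.
split=> //; exact: (tol2 K200 p01 m_ge1 gap g_small g_big ecountG_dev crossn_dev).
Qed.

Lemma single_dev v o S : v \in U1 :|: U2 -> S = (if o is Some y then uncovered_nbrs y else [set: V]) ->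
  `|#|[set z in S | unc G Q2 v z]|%:R - p' * #|[set z in S | G v z]|%:R| <= p / (10 * 10) * (p' * (p * M)).
Proof.
move=> vU eS; have [q0 _ _ tl] := p'_facts.
have iF : ([set v], S) \in tracked_inside.
  by rewrite in_setU; apply/orP; right; apply/imsetP; exists (v, o); rewrite ?eS // in_setX vU inE.
have g30 : 0 < g3 by rewrite mulr_gt0.
have := tracked_count_dev g30 Phi2 iF; rewrite /= cards1 !expr1 dM2 /scale_inside /= cards1 eqxx trk0E /tracked_count /= !cnbr1.
move=> h; apply: le_trans h _; rewrite /tol -mulrA ler_pM2r //.
by rewrite mulr_gt0 //; case: pm_gt0.
Qed.

(** The second phase uses triples within a side only, so cross pairs are untouched and the first
    clause is inherited from the first phase. Inside degrees are multiplied by [p'] up to the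
    tolerance. *)
Lemma final_side U B : good_side U B -> U \subset U1 :|: U2 -> [disjoint U & B] ->
  quasi_side (Q1 :|: Q2) m p f (2 * g) U B.
Proof.
move=> [[a1 a2 a3 a4] hG] UU dUB.
have cross u x : u \in U -> x \in B -> cov (Q1 :|: Q2) u x = cov Q1 u x.
  move=> uU xB; have xU : x \notin U by rewrite (disjointFl dUB xB).
  apply: cov_Q2; first by apply: contraNneq xU => <-.
  by rewrite hG // (negbTE xU).
have [q0 f1 f2 tl] := p'_facts; have [pm1 pm2] := pm_gt0; have /andP[p0 p1] := p01.
have gl := g_le1.
have gq : 0 < p' * (p * M) by rewrite mulr_gt0.
have ggq : g * (p' * (p * M)) <= (10 * 10 * 10)^-1 * (p' * (p * M)).
  by rewrite ler_pM2r //; have := g_tiny K200 p01 g_small; lra.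
split.
- move=> Z ZU cZ; have := a1 Z ZU cZ; congr (`| _%:R - _| <= _).
  apply: eq_card => x; rewrite !inE; case xB: (x \in B) => //=.
  by apply: eq_forallb_in => z zZ; rewrite cross // (subsetP ZU).
- move=> v vU; have vU' := subsetP UU v vU; rewrite -inside_at //.
  have := @single_dev v None _ vU' erefl.
  have := a2 v vU.
  have -> : #|[set z in U | (z != v) && X v z]| = #|[set z in [set: V] | G v z]|.
    by apply: eq_card => z; rewrite !inE hG.
  have -> : inbr (Q1 :|: Q2) U v = #|[set z in [set: V] | unc G Q2 v z]|.
    apply: eq_card => z; rewrite !inE.
    have [gv|gv] := boolP (G v z); first by rewrite unc_G2 //; move: gv; rewrite hG // => /and3P[-> -> _].
    rewrite /unc (negbTE gv) /=; move: gv; rewrite hG // cov_setU negb_or.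
    by case: (z \in U); case: (z != v); case: (cov Q1 v z).
  move: (#|_|%:R) => d0; move: (#|_|%:R) => d1.
  rewrite !ler_distl => /andP[h1 h2] /andP[h3 h4].
  have b1 : p' * (p * M - g3 * (p * M)) <= p' * d0 by rewrite ler_pM2l.
  have b2 : p' * d0 <= p' * (p * M + g3 * (p * M)) by rewrite ler_pM2l.
  have b3 : p / (10 * 10) * (p' * (p * M)) <= 1 / (10 * 10) * (p' * (p * M)).
    by rewrite ler_pM2r // ler_pM2r // invr_gt0; lra.
  move: b1 b2 b3 f1 f2 h3 h4 gq ggq; rewrite mulrBr mulrDr [p' * (g3 * _)]mulrCA.
  move: f (p' * (p * M)) (p' * d0) (p / _ * _) => F y y0 z *.
  by apply/andP; split; lra.
move=> u y uU yB nc; have uU' := subsetP UU u uU.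
have := @single_dev u (Some y) _ uU' erefl.
have := a4 u y uU yB.
have -> : #|[set z in U | [&& z != u, X u z & X y z]]| = #|[set z in uncovered_nbrs y | G u z]|.
  apply: eq_card => z; rewrite !inE hG //.
  by case: (z \in U); case: (z != u); case: (cov Q1 u z); case: (cov Q1 y z).
have -> : #|[set z in uncovered_nbrs y | unc G Q2 u z]| =
   #|[set v in U | [&& v != u, ~~ cov (Q1 :|: Q2) u v & ~~ cov (Q1 :|: Q2) v y]]|.
  apply: eq_card => z; rewrite !inE.
  have [gv|gv] := boolP (G u z).
    have := gv; rewrite hG // => /and3P[zU zu _]; rewrite unc_G2 // zU zu (cross z y) // (cov_sym _ z y).
    by rewrite andbC.
  rewrite /unc (negbTE gv) andbF; move: gv; rewrite hG // [cov (Q1 :|: Q2) u z]cov_setU !negb_or.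
  by case: (z \in U); case: (z != u); case: (cov Q1 u z).
move: (#|_|%:R) => d0; move: (#|_|%:R) => d1.
rewrite !ler_distl => /andP[h1 _] /andP[h3 _]; apply: le_trans h3.
have b1 : p' * (p ^+ 2 * M - g3 * (p ^+ 2 * M)) <= p' * d0 by rewrite ler_pM2l.
have e : p' * (p ^+ 2 * M - g3 * (p ^+ 2 * M)) = p * ((1 - g3) * (p' * (p * M))) by ring.
have b2 : p * (3 / 5 * f + 1 / (10 * 10) * (p' * (p * M))) <= p * ((1 - g3) * (p' * (p * M))).
  rewrite ler_pM2l //; move: f2 ggq gq; move: f (p' * (p * M)) => F y'; lra.
have e2 : p * (3 / 5 * f + 1 / (10 * 10) * (p' * (p * M))) = 3 / 5 * (p * f) + p / (10 * 10) * (p' * (p * M)).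
  by move: f (p' * (p * M)) => a b; ring.
rewrite e in b1; rewrite e2 in b2; move: b1 b2.
move: (p * ((1 - g3) * _)) (3 / 5 * (p * f)) (p / _ * _) (p' * d0) => z1 z2 z3 z4 hz1 hz2; lra.
Qed.

Lemma final_total : (\sum_(u in U1) #|[set x in U2 | ~~ cov (Q1 :|: Q2) u x]| =
  m * 3 ^ j + 2 * #|inside (Q1 :|: Q2) U1| + 2 * #|inside (Q1 :|: Q2) U2|)%N.
Proof.
have -> : (\sum_(u in U1) #|[set x in U2 | ~~ cov (Q1 :|: Q2) u x]| = crossn)%N.
  apply: eq_bigr => u uU; apply: eq_card => x; rewrite !inE; case xU: (x \in U2) => //=.
  have nU : x \notin U1 by rewrite (disjointFl d12 xU).
  rewrite cov_Q2 //; first by apply: contraNneq nU => <-.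
  by rewrite ingraph1 // (negbTE nU).
rewrite -leg2 addnC -addnA; congr addn.
rewrite -(inside_all _ U1) -(inside_all _ U2) -!inbr_sum //.
have -> : ecount (unc G Q2) = (\sum_(v in U1 :|: U2) #|[set z | unc G Q2 v z]|)%N.
  under eq_bigr => u _ do rewrite -sum1_card.
  rewrite pair_big_dep /= sum1_card; apply: eq_card => xy; rewrite !inE /= [in RHS]unfold_in inE.
  by case h: (unc G Q2 _ _); rewrite ?andbF //; case/andP: h => /G_in ->.
rewrite sum_sides; congr addn; apply: eq_bigr => v vU; apply: eq_card => z; rewrite !inE.
  rewrite /unc ingraph1 // cov_setU negb_or.
  by case: (z \in U1); case: (z != v); case: (cov Q1 v z).
rewrite /unc ingraph2 // cov_setU negb_or.
by case: (z \in U2); case: (z != v); case: (cov Q1 v z).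
Qed.

Lemma final_completion : exists S, steiner_triple_system S /\ Q1 \subset S.
Proof.
have nf := quasi_num_facts K200 p01 g_gt0 m_ge1 gap g_small g_big crossn_dev erefl erefl.
have d21 : [disjoint U2 & U1] by rewrite disjoint_sym.
have t2 := packing_triples pk; have l2 := packing_linsys pk.
have [||||S [S1 S2]] := quasi_completion nf d12 eW cW c1 c2 (triplesU t1 t2) _ _ _ _ final_total.
- apply: linsysU => // x y xy cv cv2; have := cov_packing pk xy cv2.
  by case/and3P => _ _; rewrite cv.
- move=> e; rewrite in_setU => /orP[/QU //|eQ]; apply/subsetP=> x xe.
  have [|x' [y' [xe' ye' xy']]] := @card_gt1_pair _ e; first by rewrite (t2 _ eQ).
  have /packingP[s _] := pk; have /triP[_ h] := subsetP s e eQ.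
  have [ex|nx] := eqVneq x x'; first by subst x'; apply: (G_in (h _ _ xe ye' xy')).
  exact: (G_in (h _ _ xe xe' nx)).
- apply: final_side => //; last exact: subsetUl.
  by split=> // *; apply: ingraph1.
- apply: final_side => //; last exact: subsetUr.
  by split=> // *; apply: ingraph2.
by exists S; split=> //; apply: subset_trans S2; apply: subsetUl.
Qed.

End Final.

Lemma phase2_completion : exists S, steiner_triple_system S /\ Q1 \subset S.
Proof.
by have [M2 [Q2 [h1 h2 h3 h4]]] := phase2_extend; apply: (final_completion h1 h2 h3 h4).
Qed.

End Phase2.

(** * The phase on both sides *)

(** Repetitions are allowed, so 4-tuples of points parametrise all nonempty sets of size at most
    4. *)
Lemma small_set (T : finType) (Z : {set T}) : (0 < #|Z| <= 4)%N ->
  exists a b c d, [/\ a \in Z, b \in Z, c \in Z, d \in Z & Z = [set a; b; c; d]].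
Proof.
move=> /andP[/card_gt0P[x0 x0Z] c4].
have inZ k : nth x0 (enum Z) k \in Z.
  have [h|h] := ltnP k (size (enum Z)); last by rewrite nth_default.
  by rewrite -mem_enum mem_nth.
exists (nth x0 (enum Z) 0), (nth x0 (enum Z) 1), (nth x0 (enum Z) 2), (nth x0 (enum Z) 3).
split=> //; apply/setP=> y; rewrite !inE; apply/idP/idP => [yZ|].
  have : y \in enum Z by rewrite mem_enum.
  move=> /(nthP x0)[k ks <-]; have : (k < 4)%N by apply: leq_trans c4; rewrite cardE.
  by case: k ks => [|[|[|[|k]]]] // _ _; rewrite eqxx ?orbT.
by rewrite -!orbA => /or4P[]/eqP->.
Qed.

Section Phase1.
Variables (R : realType) (V : finType) (U1 U2 W : {set V}).
Variables (m j K t M N : nat) (g0 : R).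
Notation m' := (m%:R : R).
Notation w := ((3 ^ j)%:R : R).

Definition clique (U : {set V}) : rel V := fun x y => [&& x != y, x \in U & y \in U].
Notation G0 := (clique (U1 :|: U2)).
Notation D := (2 * m%:R - 2 : R).
Notation p := (dens R G0 M).
Notation g := (tol g0 K p).

Hypothesis d12 : [disjoint U1 & U2].
Hypothesis eW : W = ~: (U1 :|: U2).
Hypothesis cW : #|W| = (3 ^ j)%N.
Hypothesis c1 : #|U1| = m.
Hypothesis c2 : #|U2| = m.
Hypothesis div6 : (m * m + m * 3 ^ j = 6 * t + 2 * m)%N.
Hypothesis K200 : (200 <= K)%N.
Hypothesis g0_gt0 : 0 < g0.
Hypothesis m_ge2 : 2 <= m'.
Hypothesis p_gt0 : 0 < p.
Hypothesis gap : p ^+ 4 * m' / (2 * (10 * 10 * 10)) <= p * m' - w <= p ^+ 4 * m' / (10 * 10 * 10).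
Hypothesis g_small : g * (3 * (10 * 10)) <= p * (p ^+ 3 / (5 * (10 * 10 * 10))) ^+ K.
Hypothesis g_big : (10 * 10 * 10) * (10 * 10 * 10) * (10 * 10 * 10) <= g0 * (p ^+ 8 * m').
Hypothesis V13 : (13 <= #|V|)%N.
Hypothesis exp_big : #|V|%:R ^+ 5 <= expR (g0 ^+ 2 / 4 * (p ^+ 2 * m')).
Hypothesis N_sts : forall S : {set {set V}}, steiner_triple_system S -> #|S| = N.

Lemma clique_sym (U : {set V}) : symmetric (clique U).
Proof. by move=> x y; rewrite /clique eq_sym [(x \in U) && _]andbC. Qed.

Lemma clique_irr (U : {set V}) : irreflexive (clique U).
Proof. by move=> x; rewrite /clique eqxx. Qed.

Lemma cardU : #|U1 :|: U2| = (2 * m)%N.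
Proof. by rewrite cardsU (disjoint_setI0 d12) cards0 subn0 c1 c2 mul2n addnn. Qed.

Lemma ecount_clique : ecount G0 = (2 * m * (2 * m).-1)%N.
Proof.
rewrite -cardU -card_offdiag; apply: eq_card => xy; rewrite !inE.
by rewrite /clique !inE andbC -andbA.
Qed.

Lemma m_ge2N : (2 <= m)%N. Proof. by rewrite -(ler_nat R). Qed.

Lemma ecountR : (ecount G0)%:R = 2 * m' * (2 * m' - 1) :> R.
Proof.
rewrite ecount_clique natrM natrM -subn1 natrB ?natrM //.
by rewrite muln_gt0 /= (leq_trans _ m_ge2N).
Qed.

Lemma ecount_clique_gt0 : (0 < ecount G0)%N.
Proof. by rewrite ecount_clique; move: m_ge2N; case: (m) => [|[|k]]. Qed.

Lemma dens_range : 0 < p <= 1.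
Proof. by rewrite p_gt0 p_le1 // ecount_clique_gt0. Qed.

Lemma g0_le_g : g0 <= g.
Proof. by apply: g0_le_gam => //; apply: ecount_clique_gt0. Qed.

Lemma g_gt0 : 0 < g. Proof. exact: lt_le_trans g0_le_g. Qed.

Lemma cnbr_clique Q (Z S : {set V}) : Z \subset U1 :|: U2 -> (0 < #|Z|)%N ->
  cnbr (unc G0 Q) Z S = [set x in S :&: (U1 :|: U2) | (x \notin Z) && [forall z in Z, ~~ cov Q z x]].
Proof.
move=> ZU /card_gt0P[z0 z0Z]; apply/setP=> x; rewrite !(inE, in_setI) -andbA; congr andb.
apply/forall_inP/idP => [h|/and3P[xU xZ /forall_inP h] z zZ].
  apply/and3P; split.
  - by move: (h z0 z0Z) => /andP[/and3P[_ _]]; rewrite in_setU.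
  - by apply/negP => xZ; move: (h x xZ) => /andP[]; rewrite /clique eqxx.
  by apply/forall_inP => z zZ; case/andP: (h z zZ).
rewrite /unc h // andbT /clique (subsetP ZU) // in_setU xU !andbT.
by apply: contraNneq xZ => <-.
Qed.

Lemma trk0_clique (Z S : {set V}) : Z \subset U1 :|: U2 -> (0 < #|Z|)%N ->
  tracked_count R G0 set0 (Z, S) = #|(S :&: (U1 :|: U2)) :\: Z|%:R.
Proof.
move=> ZU Z0; rewrite /tracked_count /= cnbr_clique //; congr _%:R; apply: eq_card => x; rewrite !inE.
rewrite andbC; congr andb; case: (x \in Z) => //=; apply/forall_inP => z _; by rewrite cov0.
Qed.

Definition side_part (o : option bool) : {set V} :=
  if o is Some b then (if b then U1 else U2) else [set: V].

(** The sets [Z] of one to four points, with neighbours counted in [U1], in [U2] or everywhere.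
    There are only polynomially many indices, so the initial potential is small once the exponent
    [g0 ^ 2 / 4 * D] exceeds a multiple of [ln n]. *)
Definition tracked_full : {set {set V} * {set V}} :=
  [set ([set q.1.1.1; q.1.1.2; q.1.2.1; q.1.2.2], side_part q.2) |
    q in setX (setX (setX (U1 :|: U2) (U1 :|: U2)) (setX (U1 :|: U2) (U1 :|: U2))) [set: option bool]].

Lemma tracked_full_card : (#|tracked_full| <= 3 * #|V| ^ 4)%N.
Proof.
apply: leq_trans (leq_imset_card _ _) _; rewrite !cardsX cardsT card_option card_bool mulnC.
rewrite leq_mul2l /= (expnD _ 2 2) -mulnn leq_mul //; apply: leq_mul; exact: max_card.
Qed.

Lemma tracked_full_mem (Z : {set V}) o : Z \subset U1 :|: U2 -> (0 < #|Z| <= 4)%N -> (Z, side_part o) \in tracked_full.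
Proof.
move=> ZU /small_set[a [b [c [d [aZ bZ cZ dZ e]]]]]; apply/imsetP.
exists (((a, b), (c, d)), o); last by rewrite /= -e.
by rewrite !in_setX /= !(subsetP ZU) //= inE.
Qed.

Lemma tracked_fullP i : i \in tracked_full -> [/\ i.1 \subset U1 :|: U2 & (0 < #|i.1| <= 4)%N].
Proof.
move=> /imsetP[[[[a b] [c d]] o]]; rewrite !in_setX /= => /andP[/andP[/andP[aU bU] /andP[cU dU]] _] -> /=.
split; first by rewrite !subUset !sub1set aU bU cU dU.
apply/andP; split; first by apply/card_gt0P; exists a; rewrite !inE eqxx.
have h (A : {set V}) x : (#|A :|: [set x]| <= #|A|.+1)%N.
  by rewrite (leq_trans (leq_card_setU _ _).1) // cards1 addn1.
by do 3 ![apply: leq_trans (h _ _) _; rewrite ltnS]; rewrite cards1.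
Qed.

Lemma D_gt0 : 0 < D. Proof. by have := m_ge2; lra. Qed.

Lemma tracked_full_ok i : i \in tracked_full -> [/\ (0 < #|i.1| <= 4)%N, 0 < D & tracked_count R G0 set0 i <= 2 * D].
Proof.
move=> iF; have [iU ic] := tracked_fullP iF; split=> //; first exact: D_gt0.
rewrite [i]surjective_pairing trk0_clique //; last by case/andP: ic.
apply: (@le_trans _ _ (2 * m)%:R).
  rewrite ler_nat -cardU; apply: subset_leq_card; apply/subsetP=> x; rewrite in_setD => /andP[_].
  by rewrite in_setI => /andP[].
by rewrite natrM; have := m_ge2; lra.
Qed.

Lemma tracked_full_edge x y : G0 x y -> [/\ ([set x; y], [set: V]) \in tracked_full, D = D
  & `|tracked_count R G0 set0 ([set x; y], [set: V]) - D| <= g0 * D].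
Proof.
move=> /and3P[xy xU yU]; have sub : [set x; y] \subset U1 :|: U2 by rewrite subUset !sub1set xU.
split=> //; first by apply: (@tracked_full_mem _ None) => //; rewrite cards2 xy.
rewrite trk0_clique ?cards2 ?xy // setTI cardsDS // cardU cards2 xy natrB ?natrM; last first.
  by rewrite -[2%N]/(2 * 1)%N leq_mul2l /= (leq_trans _ m_ge2N).
by rewrite subrr normr0 mulr_ge0 // ltW // D_gt0.
Qed.

Lemma n_bound : ((2 * (3 * #|V| ^ 4))%:R : R) * expR (- (g0 ^+ 2 / 4 * D)) <= 2^-1.
Proof.
have m2 := m_ge2; have /andP[p0 p1] := dens_range.
have n0 : 0 < #|V|%:R :> R by rewrite ltr0n (leq_trans _ V13).
have h1 : #|V|%:R ^+ 5 <= expR (g0 ^+ 2 / 4 * D).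
  apply: le_trans exp_big _; rewrite ler_expR ler_pM2l ?divr_gt0 ?exprn_gt0 //.
  apply: (@le_trans _ _ m'); last by lra.
  by rewrite ler_piMl ?exprn_ile1 //; first [exact: ltW | lra].
have e0 := expR_gt0 (g0 ^+ 2 / 4 * D).
rewrite expRN ler_pdivrMr //; apply: le_trans (_ : 2^-1 * #|V|%:R ^+ 5 <= _); last by rewrite ler_pM2l ?invr_gt0 //.
have : (12 * #|V| ^ 4 <= #|V| * #|V| ^ 4)%N by rewrite leq_mul2r (ltnW V13) orbT.
rewrite -(ler_nat R) -expnS natrX natrM natrX mulnA natrM natrX; move: (_ ^+ 4) (_ ^+ 5) => a b; lra.
Qed.

Notation PhiM := (Phi G0 tracked_full (fun _ => D) g0 K).

Lemma Phi_full_half : PhiM 0 set0 <= 2^-1.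
Proof.
apply: le_trans (Phi_init G0 K g0_gt0 (fun i _ => lexx D)) _.
by apply: le_trans n_bound; rewrite ler_wpM2r ?expR_ge0 // ler_nat leq_mul2l tracked_full_card.
Qed.

Lemma gm_big : [/\ (10 * 10) <= g0 * m', (10 * 10) <= g0 * p * m' & (10 * 10) <= g0 * (p ^+ 2 * m')].
Proof.
have /andP[p0 p1] := dens_range; have m0 : 0 < m' by have := m_ge2; lra.
have process_state k : (k <= 8)%N -> (10 * 10) <= g0 * (p ^+ k * m').
  move=> k8; have : g0 * (p ^+ 8 * m') <= g0 * (p ^+ k * m').
    rewrite ler_pM2l // ler_pM2r // -(subnKC k8) exprD ler_piMr ?exprn_ge0 ?exprn_ile1 //; exact: ltW.
  by have := g_big; move: (g0 * _) (g0 * (p ^+ k * _)) => a b; lra.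
by split; [have := process_state 0 isT; rewrite expr0 mul1r|have := process_state 1 isT; rewrite expr1 mulrA|exact: (process_state 2 isT)].
Qed.

Lemma g_hundred : g <= 100^-1.
Proof. by have := g_tiny K200 dens_range g_small; lra. Qed.

Lemma stepsz_full_small : 8 * stepsz R G0 <= g0 * p.
Proof.
have m2 := m_ge2; have [_ h _] := gm_big; have m0 : 0 < m' by lra.
have e0 : 0 < 2 * m' * (2 * m' - 1) by rewrite !mulr_gt0 //; lra.
rewrite /stepsz ecountR mulrA ler_pdivrMr //.
have : (10 * 10) * 1 <= g0 * p * m' * (2 * m' - 1) by apply: ler_pM => //; lra.
lra.
Qed.

Lemma scale_full_big : 16 <= g0 * (p ^+ 2 * D).
Proof.
have m2 := m_ge2; have [_ _ h] := gm_big; apply: le_trans (_ : g0 * (p ^+ 2 * m') <= _).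
  by move: h; lra.
have p20 : 0 < p ^+ 2 by rewrite exprn_gt0.
by rewrite ler_pM2l // ler_pM2l //; lra.
Qed.

Section Side.
Variable Q : {set {set V}}.
Hypothesis P1 : PhiM M Q < 1.

(** One-sided counts start near [m] but carry the common scale [D = 2 * m - 2], whence the factor
    [2 * g]. The constant [c] counts the points of [Z] lying in the side considered. *)
Lemma trk_side (Z : {set V}) o c : Z \subset U1 :|: U2 -> (0 < #|Z| <= 4)%N ->
  #|side_part o :&: (U1 :|: U2) :\: Z|%:R = m' - c -> 0 <= c <= 2 ->
  `|#|[set x in side_part o :&: (U1 :|: U2) | (x \notin Z) && [forall z in Z, ~~ cov Q z x]]|%:R
     - p ^+ #|Z| * m'| <= (2 * g * m' - 2 * g + c) * p ^+ #|Z|.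
Proof.
move=> ZU cZ e /andP[c0 c2']; have Z0 : (0 < #|Z|)%N by case/andP: cZ.
have := tracked_count_dev g0_gt0 P1 (@tracked_full_mem Z o ZU cZ).
rewrite trk0_clique // e /tracked_count /= cnbr_clique //; move: (#|_|%:R) => y.
have pk0 : 0 < p ^+ #|Z| by rewrite exprn_gt0.
move: (p ^+ #|Z|) pk0 => P P0; rewrite !ler_distl => /andP[h1 h2].
have cP : 0 <= c * P by rewrite mulr_ge0 // ltW.
by apply/andP; split; move: h1 h2 cP; lra.
Qed.

Lemma side_general U B o o' : U = side_part (Some o) -> B = side_part (Some o') -> U :|: B = U1 :|: U2 ->
  [disjoint U & B] -> #|U| = m -> #|B| = m -> phase1_side Q m p g U B.
Proof.
move=> eU eB UB dUB cU cB; have gp := g_gt0; have [gm _ _] := gm_big; have m0 : 0 < m' by have := m_ge2; lra.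
have gm2 : (10 * 10) <= g * m'.
  by apply: le_trans gm _; rewrite ler_pM2r // g0_le_g.
have UU : U \subset U1 :|: U2 by rewrite -UB subsetUl.
have BU : B \subset U1 :|: U2 by rewrite -UB subsetUr.
have UI : U :&: (U1 :|: U2) = U by apply/setIidPl.
have BI : B :&: (U1 :|: U2) = B by apply/setIidPl.
have fin (y : nat) (k : nat) c : `|y%:R - p ^+ k * m'| <= (2 * g * m' - 2 * g + c) * p ^+ k -> c <= 2 ->
    `|y%:R - p ^+ k * m'| <= 3 * g * (p ^+ k * m').
  move=> h c2'; apply: le_trans h _; have pk0 : 0 < p ^+ k by rewrite exprn_gt0.
  by rewrite [p ^+ k * m']mulrC [3 * g * _]mulrA ler_pM2r //; lra.
split.
- move=> Z ZU cZ; have ZU' := subset_trans ZU UU.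
  have dBZ : [disjoint B & Z] by rewrite disjoint_sym; apply: disjointWl ZU dUB.
  have := @trk_side Z (Some o') 0 ZU' cZ; rewrite -eB BI.
  have -> : B :\: Z = B by apply/setDidPl.
  rewrite cB subr0 => /(_ erefl); rewrite lexx ler0n => /(_ isT) h.
  apply: (@le_trans _ _ ((2 * g * m' - 2 * g + 0) * p ^+ #|Z|)); last first.
    have pk0 : 0 < p ^+ #|Z| by rewrite exprn_gt0.
    by rewrite addr0 [p ^+ _ * m']mulrC [2 * g * (m' * _)]mulrA ler_pM2r //; lra.
  apply: le_trans h; rewrite le_eqVlt; apply/orP; left; apply/eqP.
  congr (`| _%:R - _ |); apply: eq_card => x; rewrite !inE; case xB: (x \in B) => //=.
  by rewrite (disjointFr dBZ xB).
- move=> v vU; have sub : [set v] \subset U1 :|: U2 by rewrite sub1set (subsetP UU).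
  have := @trk_side [set v] (Some o) 1 sub; rewrite cards1 -eU UI => /(_ isT).
  rewrite cardsDS ?sub1set // cards1 cU natrB ?(leq_trans _ m_ge2N) // => /(_ erefl).
  rewrite ler01 ler1n => /(_ isT) h.
  have := fin _ 1%N 1 h; rewrite expr1 ler1n => /(_ isT); congr (`| _%:R - _| <= _).
  apply: eq_card => x; rewrite !inE; congr [&& _, _ & _].
  by apply/forall_inP/idP => [|hx z /set1P->] //; apply; rewrite set11.
- move=> x y xU yU xy; have sU : [set x; y] \subset U by rewrite subUset !sub1set xU.
  have := @trk_side [set x; y] (Some o) 2 (subset_trans sU UU); rewrite cards2 xy -eU UI => /(_ isT).
  rewrite cardsDS // cards2 xy cU natrB ?m_ge2N // => /(_ erefl).
  rewrite lexx ler0n => /(_ isT) h.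
  have := fin _ 2%N 2 h; rewrite lexx => /(_ isT); congr (`| _%:R - _| <= _).
  apply: eq_card => z; rewrite !inE negb_or -!andbA; congr [&& _, _, _ & _].
  apply/forall_inP/andP => [h'|[h1 h2] s]; first by split; apply: h'; rewrite !inE eqxx ?orbT.
  by rewrite !inE => /orP[]/eqP->.
move=> u y uU yB; have yU : y \notin U by rewrite (disjointFl dUB yB).
have uy : u != y by apply: contraNneq yU => <-.
have sU : [set u; y] \subset U1 :|: U2 by rewrite subUset !sub1set (subsetP UU) // (subsetP BU).
have := @trk_side [set u; y] (Some o) 1 sU; rewrite cards2 uy -eU UI => /(_ isT).
have -> : U :\: [set u; y] = U :\: [set u].
  apply/setP=> z; rewrite !inE; have [->|zy] := eqVneq z y; last by rewrite orbF.
  by rewrite (negbTE yU) !andbF.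
rewrite cardsDS ?sub1set // cards1 cU natrB ?(leq_trans _ m_ge2N) // => /(_ erefl).
rewrite ler01 ler1n => /(_ isT) h.
have := fin _ 2%N 1 h; rewrite ler1n => /(_ isT); congr (`| _%:R - _| <= _).
apply: eq_card => z; rewrite !inE negb_or -!andbA.
have [zU /=|//] := boolP (z \in U); have -> : z != y by apply: contraNneq yU => <-.
congr andb; apply/forall_inP/andP => [h'|[h1 h2] s]; first by split; apply: h'; rewrite !inE eqxx ?orbT.
by rewrite !inE => /orP[]/eqP->.
Qed.

Lemma phase1_completion : process_state G0 M Q -> exists S, steiner_triple_system S /\ Q \subset S.
Proof.
move=> [pk _ _]; have gg := g0_le_g; have /andP[p0 p1] := dens_range; have m0 : 0 < m' by have := m_ge2; lra.
have QU e : e \in Q -> e \subset U1 :|: U2.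
  move=> eQ; apply/subsetP=> x xe; have c3 := packing_triples pk eQ.
  have [|x' [y' [xe' ye' xy']]] := @card_gt1_pair _ e; first by rewrite c3.
  have /packingP[s _] := pk; have /triP[_ h] := subsetP s e eQ.
  have [ex|nx] := eqVneq x x'; first by subst x'; have /and3P[] := h _ _ xe ye' xy'.
  by have /and3P[] := h _ _ xe xe' nx.
have s1 : phase1_side Q m p g U1 U2 by apply: (@side_general _ _ true false).
have s2' : phase1_side Q m p g U2 U1.
  by apply: (@side_general _ _ false true) => //; rewrite ?(setUC U2) // disjoint_sym.
apply: (phase2_completion d12 eW cW c1 c2 (packing_triples pk) (packing_linsys pk) QU s1 s2' div6
   K200 dens_range g_gt0 _ gap g_small _ V13).
- by have := m_ge2; lra.
- by apply: le_trans g_big _; rewrite ler_pM2r ?mulr_gt0 ?exprn_gt0.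
apply: le_trans exp_big _; rewrite ler_expR ler_pM2r ?mulr_gt0 ?exprn_gt0 //.
by rewrite ler_pM2r ?invr_gt0 //; apply: lerXn2r; rewrite ?nnegrE ?g0_le_g //; apply: ltW; rewrite ?g_gt0.
Qed.

End Side.

Definition sts_above (Q : {set {set V}}) : nat :=
  #|[set S : {set {set V}} | steiner_triple_system S & Q \subset S]|.

Lemma sts_above_rec (Q : {set {set V}}) :
  (\sum_(e | e \notin Q) sts_above (e |: Q) = sts_above Q * (N - #|Q|))%N.
Proof.
rewrite /sts_above -sum_nat_const.
under eq_bigr => e _ do rewrite -sum1_card.
rewrite (exchange_big_dep (fun S : {set {set V}} => S \in [set S : {set {set V}} | steiner_triple_system S & Q \subset S])) /=; last first.
  by move=> e S _; rewrite !inE => /andP[-> ]; rewrite subUset => /andP[].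
apply: eq_bigr => S; rewrite inE => /andP[sS QS].
rewrite -(N_sts sS) -cardsDS // -sum1_card; apply: eq_bigl => e.
by rewrite !inE sS subUset sub1set QS andbT.
Qed.

(** A good prefix of length [M1] is extended by the process to length [M], where the completion
    applies, so it lies in at least one system. The factor [2^-1] is a lower bound for [1 - Phi] at
    the start. *)
Lemma phase1_lower M1 : (M1 <= M)%N ->
  2^-1 * \prod_(0 <= l < M1) LB G0 D g0 K l <=
  (#|[set S : {set {set V}} | steiner_triple_system S]| * N ^_ M1)%:R.
Proof.
move=> M1M.
have base (Q : {set {set V}}) : process_state G0 M1 Q -> PhiM M1 Q < 1 -> (0 < sts_above Q)%N.
  move=> sQ pQ; have [Q' [QQ sQ' pQ']] := process_extend (@clique_sym _) (@clique_irr _) K200 g0_gt0 D_gt0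
    tracked_full_ok tracked_full_edge ecount_clique_gt0 p_gt0 stepsz_full_small g_hundred scale_full_big M1M sQ pQ.
  have [S [S1 S2]] := phase1_completion pQ' sQ'.
  by apply/card_gt0P; exists S; rewrite inE S1 (subset_trans QQ).
have := process_lower (@clique_sym _) (@clique_irr _) K200 g0_gt0 D_gt0
    tracked_full_ok tracked_full_edge ecount_clique_gt0 p_gt0 stepsz_full_small g_hundred scale_full_big M1M sts_above_rec base (leq0n _) (process_state0 G0).
rewrite !subn0.
have -> : sts_above set0 = #|[set S : {set {set V}} | steiner_triple_system S]|.
  by apply: eq_card => S; rewrite !inE sub0set andbT.
apply: le_trans; apply: ler_wpM2r; last by have := Phi_full_half; lra.
rewrite big_nat; apply: prodr_ge0 => l /andP[_ lM].
exact: (LB_ge0 g0_gt0 D_gt0 ecount_clique_gt0 p_gt0 stepsz_full_small g_hundred scale_full_big (leq_trans (ltnW lM) M1M)).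
Qed.

End Phase1.

(** * Choice of parameters *)

Lemma expR_le_1sub (R : realType) (s : R) : 0 <= s <= 2^-1 -> expR (- (2 * s)) <= 1 - s.
Proof.
move=> /andP[s0 s1]; rewrite expRN invf_ple ?posrE ?expR_gt0 //; last by lra.
apply: le_trans (expR_ge1Dx _).
have h : 0 < 1 - s by lra.
rewrite -[X in X <= _]mul1r ler_pdivrMr //.
have : s * s <= s * 2^-1 by rewrite ler_wpM2l.
lra.
Qed.

(* [p] and [q] are the densities of uncovered pairs on [n - w] and on [n] points
   after the same number of steps; a hole of size [a], with [a ^ 3 = a3], lowers
   the upper count by a factor [1 - 6 v], all other losses being [O (v ^ 2)]. *)
Lemma step_ratio (R : realType) (n w v a3 p q t : R) :
  let u := n - w in let E := u * (u - 1) in let E0 := n * (n - 1) in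
  0 < v <= 20^-1 -> 4 <= n -> 1 <= v ^+ 6 * (n - 2) -> 0 <= w <= n * v ^+ 4 ->
  v ^+ 2 <= p <= 1 -> q = 1 - (1 - p) * (E / E0) -> n ^+ 3 * v <= a3 -> 0 <= 4 * t <= v ^+ 2 ->
  (E0 * (n - 2) / 6 - a3) * q ^+ 3 + E0 / 6 * q <=
    (E * p ^+ 3 * (u - 2) * (1 - 2 * t) / 6) * expR (- (5 * v)).
Proof.
move=> u E E0 /andP[v0 v1] n4 nv /andP[w0 wn] /andP[pv p1] qE a3n /andP[t0 tv].
have v2 : 0 < v ^+ 2 by rewrite exprn_gt0.
have v4 : 0 < v ^+ 4 by rewrite exprn_gt0.
have v2s : v ^+ 2 <= 20^-1 * v by rewrite expr2 ler_pM2r.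
have v4s : v ^+ 4 <= 20^-1 * v ^+ 2.
  have -> : v ^+ 4 = v ^+ 2 * v ^+ 2 by ring.
  by rewrite ler_pM2r //; lra.
pose r := v ^+ 4; have r1 : r <= (20 * 20)^-1 by rewrite /r; lra.
have r0 : 0 < r by [].
have u1 : n * (1 - r) <= u by rewrite /u /r; lra.
have nr : n * r <= n * (20 * 20)^-1 by rewrite ler_pM2l //; lra.
have nr4 : 4 * r <= n * r by rewrite ler_pM2r.
have E00 : 0 < E0 by rewrite mulr_gt0 //; lra.
have EE : E0 * (1 - 4 * r) <= E.
  apply: (@le_trans _ _ (n * (1 - r) * (n * (1 - r) - 1))).
    have -> : n * (1 - r) * (n * (1 - r) - 1) = E0 * (1 - 4 * r) + n * (2 * (n * r) + n * r * r - 3 * r).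
      by rewrite /E0; ring.
    rewrite lerDl mulr_ge0 //; first by lra.
    have : 0 <= n * r * r by apply: mulr_ge0; [apply: mulr_ge0|]; move: n4 r0; clear; lra.
    by lra.
  by apply: ler_pM => //; move: n4 nr r1 u1 r0; clear; lra.
have un : u <= n by rewrite /u; lra.
have u2 : 2 <= u by lra.
have EE1 : E <= E0 by apply: ler_pM; move: un u2; clear; lra.
have uu : (n - 2) * (1 - 2 * r) <= u - 2 by lra.
have ex s : 0 <= s <= 2^-1 -> expR (- (2 * s)) <= 1 - s := @expR_le_1sub R s.
have e1 : E0 * expR (- (8 * r)) <= E.
  apply: le_trans EE; rewrite ler_pM2l //.
  have := ex (4 * r); have -> : 2 * (4 * r) = 8 * r by ring.
  by apply; lra.
have e2 : (n - 2) * expR (- (4 * r)) <= u - 2.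
  apply: le_trans uu; rewrite ler_pM2l; last by lra.
  have := ex (2 * r); have -> : 2 * (2 * r) = 4 * r by ring.
  by apply; lra.
have e3 : expR (- (4 * t)) <= 1 - 2 * t.
  have := ex (2 * t); have -> : 2 * (2 * t) = 4 * t by ring.
  by apply; lra.
have p0 : 0 < p := lt_le_trans v2 pv.
have sE : 1 - 4 * r <= E / E0 <= 1.
  by rewrite ler_pdivlMr // ler_pdivrMr // mul1r [(1 - _) * _]mulrC EE EE1.
have pq : p <= q.
  have : (1 - p) * (E / E0) <= (1 - p) * 1 by rewrite ler_wpM2l ?subr_ge0 //; case/andP: sE.
  by rewrite qE; move: (_ * (E / E0)) => z; clear; lra.
have qp : q <= p + 4 * r.
  have : (1 - p) * (1 - 4 * r) <= (1 - p) * (E / E0) by rewrite ler_wpM2l ?subr_ge0 //; case/andP: sE.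
  have : 0 <= p * r by rewrite mulr_ge0 // ltW.
  by rewrite qE; move: (_ * (E / E0)) => z; clear; lra.
have q0 : 0 < q := lt_le_trans p0 pq.
(* The additive error [4 * v ^ 4] becomes a relative error [4 * v ^ 2] because [p >= v ^ 2]. *)
have e4 : q * expR (- (4 * v ^+ 2)) <= p.
  have h : q <= p * expR (4 * v ^+ 2).
    apply: le_trans qp _; apply: (@le_trans _ _ (p * (1 + 4 * v ^+ 2))).
      have rE : r = v ^+ 2 * v ^+ 2 by rewrite /r; ring.
      have : v ^+ 2 * v ^+ 2 <= p * v ^+ 2 by rewrite ler_pM2r.
      by rewrite -rE; lra.
    by rewrite ler_pM2l // expR_ge1Dx.
  by rewrite expRN ler_pdivrMr ?expR_gt0.
have n20 : 0 < n - 2 by move: n4; clear; lra.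
have T0 : 0 < E0 * (n - 2) / 6 by apply: divr_gt0 => //; apply: mulr_gt0 => //.
set T := E0 * (n - 2) / 6.
have q30 : 0 < q ^+ 3 by rewrite exprn_gt0.
have TQ : 0 < T * q ^+ 3 by apply: mulr_gt0.
(* Here [T] is the number of all triples. The missing triples remove a proportion at least [6 * v];
   the contribution of the blocks of the system itself adds at most [v ^ 2]. *)
have L1 : (T - a3) * q ^+ 3 + E0 / 6 * q <= T * q ^+ 3 * expR (- (6 * v) + v ^+ 2).
  apply: (@le_trans _ _ (T * q ^+ 3 * (1 - 6 * v + v ^+ 2))); last first.
    rewrite ler_pM2l //; by apply: le_trans (expR_ge1Dx _); clear; lra.
  have a3T : 6 * v * T <= a3.
    apply: le_trans a3n; have -> : 6 * v * T = E0 * (n - 2) * v by rewrite /T; field.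
    rewrite ler_pM2r // /E0 !exprS expr0 mulr1 -mulrA ler_pM2l; last by move: n4; clear; lra.
    by apply: ler_pM; move: n4; clear; lra.
  have hq : E0 / 6 * q <= T * q ^+ 3 * v ^+ 2.
    have -> : T * q ^+ 3 * v ^+ 2 = E0 / 6 * q * ((n - 2) * (q ^+ 2 * v ^+ 2)) by rewrite /T; ring.
    have hh : 0 <= E0 / 6 * q by apply: mulr_ge0; [apply: divr_ge0 => //; exact: ltW|exact: ltW].
    apply: (ler_peMr hh).
    apply: le_trans nv _; rewrite mulrC ler_pM2l //.
    have -> : v ^+ 6 = (v ^+ 2) ^+ 2 * v ^+ 2 by ring.
    rewrite ler_pM2r //; apply: lerXn2r; rewrite ?nnegrE; [exact: ltW|exact: ltW|exact: le_trans pv pq].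
  have : 6 * v * T * q ^+ 3 <= a3 * q ^+ 3 by rewrite ler_pM2r.
  by move: hq; move: (E0 / 6 * q) => z; clear; lra.
apply: le_trans L1 _.
have q3 : q ^+ 3 * expR (- (12 * v ^+ 2)) <= p ^+ 3.
  have -> : - (12 * v ^+ 2) = 3%:R * (- (4 * v ^+ 2)) by ring.
  rewrite expRM_natl -exprMn lerXn2r // nnegrE ?ltW //.
  by rewrite mulr_gt0 ?expR_gt0.
apply: (@le_trans _ _ ((E0 * expR (- (8 * r))) * (q ^+ 3 * expR (- (12 * v ^+ 2))) *
   ((n - 2) * expR (- (4 * r))) * expR (- (4 * t)) / 6 * expR (- (5 * v)))).
  have -> : (E0 * expR (- (8 * r))) * (q ^+ 3 * expR (- (12 * v ^+ 2))) *
   ((n - 2) * expR (- (4 * r))) * expR (- (4 * t)) / 6 * expR (- (5 * v)) =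
   T * q ^+ 3 * (expR (- (8 * r)) * expR (- (12 * v ^+ 2)) * expR (- (4 * r)) * expR (- (4 * t)) * expR (- (5 * v))).
    by rewrite /T; ring.
  (* All error exponents together are [O (v ^ 2)] and fit into the difference between [6 * v] and
     [5 * v]. *)
  rewrite -!expRD ler_pM2l // ler_expR /r; move: v2s v4s tv v2 v0 v1; move: (v ^+ 2) (v ^+ 4) => y z; clear; lra.
have x0 a : 0 <= expR a :> R by apply: expR_ge0.
rewrite ler_pM2r ?expR_gt0 // ler_pM2r ?invr_gt0 //.
have E0n := ltW E00; have q3n := ltW q30; have n2n := ltW n20; clearbody T E E0.
move: (q ^+ 3) (n - 2) (p ^+ 3) (u - 2) (1 - 2 * t) q3n n2n q3 e1 e2 e3 => Q N2 P U T' Q0 N0 h3 h1 h2 h4.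
move: (expR _) (x0 (- (8 * r))) (expR (- (12 * _))) (x0 (- (12 * v ^+ 2))) (expR (- (4 * r)))
  (x0 (- (4 * r))) (expR (- (4 * t))) (x0 (- (4 * t))) h1 h2 h3 h4.
move=> a a0 b b0 c c0 d d0 h1 h2 h3 h4.
apply: ler_pM => //; first by rewrite !mulr_ge0.
apply: ler_pM => //; rewrite ?mulr_ge0 //.
by apply: ler_pM => //; rewrite ?mulr_ge0.
Qed.

(** Both counts contain the number [N ^_ M1] of ordered prefixes of a system, which cancels; what
    remains is the product of the per-step ratios [c]. *)
Lemma count_compare (R : realType) (V : finType) (B : {set {set {set V}}}) (A0 : {set {set V}})
  (N M1 S : nat) (L : nat -> R) (c : R) :
  (forall T, T \in B -> steiner_triple_system T) -> (forall T, T \in B -> T \subset A0) ->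
  (forall T, T \in A0 -> #|T| = 3%N) -> (forall T, T \in B -> #|T| = N) -> (M1 <= N)%N ->
  0 <= c -> (forall l, (l < M1)%N -> 0 <= alpha R A0 N l <= L l * c) ->
  2^-1 * \prod_(0 <= l < M1) L l <= (S * N ^_ M1)%:R ->
  #|B|%:R <= 2 * S%:R * (#|V|%:R ^+ 3) ^+ (N - M1) * c ^+ M1.
Proof.
move=> h1 h2 h3 h4 MN c0 hL low.
have F0 : 0 < (N ^_ M1)%:R :> R by rewrite ltr0n ffact_gt0.
rewrite -(ler_pM2r F0) -[X in X <= _]natrM.
apply: le_trans (upper_count R h1 h2 h3 h4 MN) _.
have -> : ((#|V| ^ 3) ^ (N - M1))%:R = (#|V|%:R ^+ 3) ^+ (N - M1) :> R by rewrite !natrX.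
have X0 : 0 <= (#|V|%:R ^+ 3) ^+ (N - M1) :> R by rewrite !exprn_ge0.
have P : \prod_(0 <= l < M1) alpha R A0 N l <= (\prod_(0 <= l < M1) L l) * c ^+ M1.
  have -> : c ^+ M1 = \prod_(0 <= l < M1) c by rewrite prodr_const_nat subn0.
  rewrite -big_split /= !big_nat; apply: ler_prod => l /andP[_ lM]; exact: hL.
apply: le_trans (ler_wpM2l X0 P) _.
have c1 : 0 <= c ^+ M1 by rewrite exprn_ge0.
have := ler_wpM2r c1 low; rewrite natrM => h.
have := ler_wpM2l X0 h; move: (_ ^+ (N - M1)) (\prod_(_ <= _ < _) _) (c ^+ M1) (_ ^_ _)%:R S%:R => *; lra.
Qed.

(** In the exponent, the holes cost at most [3 * n] and the last blocks at most [9 * L * v ^ 2 * N],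
    which is a small fraction of [v * N] because [100 * L * v <= 1]. The gain is nearly [5 * v * N],
    and [v * N] is at least [100 * n]. *)
Lemma total_small (R : realType) (n v L : R) (nN N M1 : nat) : 0 < v <= 100^-1 -> n = nN%:R ->
  n <= expR L -> 0 <= L -> 100 * L * v <= 1 -> (M1 <= N)%N -> (N - M1)%:R <= 3 * v ^+ 2 * N%:R ->
  100 * n <= N%:R * v -> 1 <= n ->
  8 ^+ nN * (2 * (n ^+ 3) ^+ (N - M1) * expR (- (5 * v)) ^+ M1) <= expR (- n).
Proof.
move=> /andP[v0 v1] en nL L0 Lv MN NM Nn n1.
have e8 : (8 : R) <= expR 3.
  have -> : (3 : R) = 3%:R * 1 by rewrite mulr1.
  rewrite expRM_natl; have -> : (8 : R) = 2 ^+ 3 by rewrite -natrX.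
  by rewrite lerXn2r // ?nnegrE ?expR_ge0 //; apply: le_trans (expR_ge1Dx 1); lra.
have e2 : (2 : R) <= expR 1 by apply: le_trans (expR_ge1Dx 1); lra.
have a1 : 8 ^+ nN <= expR (3 * n).
  by rewrite en mulrC expRM_natl; apply: lerXn2r; rewrite ?nnegrE ?expR_ge0.
have a2 : (n ^+ 3) ^+ (N - M1) <= expR (3 * L * (N - M1)%:R).
  have n0 : 0 <= n by lra.
  have aa : n ^+ 3 <= expR (3 * L).
    by rewrite expRM_natl; apply: lerXn2r; rewrite ?nnegrE ?expR_ge0.
  by rewrite [X in expR X]mulrC expRM_natl; apply: lerXn2r; rewrite ?nnegrE ?exprn_ge0 ?expR_ge0.
have a3 : expR (- (5 * v)) ^+ M1 = expR (- (5 * v) * M1%:R) by rewrite [X in _ = expR X]mulrC expRM_natl.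
rewrite a3.
have n3 : 0 <= n ^+ 3 by rewrite exprn_ge0 //; lra.
apply: (@le_trans _ _ (expR (3 * n) * (expR 1 * expR (3 * L * (N - M1)%:R) * expR (- (5 * v) * M1%:R)))).
  have x1 : 0 <= (n ^+ 3) ^+ (N - M1) by rewrite exprn_ge0.
  have x2 : 0 <= expR (- (5 * v) * M1%:R) := expR_ge0 _.
  have x3 : 0 <= 8 ^+ nN :> R by rewrite exprn_ge0.
  apply: (ler_pM x3 _ a1); first by rewrite !mulr_ge0.
  by apply: (ler_wpM2r x2); apply: ler_pM.
rewrite -!expRD ler_expR.
have Nv0 : 0 <= N%:R * v by rewrite mulr_ge0 // ltW.
have b1 : 3 * L * (N - M1)%:R <= 10^-1 * (N%:R * v).
  apply: (@le_trans _ _ (3 * L * (3 * v ^+ 2 * N%:R))); first by rewrite ler_wpM2l //; lra.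
  have -> : 3 * L * (3 * v ^+ 2 * N%:R) = 9 / 100 * (100 * L * v) * (N%:R * v) by field.
  rewrite ler_wpM2r //; lra.
have b2 : N%:R * v - 3 * v * (v * (N%:R * v)) <= M1%:R * v.
  have e : (N - M1)%:R = N%:R - M1%:R :> R by rewrite natrB.
  have := ler_wpM2r (ltW v0) NM; rewrite e !expr2; lra.
have b3 : v * (v * (N%:R * v)) <= 100^-1 * (100^-1 * (N%:R * v)).
  apply: ler_pM => //; [exact: ltW|by rewrite mulr_ge0 // ltW|].
  by rewrite ler_wpM2r.
move: b1 b2 b3 Nn n1; move: (3 * L * _) (M1%:R) => a b; move: (N%:R * v) => c.
lra.
Qed.

Lemma pick_steps (R : realType) (h x : R) : 0 < h -> x <= 1 ->
  exists M : nat, x <= 1 - M%:R * h < x + h.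
Proof.
move=> h0 x1; exists (Num.truncn ((1 - x) / h)).
have q0 : 0 <= (1 - x) / h by rewrite divr_ge0 ?subr_ge0 // ltW.
have /andP[t1 t2] := truncn_itv q0.
move: t1 t2; rewrite ler_pdivlMr // ltr_pdivrMr // -natr1 => t1 t2.
by apply/andP; split; lra.
Qed.

Lemma exps_arith K : (21 * K + 6 = 2 + (19 * K + 4 + 2 * K))%N.
Proof. lia. Qed.

(* Everything is measured by [v = n ^- (1 / RR)]: the density stops at [v ^ 2] in
   the counted prefix, [w / n ~ v ^ 4], and the initial error is [v ^ A]. *)
Section Params.
Variables (R : realType) (n w m v h p : R) (K A RR : nat).
Hypothesis v01 : 0 < v <= (10 * 10 * 10 * 10)^-1.
Hypothesis nRR : 1 <= n * v ^+ RR.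
Hypothesis RRA : (2 * A + 60 <= RR)%N.
Hypothesis AE : A = (21 * K + 6)%N.
Hypothesis w_lo : n * v ^+ 4 <= 3 * w.
Hypothesis w_hi : w <= n * v ^+ 4.
Hypothesis mE : 2 * m = n - w.
Hypothesis hE : h = 6 / (2 * m * (2 * m - 1)).
Notation om := (w / m).
Notation pstar := (om + 7 / (10 * 10 * 10 * 10) * om ^+ 4).
Hypothesis p_rng : pstar <= p < pstar + h.

Lemma v_gt0 : 0 < v. Proof. by case/andP: v01. Qed.
Lemma v_le1 : v <= 1. Proof. by have := v01; lra. Qed.

Lemma v_pow a b : (a <= b)%N -> v ^+ b <= v ^+ a.
Proof.
move=> ab; rewrite -(subnKC ab) exprD ler_piMr ?exprn_ge0 ?exprn_ile1 ?v_le1 //; exact: ltW v_gt0.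
Qed.

Lemma n_gt0 : 0 < n.
Proof.
have := v_gt0 => v0; rewrite -(pmulr_lgt0 _ (exprn_gt0 RR v0)); apply: lt_le_trans nRR; exact: ltr01.
Qed.

Lemma n_v_pow k : (k <= RR)%N -> 1 <= n * v ^+ k.
Proof. by move=> kR; apply: le_trans nRR _; rewrite ler_pM2l ?v_pow // n_gt0. Qed.

Lemma v_pow_step k : v ^+ k.+1 * (10 * 10 * 10 * 10) <= v ^+ k.
Proof.
have := v01; have vk : 0 < v ^+ k by rewrite exprn_gt0 // v_gt0.
have -> : v ^+ k.+1 * (10 * 10 * 10 * 10) = v ^+ k * (v * (10 * 10 * 10 * 10)) by rewrite exprS; ring.
by move=> /andP[_ h1]; rewrite ler_piMr //; [exact: ltW|lra].
Qed.

Lemma n_v_pow_big k : (k < RR)%N -> (10 * 10 * 10 * 10) <= n * v ^+ k.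
Proof.
move=> kR; have h1 := n_v_pow kR; have := ler_wpM2l (ltW n_gt0) (v_pow_step k); move: h1.
have -> : n * (v ^+ k.+1 * (10 * 10 * 10 * 10)) = n * v ^+ k.+1 * (10 * 10 * 10 * 10) by ring.
by move: (n * v ^+ k.+1) (n * v ^+ k) => a b; lra.
Qed.

Lemma RR60 : (60 <= RR)%N.
Proof. exact: leq_trans (leq_addl _ _) RRA. Qed.

Lemma n_v_pow_small k : (k < 60)%N -> (10 * 10 * 10 * 10) <= n * v ^+ k.
Proof. by move=> k60; apply: n_v_pow_big; apply: leq_trans k60 RR60. Qed.

Lemma n_big : (10 * 10 * 10 * 10) <= n.
Proof. by have := @n_v_pow_small 0 isT; rewrite expr0 mulr1. Qed.

Lemma vpows : [/\ v ^+ 4 <= (10 * 10 * 10 * 10)^-1, 0 < v ^+ 4 & v ^+ 4 <= (10 * 10 * 10 * 10)^-1 * v ^+ 2].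
Proof.
have := v_pow_step 2; have := v_pow_step 3; have := v_gt0 => v0; have v4 : 0 < v ^+ 4 by rewrite exprn_gt0.
have v2 : v ^+ 2 <= 1 by rewrite exprn_ile1 ?v_le1 //; exact: ltW.
have v3 : v ^+ 3 <= v ^+ 2 by apply: v_pow.
by move: v4 v2 v3; move: (v ^+ 4) (v ^+ 3) (v ^+ 2) => a b c *; split; lra.
Qed.

Lemma w_small : 0 < w <= (10 * 10 * 10 * 10)^-1 * n.
Proof.
have [v4 v40 _] := vpows; have n0 := n_gt0.
have : n * v ^+ 4 <= n * (10 * 10 * 10 * 10)^-1 by rewrite ler_pM2l.
have : 0 < n * v ^+ 4 by rewrite mulr_gt0.
by move: w_lo w_hi; lra.
Qed.

Lemma m_bounds : [/\ 0 < m, n <= 3 * m, 2 * m <= n & 2 <= m].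
Proof.
by have /andP[w0 w1] := w_small; have := n_big; have := mE; split; lra.
Qed.

Lemma om_bounds : 2 / 3 * v ^+ 4 <= om <= 3 * v ^+ 4.
Proof.
have [m0 nm mn _] := m_bounds; have [_ v4 _] := vpows.
rewrite ler_pdivlMr // ler_pdivrMr //.
have : 2 * m * v ^+ 4 <= n * v ^+ 4 by rewrite ler_pM2r.
have : n * v ^+ 4 <= 3 * m * v ^+ 4 by rewrite ler_pM2r.
by move: w_lo w_hi; lra.
Qed.

Lemma h_bounds : 0 < h <= v ^+ 20.
Proof.
have [m0 nm mn m2] := m_bounds.
have e0 : 0 < 2 * m * (2 * m - 1) by rewrite !mulr_gt0 //; lra.
rewrite hE divr_gt0 //= ler_pdivrMr //.
have h10 : (10 * 10 * 10 * 10) <= n * v ^+ 10 by apply: n_v_pow_small.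
have : (10 * 10 * 10 * 10) * (10 * 10 * 10 * 10) <= n * v ^+ 10 * (n * v ^+ 10) by apply: ler_pM => //; lra.
have -> : n * v ^+ 10 * (n * v ^+ 10) = v ^+ 20 * (n * n) by ring.
have v20 : 0 < v ^+ 20 by rewrite exprn_gt0 // v_gt0.
have nn : n * n <= 9 * (2 * m * (2 * m - 1)).
  have : n * n <= 3 * m * (3 * m) by apply: ler_pM => //; have := n_gt0; lra.
  have : 2 * m <= m * m by rewrite ler_pM2r.
  lra.
have := ler_wpM2l (ltW v20) nn; move: (v ^+ 20 * (n * n)) => a; lra.
Qed.

Lemma om4_bounds : [/\ 0 < om ^+ 4, h <= om ^+ 4 / (10 * 10 * 10 * 10) & om ^+ 4 <= (10 * 10 * 10 * 10)^-1 * om].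
Proof.
have /andP[o1 o2] := om_bounds; have [v4 v40 _] := vpows; have /andP[h0 h1] := h_bounds.
have om0 : 0 < om by lra.
have om4 : 0 < om ^+ 4 by rewrite exprn_gt0.
split=> //.
  have : (2 / 3 * v ^+ 4) ^+ 4 <= om ^+ 4 by apply: lerXn2r; rewrite ?nnegrE //; lra.
  have -> : (2 / 3 * v ^+ 4) ^+ 4 = 2 / 3 * (2 / 3) * (2 / 3) * (2 / 3) * v ^+ 16 by ring.
  have := v_pow_step 16; have := v_pow_step 17; have : v ^+ 20 <= v ^+ 18 by apply: v_pow.
  have : 0 < v ^+ 18 by rewrite exprn_gt0 // v_gt0.
  move: h1; move: (v ^+ 16) (v ^+ 17) (v ^+ 18) (v ^+ 20) (om ^+ 4) => *; lra.
rewrite exprSr ler_pM2r //.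
have o1' : om <= 1 by lra.
have : om ^+ 3 <= om ^+ 1.
  by rewrite exprS expr1 ler_piMr ?exprn_ile1 //; exact: ltW.
by rewrite expr1; have := v_pow_step 3; have : v ^+ 3 <= v ^+ 1 by [apply: v_pow]; rewrite expr1; have := v_pow_step 3; have := v01; 
  have : 0 < v ^+ 3 by [rewrite exprn_gt0 // v_gt0]; have := v_pow_step 2; have : v ^+ 2 <= v ^+ 1 by [apply: v_pow]; rewrite expr1; move: o2;
  move: (v ^+ 4) (v ^+ 3) (v ^+ 2) (om ^+ 3) => *; lra.
Qed.

Lemma p_bounds : [/\ om + 7 / (10 * 10 * 10 * 10) * om ^+ 4 <= p,
  p <= om + 8 / (10 * 10 * 10 * 10) * om ^+ 4, 0 < om & p <= om * (1 + (10 * 10 * 10)^-1)].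
Proof.
have [o4 ho oo] := om4_bounds; have /andP[p1 p2] := p_rng.
have /andP[o1 o2] := om_bounds; have [v4 v40 _] := vpows.
by split; lra.
Qed.

(** By the choice of [pstar], the excess of [p] over [om] is between 7 and 8 ten-thousandths of
    [om ^ 4]. This lies between a two-thousandth and a thousandth of [p ^ 4], as [p ^ 4] is between
    [om ^ 4] and [11 / 10 * om ^ 4]. *)
Lemma p_gap : p ^+ 4 * m / (2 * (10 * 10 * 10)) <= p * m - w <= p ^+ 4 * m / (10 * 10 * 10).
Proof.
have [p1 p2 o0 p3] := p_bounds; have [m0 _ _ _] := m_bounds; have [o4 _ _] := om4_bounds.
have -> : p * m - w = (p - om) * m by field; rewrite gt_eqF.
rewrite ![_ * m / _]mulrAC !ler_pM2r //.
have a1 : om ^+ 4 <= p ^+ 4 by apply: lerXn2r; rewrite ?nnegrE; lra.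
have a2 : p ^+ 4 <= (om * (1 + (10 * 10 * 10)^-1)) ^+ 4.
  by apply: lerXn2r => //; rewrite ?nnegrE; lra.
have a3 : (om * (1 + (10 * 10 * 10)^-1)) ^+ 4 <= 11 / 10 * om ^+ 4.
  by rewrite exprMn mulrC ler_pM2r // !exprS expr0; lra.
by move: a1 a2 a3 p1 p2 o4; move: (om ^+ 4) (p ^+ 4) (_ ^+ 4) => *; apply/andP; split; lra.
Qed.

(** Since [om] is of order [v ^ 4], the density at which the first phase stops lies strictly below
    [v ^ 2], where the counted prefix ends, and above [v ^ 5]. *)
Lemma p_v : v ^+ 5 <= p /\ pstar + h <= v ^+ 2.
Proof.
have [p1 p2 o0 p3] := p_bounds; have [o4 ho oo] := om4_bounds.
have /andP[o1 o2] := om_bounds; have [v4 v40 v42] := vpows.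
have := v_pow_step 4; have : 0 < v ^+ 5 by rewrite exprn_gt0 // v_gt0.
by move: (v ^+ 5) => *; split; lra.
Qed.

Lemma p_01 : 0 < p <= 1.
Proof.
have [p1 p2] := p_v; have v5 : 0 < v ^+ 5 by rewrite exprn_gt0 // v_gt0.
have : v ^+ 2 <= 1 by rewrite exprn_ile1 ?v_le1 //; exact: ltW v_gt0.
by have /andP[_ p3] := p_rng; lra.
Qed.

(** The origin of [A = 21 * K + 6]: with [p >= v ^ 5], the power [4 * K + 1] of [p] needs
    [20 * K + 5] factors [v]; [K] further ones absorb the constants [5000], and one more absorbs
    300. *)
Lemma par_small : v ^+ A * p^-1 ^+ K * (3 * (10 * 10)) <= p * (p ^+ 3 / (5 * (10 * 10 * 10))) ^+ K.
Proof.
have /andP[p0 _] := p_01; have [p5 _] := p_v; have v0 := v_gt0.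
rewrite [X in X <= _]mulrAC exprVn ler_pdivrMr ?exprn_gt0 //.
have -> : p * (p ^+ 3 / (5 * (10 * 10 * 10))) ^+ K * p ^+ K = p * (p ^+ 3 / (5 * (10 * 10 * 10)) * p) ^+ K.
  by move: (p ^+ 3 / _) => Y; rewrite exprMn mulrA.
have -> : v ^+ A * (3 * (10 * 10)) = v ^+ 5 * (v * (3 * (10 * 10))) * (v ^+ 21) ^+ K.
  by rewrite AE exprD exprM; ring.
have v50 : 0 <= v ^+ 5 by rewrite exprn_ge0 // ltW.
have y0 : 0 <= v * (3 * (10 * 10)) by apply: mulr_ge0; lra.
have y1 : v * (3 * (10 * 10)) <= 1 by have := v01; lra.
have v21 : 0 <= v ^+ 21 by rewrite exprn_ge0 // ltW.
apply: ler_pM.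
- by rewrite mulr_ge0.
- by rewrite exprn_ge0.
- by apply: le_trans p5; rewrite ler_piMr.
have p4 : (v ^+ 5) ^+ 4 <= p ^+ 4 by apply: lerXn2r; rewrite ?nnegrE // ltW.
apply: lerXn2r; rewrite ?nnegrE //.
  by apply: mulr_ge0; [apply: divr_ge0; [apply: exprn_ge0; lra|lra]|lra].
have -> : p ^+ 3 / (5 * (10 * 10 * 10)) * p = p ^+ 4 / (5 * (10 * 10 * 10)) by rewrite mulrAC -exprSr.
have e20 : (v ^+ 5) ^+ 4 = v ^+ 20 by rewrite -exprM.
have := v_pow_step 20; move: p4 v21; rewrite e20; move: (v ^+ 20) (v ^+ 21) (p ^+ 4) => *; lra.
Qed.

Lemma par_big : (10 * 10 * 10) * (10 * 10 * 10) * (10 * 10 * 10) <= v ^+ A * (p ^+ 8 * m).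
Proof.
have /andP[p0 _] := p_01; have [p5 _] := p_v; have v0 := v_gt0; have [m0 nm _ _] := m_bounds.
have v5 : 0 <= v ^+ 5 by rewrite exprn_ge0 // ltW.
have p8 : (v ^+ 5) ^+ 8 <= p ^+ 8 by apply: lerXn2r; rewrite ?nnegrE // ltW.
have AR : (A + 43 < RR)%N.
  by apply: leq_trans RRA; rewrite mul2n -addnn -addnS -addnA leq_add2l (leq_trans _ (leq_addl _ _)).
have big := n_v_pow_big AR.
have e : v ^+ A * ((v ^+ 5) ^+ 8 * n) * v ^+ 3 = n * v ^+ (A + 43).
  have -> : (A + 43 = A + 40 + 3)%N by rewrite -addnA.
  by rewrite -exprM !exprD; ring.
have le1 : v ^+ A * ((v ^+ 5) ^+ 8 * n) <= v ^+ A * (p ^+ 8 * (3 * m)).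
  rewrite ler_pM2l ?exprn_gt0 //; apply: ler_pM => //; first by rewrite !exprn_ge0 // ltW.
  exact: ltW n_gt0.
have v3 : v ^+ 3 * ((10 * 10 * 10 * 10) * (10 * 10 * 10 * 10) * (10 * 10 * 10 * 10)) <= 1.
  have := v_pow_step 0; have := v_pow_step 1; have := v_pow_step 2; rewrite expr0.
  move: (v ^+ 1) (v ^+ 2) (v ^+ 3) => *; lra.
have z0 : 0 <= v ^+ A * ((v ^+ 5) ^+ 8 * n).
  by rewrite !mulr_ge0 ?exprn_ge0 // ltW // n_gt0.
have := ler_wpM2l z0 v3.
move: z0 e le1; move: (v ^+ A * ((v ^+ 5) ^+ 8 * n)) => z z0 e le1.
have -> : z * (v ^+ 3 * ((10 * 10 * 10 * 10) * (10 * 10 * 10 * 10) * (10 * 10 * 10 * 10))) =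
  z * v ^+ 3 * ((10 * 10 * 10 * 10) * (10 * 10 * 10 * 10) * (10 * 10 * 10 * 10)) by ring.
rewrite e; move: le1 big.
have -> : v ^+ A * (p ^+ 8 * (3 * m)) = 3 * (v ^+ A * (p ^+ 8 * m)) by ring.
move: (v ^+ A * (p ^+ 8 * m)) (n * v ^+ (A + 43)) => *; lra.
Qed.

(** The origin of the term [2 * A] in the bound on [RR]: the exponent is of order
    [n * v ^ (2 * A + 10)], and one more factor [v] compares it with [L], which is at most
    [v^-1 / 100]. *)
Lemma par_exp L : n <= expR L -> 0 <= L -> 100 * L * v <= 1 ->
  n ^+ 5 <= expR ((v ^+ A) ^+ 2 / 4 * (p ^+ 2 * m)).
Proof.
move=> nL L0 Lv; have /andP[p0 _] := p_01; have [p5 _] := p_v; have v0 := v_gt0; have [m0 nm _ _] := m_bounds.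
apply: (@le_trans _ _ (expR (5 * L))).
  by rewrite expRM_natl; apply: lerXn2r; rewrite ?nnegrE ?expR_ge0 // ltW // n_gt0.
rewrite ler_expR -(ler_pM2r v0).
apply: (@le_trans _ _ 1); first by lra.
have v5 : 0 <= v ^+ 5 by rewrite exprn_ge0 // ltW.
have p2 : (v ^+ 5) ^+ 2 <= p ^+ 2 by apply: lerXn2r; rewrite ?nnegrE // ltW.
have AR : (2 * A + 11 < RR)%N by apply: leq_trans RRA; rewrite -addnS leq_add2l.
have big := n_v_pow_big AR.
have e : n * v ^+ (2 * A + 11) = (v ^+ A) ^+ 2 * ((v ^+ 5) ^+ 2 * n) * v.
  by rewrite mulnC exprD exprM -[(v ^+ 5) ^+ 2]exprM exprS; ring.
have le1 : (v ^+ A) ^+ 2 * ((v ^+ 5) ^+ 2 * n) <= (v ^+ A) ^+ 2 * (p ^+ 2 * (3 * m)).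
  rewrite ler_pM2l ?exprn_gt0 //; apply: ler_pM => //; first by rewrite !exprn_ge0 // ltW.
  exact: ltW n_gt0.
have := ler_wpM2r (ltW v0) le1; rewrite -e; move: big.
have -> : (v ^+ A) ^+ 2 * (p ^+ 2 * (3 * m)) * v = 12 * ((v ^+ A) ^+ 2 / 4 * (p ^+ 2 * m) * v) by field.
move: (n * _) (_ * v) => *; lra.
Qed.

Lemma par_tol d : v ^+ 2 <= d -> 0 <= 4 * (v ^+ A * d^-1 ^+ K) <= v ^+ 2.
Proof.
move=> hd; have v0 := v_gt0; have v2 : 0 < v ^+ 2 by rewrite exprn_gt0.
have d0 : 0 < d by lra.
have dK : 0 < d ^+ K by rewrite exprn_gt0.
rewrite exprVn; apply/andP; split.
  by rewrite mulr_ge0 // divr_ge0 ?exprn_ge0 // ltW.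
rewrite mulrA ler_pdivrMr //.
have h1 : (v ^+ 2) ^+ K <= d ^+ K by apply: lerXn2r; rewrite ?nnegrE // ltW.
apply: le_trans (ler_wpM2l (ltW v2) h1).
have -> : v ^+ A = v ^+ 2 * (v ^+ (19 * K + 4) * (v ^+ 2) ^+ K).
  by rewrite AE -exprM -!exprD; congr (_ ^+ _); apply: exps_arith.
have h2 : 4 * v ^+ (19 * K + 4) <= 1.
  have : v ^+ (19 * K + 4) <= v ^+ 4 by apply: v_pow; rewrite leq_addl.
  by have [v4 _ _] := vpows; lra.
have z : 0 <= v ^+ 2 * (v ^+ 2) ^+ K by rewrite mulr_ge0 ?exprn_ge0 // ltW.
have := ler_wpM2r z h2; lra.
Qed.

Lemma par_E : n * (n - 1) * (1 - 4 * v ^+ 4) <= 2 * m * (2 * m - 1).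
Proof.
have [m0 nm mn m2] := m_bounds; have nb := n_big; have [v4 v40 _] := vpows.
pose r := v ^+ 4.
have u1 : n * (1 - r) <= 2 * m by rewrite mE; have := w_hi; rewrite /r; lra.
have nr4 : 4 * r <= n * r by rewrite ler_pM2r //; lra.
have nr1 : n * r <= n * (10 * 10 * 10 * 10)^-1 by rewrite ler_pM2l //; lra.
apply: (@le_trans _ _ (n * (1 - r) * (n * (1 - r) - 1))).
  have -> : n * (1 - r) * (n * (1 - r) - 1) = n * (n - 1) * (1 - 4 * r) + n * (2 * (n * r) + n * r * r - 3 * r).
    by ring.
  rewrite lerDl; apply: mulr_ge0; first by lra.
  have r0 : 0 < r by [].
  have : 0 <= n * r * r by apply: mulr_ge0; [apply: mulr_ge0|]; lra.
  by move: nr4 r0; move: (n * r * r) (n * r) => *; lra.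
by apply: ler_pM => //; lra.
Qed.

Lemma par_N (N M1 : nat) : 6 * N%:R = n * (n - 1) -> 0 < 1 - M1%:R * h -> 1 - M1%:R * h < v ^+ 2 + h ->
  [/\ (M1 <= N)%N, (N - M1)%:R <= 3 * v ^+ 2 * N%:R & 100 * n <= N%:R * v].
Proof.
move=> N6 d0 d1; have [m0 nm mn m2] := m_bounds; have nb := n_big.
have [v4 v40 v42] := vpows; have /andP[h0 h20] := h_bounds; have v0 := v_gt0.
have e0 : 0 < 2 * m * (2 * m - 1) by rewrite !mulr_gt0 //; lra.
have hE' : h * (2 * m * (2 * m - 1)) = 6 by rewrite hE mulfVK // gt_eqF.
have EN : 2 * m * (2 * m - 1) <= 6 * N%:R by rewrite N6; apply: ler_pM; lra.
have EN' := par_E; rewrite -N6 in EN'.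
move: (2 * m * (2 * m - 1)) e0 hE' EN EN' => E e0 hE' EN EN'.
have M6 : 6 * M1%:R = M1%:R * h * E by rewrite -hE'; ring.
have MN : M1%:R <= N%:R :> R.
  have : M1%:R * h * E <= 1 * E by rewrite ler_pM2r //; lra.
  by move: M6 EN; move: (M1%:R * h * E) (M1%:R) => *; lra.
have MN' : (M1 <= N)%N by rewrite -(ler_nat R).
split=> //.
  rewrite natrB //.
  have : (1 - (v ^+ 2 + h)) * E <= M1%:R * h * E by rewrite ler_pM2r //; lra.
  rewrite -M6 => h1.
  have hv : h <= 10^-1 * v ^+ 2.
    have : v ^+ 20 <= v ^+ 4 by apply: v_pow.
    by move: h20 v42 v40; have : 0 < v ^+ 2 by [rewrite exprn_gt0]; move: (v ^+ 20) (v ^+ 4) (v ^+ 2) => *; lra.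
  have v21 : v ^+ 2 <= 10^-1.
    by have := v_pow_step 1; have := v_pow_step 0; rewrite expr0; have : 0 < v ^+ 2 by [rewrite exprn_gt0]; move: (v ^+ 1) (v ^+ 2) => *; lra.
  have N0 : 0 <= N%:R :> R by [].
  have q0 : 0 < 1 - (v ^+ 2 + h) by lra.
  have h2 : (1 - (v ^+ 2 + h)) * (6 * N%:R * (1 - 4 * v ^+ 4)) <= (1 - (v ^+ 2 + h)) * E by rewrite ler_pM2l.
  have h3 : (1 - 11 / 10 * v ^+ 2) * (1 - 10^-1 * v ^+ 2) <= (1 - (v ^+ 2 + h)) * (1 - 4 * v ^+ 4).
    apply: ler_pM; lra.
  have v22 : 0 <= v ^+ 2 * v ^+ 2 by rewrite mulr_ge0 ?sqr_ge0.
  have h4 : 1 - 3 * v ^+ 2 <= (1 - (v ^+ 2 + h)) * (1 - 4 * v ^+ 4).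
    apply: le_trans h3; have := sqr_ge0 v; move: v22; move: (v ^+ 2) => *; lra.
  have h5 := ler_wpM2l N0 h4.
  move: h1 h2 h5; move: (v ^+ 4) => *; lra.
have nb2 : (10 * 10 * 10 * 10) <= n * v.
  by have := @n_v_pow_small 1 isT; rewrite expr1.
have : 600 <= (n - 1) * v by have := v_le1; lra.
have n0 := n_gt0.
move=> h6; have := ler_wpM2l (ltW n0) h6; rewrite mulrA -N6; lra.
Qed.

End Params.

(** * Splitting the points, and divisibility *)

Lemma subset_of_size (T : finType) (A : {set T}) k : (k <= #|A|)%N ->
  exists2 B : {set T}, B \subset A & #|B| = k.
Proof.
move=> kA; exists [set x in take k (enum A)].
  by apply/subsetP=> x; rewrite inE => /mem_take; rewrite mem_enum.
rewrite cardsE (card_uniqP (take_uniq k (enum_uniq A))) size_takel //.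
by rewrite -cardE.
Qed.

Lemma split_vertices (T : finType) w m : #|T| = (2 * m + w)%N ->
  exists U1 U2 W : {set T}, [/\ [disjoint U1 & U2], W = ~: (U1 :|: U2), #|W| = w, #|U1| = m & #|U2| = m].
Proof.
move=> cT.
have [U1 _ c1] : exists2 B : {set T}, B \subset setT & #|B| = m.
  by apply: subset_of_size; rewrite cardsT cT mul2n -addnn -addnA leq_addr.
have cU : #|~: U1| = (m + w)%N by move: (cardsC U1); rewrite c1 cT mul2n -addnn -addnA => /addnI.
have [U2 s2 c2] : exists2 B : {set T}, B \subset ~: U1 & #|B| = m.
  by apply: subset_of_size; rewrite cU leq_addr.
exists U1, U2, (~: (U1 :|: U2)).
have d : [disjoint U1 & U2] by rewrite disjoint_sym disjoints_subset.
split=> //; move: (cardsC (U1 :|: U2)).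
by rewrite cardsU (disjoint_setI0 d) cards0 subn0 c1 c2 cT mul2n addnn => /addnI.
Qed.

Lemma even_mul_succ c : exists d, (c * c.+1 = 2 * d)%N.
Proof.
by exists 'C(c.+1, 2); rewrite mulnC -mul_bin_diag bin1 mulnC.
Qed.

Lemma odd_exp3 j : exists y, (3 ^ j.+1 = 6 * y + 3)%N.
Proof.
elim: j => [|j [y e]]; first by exists 0%N.
by exists (3 * y + 1)%N; rewrite expnS e; lia.
Qed.

(** As [3 ^ j.+1] is 3 modulo 6, [m] is 2 or 0 modulo 3 according to the residue of [n], and
    [m * (m + 3 ^ j.+1 - 2)] is congruent to [m * (m + 1)] modulo 6, hence to 0. *)
Lemma params_nat n j : (n %% 6 = 1)%N \/ (n %% 6 = 3)%N -> (3 ^ j.+1 <= n)%N ->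
  exists m t, [/\ n = (2 * m + 3 ^ j.+1)%N & (m * m + m * 3 ^ j.+1 = 6 * t + 2 * m)%N].
Proof.
have [y e] := odd_exp3 j; rewrite e => hn yn.
have [k hk] : exists k, n = (6 * k + 1)%N \/ n = (6 * k + 3)%N.
  by exists (n %/ 6)%N; case: hn => h; [left|right]; rewrite {1}(divn_eq n 6) h mulnC.
case: hk => hk.
  have [c hc] : exists c, (k = y + c + 1)%N by exists (k - y - 1)%N; lia.
  exists (3 * c + 2)%N; have [d hd] := even_mul_succ c.
  exists (d * 3 + c + 1 + (3 * c + 2) * y)%N; split; first by lia.
  by move: hd; clear; rewrite mulnS; lia.
have [c hc] : exists c, (k = y + c)%N by exists (k - y)%N; lia.
exists (3 * c)%N; have [d hd] := even_mul_succ c.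
exists (d * 3 - c + 3 * c * y)%N; split; first by lia.
have cd : (c <= d * 3)%N by nia.
have : (d * 3 - c + c = d * 3)%N by rewrite subnK.
move: (d * 3 - c)%N => s hs; move: hd hs; clear; rewrite mulnS; lia.
Qed.

Lemma block_count n : (n %% 6 = 1)%N \/ (n %% 6 = 3)%N -> exists N, (n * n.-1 = 6 * N)%N.
Proof.
move=> hn.
have [k hk] : exists k, n = (6 * k + 1)%N \/ n = (6 * k + 3)%N.
  by exists (n %/ 6)%N; case: hn => h; [left|right]; rewrite {1}(divn_eq n 6) h mulnC.
case: hk => ->.
  by exists (k * (6 * k + 1))%N; rewrite addn1 /= mulnC mulnA.
exists ((2 * k + 1) * (3 * k + 1))%N; rewrite addn3 /=; nia.
Qed.

Lemma pow3_between (R : realType) (x : R) : 3 <= x ->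
  exists j, (3 ^ j.+1)%:R <= x /\ x <= 3 * (3 ^ j.+1)%:R.
Proof.
move=> x3; have x0 : 0 <= x by lra.
have /andP[t1 t2] := truncn_itv x0.
set k := Num.truncn x in t1 t2.
have k3 : (3 <= k)%N.
  by rewrite -ltnS -(ltr_nat R); apply: le_lt_trans t2.
have /andP[l1 l2] := trunc_log_bounds (isT : (1 < 3)%N) (leq_trans (isT : (0 < 3)%N) k3).
move: l1 l2; case: (trunc_log 3 k) => [|j] l1 l2.
  by move: l2; rewrite ltnNge k3.
exists j; split; first by apply: le_trans t1; rewrite ler_nat.
by rewrite -natrM -expnS; apply: le_trans (ltW t2) _; rewrite ler_nat.
Qed.

(** Holes enter only through [A0]: any class of systems whose blocks avoid [n ^ 3 * v] triples
    altogether is so rare that a union over [8 ^ n] classes still leaves a proportion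
    [expR (- n)]. *)
Lemma sts_master (R : realType) (n K A RR : nat) (v L : R) :
  (n %% 6 = 1)%N \/ (n %% 6 = 3)%N -> 0 < v <= (10 * 10 * 10 * 10)^-1 -> 1 <= n%:R * v ^+ RR ->
  (2 * A + 60 <= RR)%N -> A = (21 * K + 6)%N -> (200 <= K)%N ->
  n%:R <= expR L -> 0 <= L -> 100 * L * v <= 1 ->
  (0 < #|[set S : {set {set 'I_n}} | steiner_triple_system S]|)%N /\
  forall (B : {set {set {set 'I_n}}}) (A0 : {set {set 'I_n}}),
  (forall T, T \in B -> steiner_triple_system T) -> (forall T, T \in B -> T \subset A0) ->
  (forall T, T \in A0 -> #|T| = 3%N) -> #|A0|%:R <= n%:R * (n%:R - 1) * (n%:R - 2) / 6 - n%:R ^+ 3 * v ->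
  #|B|%:R * 8 ^+ n <= #|[set S : {set {set 'I_n}} | steiner_triple_system S]|%:R * expR (- n%:R) :> R.
Proof.
move=> n6 v01 nRR RRA AE K200 nL L0 Lv; have /andP[v0 vle] := v01.
have big4 : (10 * 10 * 10 * 10) <= n%:R * v ^+ 4 := @n_v_pow_small _ _ _ _ _ v01 nRR RRA 4 isT.
have nbig := n_big v01 nRR RRA.
have n4 : 4 <= n%:R :> R by move: nbig; lra.
have n1 : 1 <= n%:R :> R by move: nbig; lra.
have E00 : 0 < n%:R * (n%:R - 1) :> R by rewrite mulr_gt0 //; move: n4; lra.
have v20 : 0 < v <= 20^-1 by apply/andP; split; lra.
have v100 : 0 < v <= 100^-1 by apply/andP; split; lra.
have v1 : v <= 1 by lra.
have v61 : v ^+ 6 <= 1 by rewrite exprn_ile1 //; exact: ltW.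
have [j [w_hi w_lo]] : exists j, (3 ^ j.+1)%:R <= n%:R * v ^+ 4 /\ n%:R * v ^+ 4 <= 3 * (3 ^ j.+1)%:R.
  by apply: pow3_between; lra.
have v4 : n%:R * v ^+ 4 <= n%:R.
  have v41 : v ^+ 4 <= 1 by rewrite exprn_ile1 //; exact: ltW.
  by rewrite ler_piMr //; lra.
have wn : (3 ^ j.+1 <= n)%N by rewrite -(ler_nat R); apply: le_trans w_hi _.
have [m [t [nE div6]]] := params_nat n6 wn.
have [U1 [U2 [W [d12 eW cW c1 c2]]]] := @split_vertices 'I_n (3 ^ j.+1) m (etrans (card_ord n) nE).
have [N NE] := block_count n6.
have N6 : 6 * N%:R = n%:R * (n%:R - 1) :> R.
  have n1N : (1 <= n)%N by apply: leq_trans wn; rewrite expn_gt0.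
  by rewrite -natrM -NE natrM -subn1 natrB.
have N_sts (S : {set {set 'I_n}}) : steiner_triple_system S -> #|S| = N.
  by move=> /sts_card; rewrite card_ord NE => /eqP; rewrite eqn_mul2l => /eqP.
set w : R := (3 ^ j.+1)%:R in w_hi w_lo.
have mE : 2 * m%:R = n%:R - w.
  by rewrite nE natrD natrM /w; lra.
pose G0 := clique (U1 :|: U2); pose h := stepsz R G0.
have [m0 nm mn m2] := m_bounds v01 nRR RRA w_lo w_hi mE.
have e0 : 0 < 2 * m%:R * (2 * m%:R - 1) :> R by rewrite !mulr_gt0 //; move: m2; clear; lra.
have eR : (ecount G0)%:R = 2 * m%:R * (2 * m%:R - 1) :> R := ecountR d12 c1 c2 m2.
have hE : h = 6 / (2 * m%:R * (2 * m%:R - 1)) by rewrite /h /stepsz eR.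
have /andP[h0 h20] := h_bounds v01 nRR RRA w_lo w_hi mE hE.
have om4 := om4_bounds v01 nRR RRA w_lo w_hi mE hE.
have v21 : v ^+ 2 <= 1 by rewrite exprn_ile1 //; exact: ltW.
(* The counted prefix stops at density about [v ^ 2]; the process itself continues to [M] steps,
   density about [ps]. *)
have [M1 /andP[M1a M1b]] := pick_steps h0 v21.
pose ps := w / m%:R + 7 / (10 * 10 * 10 * 10) * (w / m%:R) ^+ 4.
have ps_v : ps + h <= v ^+ 2.
  have hps : ps <= ps < ps + h by rewrite lexx ltrDl.
  by have [_] := p_v v01 nRR RRA w_lo w_hi mE hE hps.
have ps1 : ps <= 1 by move: ps_v v21 h0; clear; lra.
have [M Mrng] := pick_steps h0 ps1.
rewrite -/(dens R G0 M) in Mrng.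
have [p5 _] := p_v v01 nRR RRA w_lo w_hi mE hE Mrng.
have /andP[p0 p1] := p_01 v01 nRR RRA w_lo w_hi mE hE Mrng.
have gap := p_gap v01 nRR RRA w_lo w_hi mE hE Mrng.
have gs := par_small v01 nRR RRA AE w_lo w_hi mE hE Mrng.
have gb := par_big v01 nRR RRA w_lo w_hi mE hE Mrng.
have ge := par_exp v01 nRR RRA w_lo w_hi mE hE Mrng nL L0 Lv.
have M1M : (M1 <= M)%N.
  rewrite leqNgt; apply/negP => MM1; case/andP: Mrng => _ hM.
  have : M%:R * h <= M1%:R * h by rewrite ler_pM2r // ler_nat ltnW.
  by move: M1a hM ps_v; rewrite /dens -/h; clear; lra.
have gA : 0 < v ^+ A by rewrite exprn_gt0.
have V13 : (13 <= #|'I_n|)%N by rewrite card_ord -(ler_nat R); move: nbig; clear; lra.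
have ge' : #|'I_n|%:R ^+ 5 <= expR ((v ^+ A) ^+ 2 / 4 * (dens R G0 M ^+ 2 * m%:R)) by rewrite card_ord.
have low M' : (M' <= M)%N -> 2^-1 * \prod_(0 <= l < M') LB G0 (2 * m%:R - 2) (v ^+ A) K l <=
  (#|[set S : {set {set 'I_n}} | steiner_triple_system S]| * N ^_ M')%:R.
  exact: (phase1_lower d12 eW cW c1 c2 div6 K200 gA m2 p0 gap gs gb V13 ge' N_sts).
have S0 : (0 < #|[set S : {set {set 'I_n}} | steiner_triple_system S]|)%N.
  (* The count for the empty prefix says that at least half a system exists, hence at least one. *)
  have := low 0%N (leq0n _); rewrite big_geq // ffactn0 muln1 mulr1 -(ltr_nat R) => S2.
  by apply: lt_le_trans S2; rewrite invr_gt0.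
split=> // B A0 B1 B2 B3 B4.
have v2p : 0 < v ^+ 2 by rewrite exprn_gt0.
have d1p : 0 < 1 - M1%:R * h := lt_le_trans v2p M1a.
have [M1N NM1 Nn] := par_N v01 nRR RRA w_lo w_hi mE hE N6 d1p M1b.
have B5 T : T \in B -> #|T| = N by move=> /B1/N_sts.
have c0 : 0 <= expR (- (5 * v)) := expR_ge0 _.
have Nr0 : 0 < N%:R :> R by move: E00; rewrite -N6; clear; lra.
have hal l : (l < M1)%N -> 0 <= alpha R A0 N l <= LB G0 (2 * m%:R - 2) (v ^+ A) K l * expR (- (5 * v)).
  move=> lM; have lN : (l <= N)%N by apply: leq_trans (ltnW lM) M1N.
  apply/andP; split; first by rewrite /alpha addr_ge0 // mulr_ge0 // exprn_ge0 // divr_ge0.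
  set d := dens R G0 l.
  have dv : v ^+ 2 <= d <= 1.
    have : l%:R * h <= M1%:R * h by rewrite ler_pM2r // ler_nat ltnW.
    have : 0 <= l%:R * h by rewrite mulr_ge0 // ltW.
    by rewrite /d /dens -/h; move: M1a; clear; lra.
  have hd := par_tol v01 AE (andP dv).1.
  pose q : R := (N - l)%:R / N%:R.
  have qE : q = 1 - (1 - d) * ((n%:R - w) * (n%:R - w - 1) / (n%:R * (n%:R - 1))).
    rewrite /q /d /dens -/h hE -mE -N6 natrB //; field.
    by rewrite !gt_eqF //; move: n4 Nr0 e0 m0 m2; clear; lra.
  have n62 : 1 <= v ^+ 6 * (n%:R - 2).
    have := @n_v_pow_small _ _ _ _ _ v01 nRR RRA 6 isT.
    by move: v61; rewrite mulrBr [v ^+ 6 * n%:R]mulrC; move: (n%:R * _) => z; clear; lra.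
  have w00 : 0 <= w <= n%:R * v ^+ 4 by rewrite w_hi /w ler0n.
  (* The ratio is applied with [a3 = n ^ 3 * v], the least number of missing triples, and with [t]
     the tolerance of the process at density [d]. *)
  have := step_ratio v20 n4 n62 w00 dv qE (lexx _) hd.
  move=> sr; apply: (@le_trans _ _ ((n%:R * (n%:R - 1) * (n%:R - 2) / 6 - n%:R ^+ 3 * v) * q ^+ 3 + n%:R * (n%:R - 1) / 6 * q)).
    have -> : n%:R * (n%:R - 1) / 6 * q = (N - l)%:R by rewrite -N6 /q; field; rewrite gt_eqF.
    rewrite /alpha -/q lerD2r ler_wpM2r // exprn_ge0 // divr_ge0 //.
  apply: le_trans sr _; rewrite /LB eR -/d -mE /tol.
  by rewrite le_eqVlt; apply/orP; left; apply/eqP; ring.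
have cmp := count_compare B1 B2 B3 B5 M1N c0 hal (low M1 M1M).
rewrite card_ord in cmp.
have tot := total_small v100 erefl nL L0 Lv M1N NM1 Nn n1.
have e8 : 0 <= (8 : R) ^+ n by rewrite exprn_ge0.
apply: le_trans (ler_wpM2r e8 cmp) _.
apply: le_trans (ler_wpM2l (ler0n _ _) tot).
by rewrite le_eqVlt; apply/orP; left; apply/eqP; ring.
Qed.

(** * The limit *)

(* Imported only here because the set notations of classical_sets clash with finset. *)
From mathcomp Require Import all_classical all_reals all_analysis.
Import numFieldNormedType.Exports.
Local Open Scope classical_set_scope.
Local Open Scope ring_scope.

(** Here [v] is [n] to the power [- 1 / RR]. With [z = L / RR], the threshold on [n] says
    [z >= 400 * RR], so [expR z >= z ^ 2 / 4 >= 100 * RR * z = 100 * L]. *)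
Lemma log_scale (R : realType) (n RR : nat) : (0 < RR)%N ->
  let L : R := exp.ln n%:R in let v := expR (- (L / RR%:R)) in
  expR (400 * RR%:R ^+ 2) <= n%:R :> R ->
  [/\ 0 < v <= (10 * 10 * 10 * 10)^-1, n%:R * v ^+ RR = 1, n%:R = expR L, 0 <= L & 100 * L * v <= 1].
Proof.
move=> RR0 L v hn.
have R0 : 0 < RR%:R :> R by rewrite ltr0n.
have R1 : 1 <= RR%:R :> R by rewrite ler1n.
have n0 : 0 < n%:R :> R by apply: lt_le_trans hn; apply: expR_gt0.
have nL : n%:R = expR L by rewrite lnK // posrE.
have L400 : 400 * RR%:R ^+ 2 <= L by move: hn; rewrite nL ler_expR.
pose z := L / RR%:R.
have zL : L = z * RR%:R by rewrite /z mulfVK // gt_eqF.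
have z400 : 400 * RR%:R <= z by rewrite ler_pdivlMr // -mulrA -expr2.
have vz : v = expR (- z) by [].
have ez : (z / 2) * (z / 2) <= expR z.
  have -> : expR z = expR (z / 2) * expR (z / 2) by rewrite -expRD; congr expR; lra.
  have : z / 2 <= expR (z / 2) by apply: le_trans (expR_ge1Dx _); lra.
  by move=> h; apply: ler_pM => //; lra.
have e0 := expR_gt0 z.
have big : 100 * L <= expR z.
  apply: le_trans ez; rewrite zL.
  have : 400 * RR%:R * z <= z * z by rewrite ler_pM2r //; lra.
  by lra.
split.
- have p4 : 0 < 10 * 10 * 10 * 10 :> R by lra.
  rewrite vz expR_gt0 expRN lef_pV2 ?posrE //.
  apply: le_trans ez; have : 400 * 400 <= z * z by apply: ler_pM; lra.
  by lra.
- rewrite vz -expRM_natl nL -expRD zL -expR0; congr expR; ring.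
- exact: nL.
- by rewrite zL mulr_ge0 //; lra.
by rewrite vz expRN ler_pdivrMr // mul1r.
Qed.

(** The origin of the exponent: the cube of [n] to the power [1 - 1 / (3 * RR)] is [n ^ 3 * v], the
    number of missing triples that the counting argument needs. *)
Lemma cube_bound (R : realType) (n a RR : nat) : (0 < RR)%N -> (0 < n)%N ->
  n%:R `^ (1 - (3 * RR%:R)^-1) < a%:R :> R ->
  n%:R ^+ 3 * expR (- (exp.ln n%:R / RR%:R)) <= (a ^ 3)%:R :> R.
Proof.
move=> RR0 n0 h; rewrite natrX.
have n0' : 0 < n%:R :> R by rewrite ltr0n.
have -> : n%:R ^+ 3 * expR (- (exp.ln n%:R / RR%:R)) = (n%:R `^ (1 - (3 * RR%:R)^-1)) ^+ 3 :> R.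
  rewrite /powR gt_eqF // -expRM_natl -{1}[n%:R]lnK ?posrE // -expRM_natl -expRD; congr expR.
  by field; rewrite pnatr_eq0 -lt0n.
by apply: lerXn2r; rewrite ?nnegrE ?powR_ge0 // ltW.
Qed.

Lemma binomial3 (R : realType) n : (3 <= n)%N ->
  'C(n, 3)%:R = n%:R * (n%:R - 1) * (n%:R - 2) / 6 :> R.
Proof.
move=> n3; have : ('C(n, 3) * 6 = n * (n - 1) * (n - 2))%N.
  by rewrite -[6%N]/(3`!) bin_ffact !ffactnS ffactn0 muln1 mulnA subn1 subn2.
move=> /(congr1 (fun k => k%:R : R)); rewrite !natrM !natrB ?(leq_trans _ n3) // => <-.
by field.
Qed.

Section Limit.
Variables (R : realType) (K A RR : nat).
Hypothesis RRA : (2 * A + 60 <= RR)%N.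
Hypothesis AE : A = (21 * K + 6)%N.
Hypothesis K200 : (200 <= K)%N.
Notation delta := ((3 * RR%:R)^-1 : R).

Lemma prob_bound n : (n %% 6 = 1)%N \/ (n %% 6 = 3)%N -> expR (400 * RR%:R ^+ 2) <= n%:R :> R ->
  `|1 - uniform_Pr R (STS n) (fun S => (alpha3_star S)%:R <= n%:R `^ (1 - delta) :> R)| <= expR (- n%:R).
Proof.
move=> n6 nbig; have RR0 : (0 < RR)%N by apply: leq_trans RRA; rewrite addn_gt0 orbT.
have [v01 nv nL L0 Lv] := log_scale RR0 nbig.
set v := expR _ in v01 nv Lv; set L := exp.ln _ in v nL L0 Lv v01 nv.
have nv' : 1 <= n%:R * v ^+ RR by rewrite nv.
have nL' : n%:R <= expR L by rewrite -nL.
have [S0 HB] := sts_master n6 v01 nv' RRA AE K200 nL' L0 Lv.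
have n3 : (3 <= n)%N.
  rewrite -(ler_nat R); apply: le_trans nbig; apply: le_trans (expR_ge1Dx _).
  have : 1 <= RR%:R ^+ 2 :> R by rewrite exprn_ege1 // ler1n.
  by lra.
have n0 : (0 < n)%N by apply: leq_trans n3.
set c := n%:R `^ (1 - delta).
have c0 : 0 <= c by apply: powR_ge0.
set P := fun S => _.
pose Sb := [set S in STS n | ~~ P S]%SET.
pose k := Num.truncn c.
have /andP[k1 k2] := truncn_itv c0.
have ck a : (k < a)%N -> c < a%:R.
  by move=> ka; apply: lt_le_trans k2 _; rewrite ler_nat.
have eS : STS n = [set S : {set {set 'I_n}} | steiner_triple_system S]%SET by [].
have bad : #|Sb|%:R <= #|STS n|%:R * expR (- n%:R) :> R.
  apply: (@union_bound n R (fun a => (k < a)%N) Sb).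
  - move=> S; rewrite !inE => /andP[sS PS]; split=> //; apply: alpha3_star_gt.
    rewrite ltnNge; apply: contra PS => hk; rewrite /P.
    by apply: le_trans k1; rewrite ler_nat.
  - move=> X a ka dX; apply: (HB _ (noncrossing X)).
    + by move=> T; rewrite !inE => /andP[/andP[]].
    + by move=> T; rewrite inE => /andP[].
    + by move=> T; rewrite inE => /andP[/eqP].
    have := cube_bound RR0 n0 (ck a ka); have := noncrossing_card dX.
    rewrite -(ler_nat R) natrD binomial3 // -/L -/v => h1 h2.
    by move: h1 h2; lra.
  by rewrite mulr_ge0 ?expR_ge0.
have S0' : 0 < #|STS n|%:R :> R by rewrite ltr0n eS.
have part : (#|[set S in STS n | P S]%SET| + #|Sb| = #|STS n|)%N.
  rewrite -(cardsID [set S | P S]%SET (STS n)); congr addn; apply: eq_card => S; rewrite !inE //.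
  by rewrite andbC.
have pR : #|[set S in STS n | P S]%SET|%:R + #|Sb|%:R = #|STS n|%:R :> R by rewrite -natrD part.
rewrite /uniform_Pr.
have -> : 1 - #|[set S in STS n | P S]%SET|%:R / #|STS n|%:R = #|Sb|%:R / #|STS n|%:R :> R.
  by apply: (mulIf (lt0r_neq0 S0')); rewrite mulrBl mul1r !divfK ?lt0r_neq0 // -pR addrC addKr.
rewrite ger0_norm ?divr_ge0 // ler_pdivrMr // mulrC.
exact: bad.
Qed.

Lemma prob_limit :
    uniform_Pr R (STS n)
        (fun S => (alpha3_star S)%:R <= n%:R `^ (1 - delta) :> R)
      @[n --> within [set n : nat | (n %% 6 = 1)%N \/ (n %% 6 = 3)%N] \oo]
      --> (1 : R).
Proof.
apply/cvgrPdist_le => e e0.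
pose b : R := expR (400 * RR%:R ^+ 2) + e^-1.
exists (Num.truncn b).+1 => // n /= bn n6.
have ei : 0 < e^-1 by rewrite invr_gt0.
have ex : 0 < expR (400 * RR%:R ^+ 2) :> R := expR_gt0 _.
have b0 : 0 <= b by rewrite /b; lra.
have bn' : b <= n%:R.
  have /andP[_ h] := truncn_itv b0; apply: le_trans (ltW h) _; by rewrite ler_nat.
apply: le_trans (prob_bound n6 _) _; first by move: bn'; rewrite /b; lra.
rewrite expRN invf_ple ?posrE ?expR_gt0 //.
apply: le_trans (expR_ge1Dx _); move: bn'; rewrite /b; lra.
Qed.

End Limit.

Theorem theorem3p1 (R : realType) :
  exists delta : R, 0 < delta /\
    uniform_Pr R (STS n)
        (fun S => (alpha3_star S)%:R <= n%:R `^ (1 - delta) :> R)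
      @[n --> within [set n : nat | (n %% 6 = 1)%N \/ (n %% 6 = 3)%N] \oo]
      --> (1 : R).
Proof.
(* The drift estimate needs [K = 200]; then [A = 21 * K + 6], the bound on [RR] is taken with
   equality, and the exponent is [1 / (3 * RR)]. *)
exists (3 * (2 * (21 * 200 + 6) + 60)%N%:R)^-1; split.
  by rewrite invr_gt0 mulr_gt0 // ltr0n addn_gt0 orbT.
have := @prob_limit R 200 (21 * 200 + 6) (2 * (21 * 200 + 6) + 60) (leqnn _) (erefl _) (leqnn _).
apply.
Qed.
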